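(* Let $n\ge2$ and let $K$ be a convex body in $\mathbb{R}^n$ whose Santal\'o point is the origin, such that $\partial K$ is of class $C^2$ and has strictly positive Gaussian curvature everywhere. Then $$\lim_{\delta\to0}c_n\,\frac{|(K_{\delta|K|})^0|-|K^0|}{(\delta|K|)^{\frac{2}{n+1}}}=\int_{S^{n-1}}\frac{d\sigma(u)}{f_K(u)^{\frac{1}{n+1}}\,h_K(u)^{n+1}},$$ where $c_n=2\big(\frac{v_{n-1}}{n+1}\big)^{\frac{2}{n+1}}$.
   Context: For a convex body $K$, its Santal\'o point is the unique interior point $x$ minimizing the volume of $\{y:\langle y,z-x\rangle\le1\ \forall z\in K\}$; for a convex body $L$ containing the origin in its interior, $L^0=\{y:\langle y,z\rangle\le1\ \forall z\in L\}$ is its polar body. Floating body: for $u\in S^{n-1}$ and $\delta'>0$ small, let $a^u_{\delta'}$ be defined by $|\{x\in K:\langle x,u\rangle\ge a^u_{\delta'}\}|=\delta'$, and $K_{\delta'}=\bigcap_{u\in S^{n-1}}\{x\in K:\langle x,u\rangle\le a^u_{\delta'}\}$. $|\cdot|$ is $n$-dimensional volume, $v_{n-1}$ is the volume of the $(n-1)$-dimensional Euclidean unit ball, $\sigma$ is spherical Lebesgue measure, $h_K$ the support function of $K$, and $f_K(u)$ the reciprocal of the Gauss curvature of $\partial K$ at the point with outer normal $u$. *)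

(* Defs.v *)
From HB Require Import structures.
From mathcomp Require Import all_boot all_order all_algebra.
From mathcomp Require Import all_classical all_reals all_analysis.
Set Implicit Arguments. Unset Strict Implicit. Unset Printing Implicit Defensive.
Import Order.TTheory GRing.Theory Num.Theory.
Import numFieldNormedType.Exports.
Local Open Scope classical_set_scope.
Local Open Scope ring_scope.

Definition dot (R : realType) (n : nat) (x y : 'rV[R]_n) : R :=
  \sum_(i < n) x 0 i * y 0 i.
Definition enorm (R : realType) (n : nat) (x : 'rV[R]_n) : R :=
  Num.sqrt (dot x x).

Definition vcons (R : realType) (n : nat) (x : R) (y : 'rV[R]_n) : 'rV[R]_n.+1 :=
  \row_(i < n.+1) match unlift ord0 i with Some j => y 0 j | None => x end.

(** n-dimensional Lebesgue integral of a nonnegative Borel function,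
    as the iterated (Tonelli) integral w.r.t. 1-dim Lebesgue measure *)
Fixpoint iint (R : realType) (n : nat) : ('rV[R]_n -> \bar R) -> \bar R :=
  match n return ('rV[R]_n -> \bar R) -> \bar R with
  | 0 => fun f => f 0
  | m.+1 => fun f =>
      (\int[@lebesgue_measure R]_(x in setT) iint (fun y => f (vcons x y)))%E
  end.

Definition vol (R : realType) (n : nat) (A : set 'rV[R]_n) : \bar R :=
  iint (fun x => (\1_A x)%:E).
Definition volR (R : realType) (n : nat) (A : set 'rV[R]_n) : R := fine (vol A).

(** integral over S^{n-1} w.r.t. spherical Lebesgue measure sigma, via
    sigma(A) = n |{t u : u in A, 0 < t <= 1}| (polar coordinates) *)
Definition sphint (R : realType) (n : nat) (g : 'rV[R]_n -> R) : R :=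
  n%:R * fine (iint (fun x : 'rV[R]_n =>
     if (0 < enorm x) && (enorm x <= 1) then (g ((enorm x)^-1 *: x))%:E
     else 0%E)).

Definition vball (R : realType) (m : nat) : R :=
  volR [set x : 'rV[R]_m | enorm x <= 1].

Definition convex_set (R : realType) (n : nat) (K : set 'rV[R]_n) : Prop :=
  forall x y t, K x -> K y -> 0 <= t <= 1 -> K (t *: x + (1 - t) *: y).
Definition convex_body (R : realType) (n : nat) (K : set 'rV[R]_n) : Prop :=
  convex_set K /\ compact K /\ interior K !=set0.

Definition polar (R : realType) (n : nat) (L : set 'rV[R]_n) : set 'rV[R]_n :=
  [set y | forall z, L z -> dot y z <= 1].

(** the Santalo point of K is the origin: 0 is an interior point minimizing
    x |-> |{y : <y, z - x> <= 1 for all z in K}| over interior points x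
    (the minimizer is unique, so this says the Santalo point is 0) *)
Definition santalo_at_origin (R : realType) (n : nat) (K : set 'rV[R]_n) : Prop :=
  interior K 0 /\
  forall x, interior K x ->
    (vol (polar K) <= vol [set y | forall z, K z -> (dot y (z - x) <= 1)%R])%E.

Definition floating_body (R : realType) (n : nat) (K : set 'rV[R]_n) (d : R)
  : set 'rV[R]_n :=
  [set x | K x /\ forall u a, enorm u = 1 ->
      vol [set y | K y /\ a <= dot y u] = d%:E -> dot x u <= a].

Definition supp_fun (R : realType) (n : nat) (K : set 'rV[R]_n) (u : 'rV[R]_n) : R :=
  sup [set dot u x | x in K].

Definition evec (R : realType) (n : nat) (i : 'I_n) : 'rV[R]_n := delta_mx 0 i.
Definition partial (R : realType) (n : nat) (i : 'I_n) (F : 'rV[R]_n -> R)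
  (x : 'rV[R]_n) : R := 'D_(evec R i) F x.
Definition grad (R : realType) (n : nat) (F : 'rV[R]_n -> R) (x : 'rV[R]_n)
  : 'rV[R]_n := \row_i partial i F x.
Definition hess (R : realType) (n : nat) (F : 'rV[R]_n -> R) (x : 'rV[R]_n)
  : 'M[R]_n := \matrix_(i, j) partial j (partial i F) x.

Definition C2_on (R : realType) (n : nat) (U : set 'rV[R]_n) (F : 'rV[R]_n -> R)
  : Prop :=
  forall y, U y -> {for y, continuous F} /\
    forall i j : 'I_n,
      derivable F y (evec R i) /\ {for y, continuous (partial i F)} /\
      derivable (partial i F) y (evec R j) /\
      {for y, continuous (partial j (partial i F))}.

Definition bd (R : realType) (n : nat) (K : set 'rV[R]_n) : set 'rV[R]_n :=
  closure K `\` interior K.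

Definition local_def (R : realType) (n : nat) (K : set 'rV[R]_n) (x : 'rV[R]_n)
  (U : set 'rV[R]_n) (F : 'rV[R]_n -> R) : Prop :=
  open U /\ U x /\ C2_on U F /\ (forall y, U y -> grad F y != 0) /\
  (forall y, U y -> (K y <-> F y <= 0)).

Definition C2_boundary (R : realType) (n : nat) (K : set 'rV[R]_n) : Prop :=
  forall x, bd K x -> exists U F, local_def K x U F.

(** Gauss curvature at x of the level hypersurface {F = 0} (outer normal
    grad F / |grad F|), by the bordered Hessian formula
    kappa = - det [[D^2 F, grad F^T], [grad F, 0]] / |grad F|^(n+1) *)
Definition gauss_curv (R : realType) (n : nat) (F : 'rV[R]_n -> R) (x : 'rV[R]_n)
  : R :=
  - \det (block_mx (hess F x) (grad F x)^T (grad F x) (0 : 'M[R]_(1, 1)))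
    / enorm (grad F x) ^+ n.+1.

Definition pos_gauss_curv (R : realType) (n : nat) (K : set 'rV[R]_n) : Prop :=
  forall x U F, bd K x -> local_def K x U F -> 0 < gauss_curv F x.

Definition curv_at_normal (R : realType) (n : nat) (K : set 'rV[R]_n)
  (u : 'rV[R]_n) (kappa : R) : Prop :=
  exists x U F, bd K x /\ local_def K x U F /\
    (enorm (grad F x))^-1 *: grad F x = u /\ kappa = gauss_curv F x.

Definition fK (R : realType) (n : nat) (K : set 'rV[R]_n) (u : 'rV[R]_n) : R :=
  (xget 0 (curv_at_normal K u))^-1.

(* Main.v *)
(* Write h and h_d for the support functions of K and of its floating body, and
   s for the (n+1)-st root of d = delta |K|.  In polar coordinates |L^0| is the
   integral over the sphere of h_L^-n / n, so it suffices to show that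
   (h - h_d) / s^2 converges pointwise to kappa^(1/(n+1)) / c_n and stays bounded,
   and to apply dominated convergence.

   For the pointwise limit, K is compared near the boundary point x with normal u
   to ellipsoids through x with the same tangent plane: by the Taylor expansion
   of a defining function, for every k1 > kappa(x) (resp. k1 < kappa(x)) there is
   such an ellipsoid of curvature at most (at least) k1 at x contained in K
   (containing K near x).  For an ellipsoid, that is, after an affine change of
   variables, for the unit ball, the height of the cap of volume d is explicit up
   to lower order terms.
   The uniform bound comes from the same estimate applied to a ball of fixed
   radius that can be rolled inside K (compactness of the boundary). *)

Require Import Defs.
From HB Require Import structures.
From mathcomp Require Import all_boot all_order all_algebra.
From mathcomp Require Import all_classical all_reals all_analysis.
From mathcomp Require Import measurable_realfun ring lra perm.
Set Implicit Arguments. Unset Strict Implicit. Unset Printing Implicit Defensive.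
Import Order.TTheory GRing.Theory Num.Theory.
Import numFieldNormedType.Exports.
Local Open Scope classical_set_scope.
Local Open Scope ring_scope.

(** * Borel sets and Lebesgue measure on row vectors *)

(** The exponent 1/(n+1) and the constant come from one scaling computation. With gam = [cap_scale],
    a cap of depth t of the unit ball has volume about (gam sqrt t)^(n+1). The map z -> c + z T
    multiplies volumes by |det T| = D^(n+1) and depths in direction u by th = |u T^T|, so the cap of
    volume s^(n+1) of the image has depth about (th / D^2) s^2 / gam^2; and th^(n+1) / (det T)^2 =
    (th / D^2)^(n+1) is the curvature of the ellipsoid at its point of normal u. Thus only the
    curvature survives, and gam^2 = c_n. Two obstacles shape the proof. The Hessian of a defining
    function has a sign only on the tangent hyperplane, so it does not define an ellipsoid; a
    multiple of g^T g is added, which the curvature ignores. And volumes are given as iterated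
    integrals, whereas linear substitutions and dominated convergence need a measure, so one is
    built first and identified with them. The factor n produced by differentiating h^-n cancels the
    1/n of the polar volume. *)

Section RowVectorBorel.
Variable R : realType.

(** With coordinate preimages as generators, measurability of a row-valued map is a coordinatewise
    matter ([measurable_rvP]); that open sets are in the generated sigma-algebra is
    [open_measurable_rv]. *)
Definition rv_gen n : set (set 'rV[R]_n) :=
  [set A | exists i (B : set R), measurable B /\ A = (fun x : 'rV[R]_n => x 0 i) @^-1` B].

Definition rv_measurable n := <<s @rv_gen n >>.

Fact rv_measurable0 n : @rv_measurable n set0.
Proof. exact: sigma_algebra0. Qed.

Fact rv_measurableC n (A : set 'rV[R]_n) :
  rv_measurable A -> rv_measurable (~` A).
Proof. exact: sigma_algebraC. Qed.

Fact rv_measurable_bigcup n (F : (set 'rV[R]_n)^nat) :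
  (forall i, rv_measurable (F i)) -> rv_measurable (\bigcup_i (F i)).
Proof. exact: sigma_algebra_bigcup. Qed.

End RowVectorBorel.

Fact rv_display : measure_display. Proof. exact: default_measure_display. Qed.

HB.instance Definition _ (R : realType) n := @isMeasurable.Build rv_display
  'rV[R]_n (@rv_measurable R n) (@rv_measurable0 R n) (@rv_measurableC R n)
  (@rv_measurable_bigcup R n).

Section RowVectorMeasurability.
Variable R : realType.

Lemma measurable_coord n (i : 'I_n) :
  measurable_fun setT (fun x : 'rV[R]_n => x 0 i).
Proof.
move=> _ B mB; rewrite setTI; apply: sub_sigma_algebra; exists i, B; split => //.
Qed.

Lemma measurable_rvP d (T : measurableType d) n (f : T -> 'rV[R]_n) :
  (forall i, measurable_fun setT (fun t => f t 0 i)) -> measurable_fun setT f.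
Proof.
move=> mf; apply: (@measurability _ _ _ _ _ _ (@rv_gen R n)) => //.
move=> _ [_ [i [B [mB ->]]] <-]; rewrite setTI.
by rewrite -[X in measurable X]setTI; exact: mf.
Qed.

Lemma vcons0 n x (y : 'rV[R]_n) : vcons x y 0 ord0 = x.
Proof. by rewrite mxE unlift_none. Qed.

Lemma vconsS n x (y : 'rV[R]_n) i : vcons x y 0 (lift ord0 i) = y 0 i.
Proof. by rewrite mxE liftK. Qed.

Definition vtail n (x : 'rV[R]_n.+1) : 'rV[R]_n := \row_i x 0 (lift ord0 i).

Lemma vcons_eta n (x : 'rV[R]_n.+1) : vcons (x 0 ord0) (vtail x) = x.
Proof.
apply/rowP => i; case: (unliftP ord0 i) => [j ->|->]; last by rewrite vcons0.
by rewrite vconsS mxE.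
Qed.

Lemma vtail_vcons n x (y : 'rV[R]_n) : vtail (vcons x y) = y.
Proof. by apply/rowP => i; rewrite mxE vconsS. Qed.

Lemma measurable_vcons d (T : measurableType d) n (f : T -> R)
    (g : T -> 'rV[R]_n) :
  measurable_fun setT f -> measurable_fun setT g ->
  measurable_fun setT (fun t => vcons (f t) (g t)).
Proof.
move=> mf mg; apply: measurable_rvP => i; case: (unliftP ord0 i) => [j ->|->].
  under eq_fun do rewrite vconsS.
  exact: (measurableT_comp (measurable_coord j) mg).
by under eq_fun do rewrite vcons0.
Qed.

Lemma measurable_vtail n : measurable_fun setT (@vtail n).
Proof.
apply: measurable_rvP => i; under eq_fun do rewrite mxE; exact: measurable_coord.
Qed.

(** An open set is the union of the countably many rational boxes inside it, and a box is a finite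
    intersection of coordinate conditions. *)
Lemma open_measurable_rv n (A : set 'rV[R]_n) : open A -> measurable A.
Proof.
move=> oA.
pose box (q : 'rV[rat]_n * rat) : set 'rV[R]_n :=
  \bigcap_(i in [set: 'I_n]) ((fun x : 'rV[R]_n => x 0 i) @^-1`
    (ball (ratr (q.1 0 i) : R) (ratr q.2))).
have mbox q : measurable (box q).
  apply: fin_bigcap_measurable => // i _.
  by rewrite -[X in measurable X]setTI; apply: measurable_coord => //;
    exact: measurable_ball.
have -> : A = \bigcup_(q : 'rV[rat]_n * rat)
    (if `[< box q `<=` A >] then box q else set0).
  apply/seteqP; split => [x Ax|x [q _]]; last first.
    by case: ifP => // /asboolP; apply.
  have /nbhs_ballP[e /= e0 xeA] : nbhs x A by exact: open_nbhs_nbhs.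
  (* Half of [e], because the rational centre is itself displaced from [x] by up to the radius
     [r]. *)
  have e20 : 0 < e / 2 by rewrite divr_gt0.
  have [r] := rat_in_itvoo e20; rewrite in_itv /= => /andP[r0 re].
  have /choice[q Hq] (i : 'I_n) :
      exists q : rat, `|x 0 i - ratr q| < (ratr r : R).
    have [q] := @rat_in_itvoo R (x 0 i - ratr r) (x 0 i + ratr r)
      ltac:(by rewrite ltrBlDr -addrA ltrDl addr_gt0).
    by rewrite in_itv /= => hq; exists q; rewrite ltr_distlC.
  exists (\row_i q i, r) => //.
  have bA : box (\row_i q i, r) `<=` A.
    move=> y yb; apply: xeA; split=> // i j; rewrite (ord1 i) => {i}.
    have := yb j I; rewrite /ball /= mxE => h1.
    have h2 := Hq j; rewrite (le_lt_trans (ler_distD (ratr (q j)) _ _))//.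
    by rewrite [e]splitr ltrD// (lt_trans _ re).
  by rewrite asboolT// => i _; rewrite /= mxE /ball /= distrC.
apply: countable_bigcupT_measurable => [|q]; first exact: countableP.
by case: ifP.
Qed.

Lemma closed_measurable_rv n (A : set 'rV[R]_n) : closed A -> measurable A.
Proof.
by move=> cA; rewrite -(setCK A); apply: measurableC; apply: open_measurable_rv;
  rewrite openC.
Qed.

Lemma continuous_measurable_rv n (f : 'rV[R]_n -> R) :
  continuous f -> measurable_fun setT f.
Proof.
move=> cf; apply: (measurability _ (RGenOpens.measurableE R)).
move=> _ [_ [a [b ->] <-]]; rewrite setTI.
by apply: open_measurable_rv; apply: open_comp => //; exact: interval_open.
Qed.

End RowVectorMeasurability.

Section RowVectorLebesgue.
Variable R : realType.

Let vpair m (p : R * 'rV[R]_m) : 'rV[R]_m.+1 := vcons p.1 p.2.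

Let measurable_vpair m :
  measurable_fun setT (@vpair m : measurableTypeR R * 'rV[R]_m -> 'rV[R]_m.+1).
Proof. exact: (measurable_vcons measurable_fst measurable_snd). Qed.

(** The product of Lebesgue measure with [mu], carried to row vectors by prepending a coordinate.
    This copies the recursion of [iint], so that identifying the two is Tonelli's theorem. *)
Definition rvleb_step m (mu : {sigma_finite_measure set 'rV[R]_m -> \bar R}) :=
  pushforward (@lebesgue_measure R \x mu)%E (@vpair m).

Section Step.
Variables (m : nat) (mu : {sigma_finite_measure set 'rV[R]_m -> \bar R}).

HB.instance Definition _ := Measure.copy (rvleb_step mu)
  (@measure_function_pushforward__canonical__measure_function_Measure _ _ _ _ R
     (@lebesgue_measure R \x mu)%E (@vpair m) (@measurable_vpair m)).

Let sigma_finite_step : sigma_finite setT (rvleb_step mu).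
Proof.
have /sigma_finiteP[F [FT ndF Foo]] := sigma_finiteT (@lebesgue_measure R).
have /sigma_finiteP[G [GT ndG Goo]] := sigma_finiteT mu.
have [mF Ffin] := all_and2 Foo; have [mG Gfin] := all_and2 Goo.
exists (fun k => [set x : 'rV[R]_m.+1 | F k (x 0 ord0)] `&` (@vtail R m @^-1` G k)).
  apply/seteqP; split => // x _.
  have [i _ Fx] : (\bigcup_i F i) (x 0 ord0) by rewrite -FT.
  have [j _ Gx] : (\bigcup_i G i) (vtail x) by rewrite -GT.
  exists (maxn i j) => //; split.
    by have /subsetPset := ndF _ _ (leq_maxl i j); apply.
  by have /subsetPset := ndG _ _ (leq_maxr i j); apply.
move=> k; split.
  apply: measurableI; rewrite -[X in measurable X]setTI.
    exact: (measurable_coord ord0 _ (mF k)).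
  exact: (measurable_vtail _ (mG k)).
rewrite /rvleb_step /pushforward.
rewrite (_ : _ @^-1` _ = F k `*` G k).
  rewrite product_measure1E//; apply: lte_mul_pinfty => //; last exact: Gfin.
  by apply/fin_numPlt; rewrite (lt_le_trans _ (measure_ge0 _ _))// Ffin.
by apply/seteqP; split=> -[x y]; rewrite /= /vpair /= vcons0 vtail_vcons.
Qed.

HB.instance Definition _ :=
  Measure_isSigmaFinite.Build _ _ _ (rvleb_step mu) sigma_finite_step.
End Step.

Fixpoint rvleb n : {sigma_finite_measure set 'rV[R]_n -> \bar R} :=
  match n with
  | 0 => [the {sigma_finite_measure set 'rV[R]_0 -> \bar R} of
            dirac (0 : 'rV[R]_0)]
  | m.+1 => [the {sigma_finite_measure set 'rV[R]_m.+1 -> \bar R} of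
            rvleb_step (rvleb m)]
  end.

Local Open Scope ereal_scope.

Lemma integral_rvlebS n (f : 'rV[R]_n.+1 -> \bar R) :
  measurable_fun setT f -> (forall x, 0 <= f x) ->
  \int[rvleb n.+1]_x f x =
  \int[@lebesgue_measure R]_x \int[rvleb n]_y f (vcons x y).
Proof.
move=> mf f0.
rewrite [LHS](ge0_integral_pushforward (@measurable_vpair n)
  (@lebesgue_measure R \x rvleb n))//.
rewrite preimage_setT fubini_tonelli1//.
- by apply: measurableT_comp => //; exact: measurable_vpair.
- by move=> x; exact: f0.
Qed.

(** Gateway from the definitions in the statement to measure theory: volumes and spherical integrals
    become integrals against [rvleb], to which limit theorems apply. *)
Lemma iintE n (f : 'rV[R]_n -> \bar R) :
  measurable_fun setT f -> (forall x, 0 <= f x) ->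
  iint f = \int[rvleb n]_x f x.
Proof.
elim: n f => [|n IH] f mf f0.
  rewrite /= integral_dirac//= diracT mul1e//.
rewrite [RHS](integral_rvlebS mf f0) /=; apply: eq_integral => x _; rewrite IH//.
by apply: (measurableT_comp mf); apply: measurable_vcons.
Qed.

Lemma volE n (A : set 'rV[R]_n) : measurable A -> vol A = rvleb n A.
Proof.
move=> mA; rewrite /vol iintE ?integral_indic ?setIT//.
by apply/measurable_EFinP; exact: measurable_indic.
Qed.

Lemma integral_rvleb_swap n (f : R -> 'rV[R]_n -> \bar R) :
  measurable_fun setT (fun p : measurableTypeR R * 'rV[R]_n => f p.1 p.2) ->
  (forall x y, 0 <= f x y) ->
  \int[@lebesgue_measure R]_x \int[rvleb n]_y f x y =
  \int[rvleb n]_y \int[@lebesgue_measure R]_x f x y.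
Proof.
move=> mf f0.
exact: (@fubini_tonelli _ _ (measurableTypeR R) _ R _ _ (fun p => f p.1 p.2)).
Qed.

End RowVectorLebesgue.

(** * Change of variables *)

Section AffineChangeOfVariables.
Variable R : realType.
Local Open Scope ereal_scope.

Let lam := @lebesgue_measure R.

Lemma measurable_affine (a b : R) :
  measurable_fun setT (fun x : measurableTypeR R => a * x + b : measurableTypeR R)%R.
Proof.
apply: continuous_measurable_fun => x; apply: cvgD; last exact: cvg_cst.
by apply: cvgM; [exact: cvg_cst|exact: cvg_id].
Qed.

Section AffineMeasure.
Variables (a b : R).
Hypothesis a0 : (a != 0)%R.

Let phi (x : measurableTypeR R) : measurableTypeR R := (a * x + b)%R.
Let nu : {measure set (measurableTypeR R) -> \bar R} :=
  @measure_function_pushforward__canonical__measure_function_Measure _ _ _ _ R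
     lam phi (measurable_affine a b).
Let mu : {measure set (measurableTypeR R) -> \bar R} :=
  mscale (NngNum (@normr_ge0 R R a)) nu.

(** Lebesgue measure is determined by its values on half-open intervals. A negative [a] reverses an
    interval and swaps its closed end, whence two cases. *)
Let lebesgue_affine (A : set (measurableTypeR R)) : measurable A -> lam A = mu A.
Proof.
apply: (@lebesgue_measure_unique R mu) => _ [[x y] /= xy <-].
rewrite /mu /mscale/= /pushforward -!/lam.
have [apos|aneg] := ltP 0%R a.
  rewrite (_ : phi @^-1` _ = `](x - b) / a, (y - b) / a]%classic)%R; last first.
    apply/seteqP; split => z; rewrite /phi /= !in_itv /=;
      by rewrite ltr_pdivrMr// ler_pdivlMr// [(z * a)%R]mulrC ltrBlDr lerBrDr.
  rewrite /lam !lebesgue_measure_itv /= !lte_fin ltr_pM2r ?invr_gt0//.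
  rewrite ltrD2r; case: ifP => _; last by rewrite mule0.
  rewrite -!EFinD -EFinM gtr0_norm//; congr EFin; field => //.
have {aneg}an : (a < 0)%R by rewrite lt_neqAle a0.
rewrite (_ : phi @^-1` _ = `[(y - b) / a, (x - b) / a[%classic)%R; last first.
  apply/seteqP; split => z; rewrite /phi /= !in_itv /=;
    rewrite ltr_ndivlMr// ler_ndivrMr// [(z * a)%R]mulrC ltrBlDr lerBrDr;
    by rewrite andbC.
rewrite /lam !lebesgue_measure_itv /= !lte_fin ltr_nM2r ?invr_lt0//.
rewrite ltrD2r; case: ifP => _; last by rewrite mule0.
rewrite -!EFinD -EFinM ltr0_norm//; congr EFin; field => //.
Qed.

Lemma integral_lebesgue_affine (f : measurableTypeR R -> \bar R) :
  measurable_fun setT f -> (forall x, 0 <= f x) ->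
  \int[lam]_x f (a * x + b)%R = (`|a|^-1)%:E * \int[lam]_x f x.
Proof.
move=> mf f0.
have -> : \int[lam]_x f x = \int[mu]_x f x.
  by apply: eq_measure_integral => A mA _; exact: lebesgue_affine.
rewrite ge0_integral_mscale//= muleA -EFinM mulVf ?normr_eq0// mul1e.
rewrite (ge0_integral_pushforward (measurable_affine a b) lam)//.
Qed.
End AffineMeasure.

Lemma rvleb_translate n (c : 'rV[R]_n) (f : 'rV[R]_n -> \bar R) :
  measurable_fun setT f -> (forall x, 0 <= f x) ->
  \int[rvleb R n]_x f (x + c)%R = \int[rvleb R n]_x f x.
Proof.
have mD m (d : 'rV[R]_m) : measurable_fun setT (fun x : 'rV[R]_m => (x + d)%R).
  apply: measurable_rvP => i; under eq_fun do rewrite mxE.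
  by apply: measurable_funD => //; exact: measurable_coord.
elim: n c f => [|n IH] c f mf f0.
  apply: eq_integral => x _; rewrite (_ : (x + c)%R = x)//.
  by apply/rowP => -[].
rewrite [LHS]integral_rvlebS//; last exact: (measurableT_comp mf (mD _ c)).
rewrite [RHS](integral_rvlebS mf f0).
have vconsD x (y : 'rV[R]_n) :
    (vcons x y + c = vcons (x + c 0 ord0) (y + vtail c))%R.
  apply/rowP => i; rewrite mxE; case: (unliftP ord0 i) => [j ->|->].
    by rewrite !vconsS !mxE.
  by rewrite !vcons0.
pose g (x : measurableTypeR R) := \int[rvleb R n]_y f (vcons x y).
have mfv : measurable_fun setT (fun p : measurableTypeR R * 'rV[R]_n =>
    f (vcons p.1 p.2)).
  by apply: (measurableT_comp mf); apply: measurable_vcons.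
transitivity (\int[lam]_x g (1 * x + c 0 ord0)%R).
  apply: eq_integral => x _; rewrite mul1r.
  under eq_integral do rewrite vconsD.
  rewrite (IH (vtail c) (fun y => f (vcons (x + c 0 ord0)%R y)))//.
  by apply: (measurableT_comp mf); apply: measurable_vcons.
rewrite (@integral_lebesgue_affine 1%R _ (oner_neq0 _) g) ?normr1 ?invr1 ?mul1e//.
- exact: (measurable_fun_fubini_tonelli_F _ mfv).
- by move=> x; apply: integral_ge0.
Qed.

(** The substitution rule as a property of the matrix: it is stable under products ([covM_mul]), so
    elementary factors suffice. *)
Definition covM n (M : 'M[R]_n) := forall f : 'rV[R]_n -> \bar R,
  measurable_fun setT f -> (forall x, 0 <= f x) ->
  \int[rvleb R n]_x f (x *m M)%R = (`|\det M|^-1)%:E * \int[rvleb R n]_x f x.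

Lemma measurable_mulmxr n m (M : 'M[R]_(n, m)) :
  measurable_fun setT (fun x : 'rV[R]_n => x *m M)%R.
Proof.
apply: measurable_rvP => i; under eq_fun do rewrite mxE.
apply: measurable_sum => j; apply: measurable_funM => //.
exact: measurable_coord.
Qed.

Lemma covM_mul n (M N : 'M[R]_n) : covM M -> covM N -> covM (M *m N)%R.
Proof.
move=> hM hN f mf f0; under eq_integral do rewrite mulmxA.
rewrite (hM (fun x => f (x *m N)%R))//.
  by rewrite hN// muleA -EFinM det_mulmx normrM invfM.
exact: (measurableT_comp mf (measurable_mulmxr N)).
Qed.

Lemma vconsE n x (y : 'rV[R]_n) : vcons x y = row_mx (x%:M : 'M[R]_1)%R y.
Proof.
apply/rowP => i.
case: (unliftP ord0 i) => [j ->|->].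
  rewrite vconsS; have -> : lift ord0 j = rshift 1 j :> 'I_(1 + n) by exact/val_inj.
  exact/esym/row_mxEr.
rewrite vcons0; have -> : ord0 = lshift n (0%R : 'I_1) :> 'I_(1 + n) by exact/val_inj.
by apply/esym; rewrite (@row_mxEl _ 1 1 n) mxE eqxx mulr1n.
Qed.

(** For a fixed first coordinate x, the others undergo [S] and then the translation by [x *: c],
    which the inner integral does not see; the outer integral is a one-dimensional scaling. *)
Lemma covM_utriang n (a : R) (c : 'rV[R]_n) (S : 'M[R]_n) : (a != 0)%R ->
  covM S -> covM (block_mx (a%:M : 'M[R]_1) c 0 S : 'M[R]_(1 + n))%R.
Proof.
move=> a0 hS f mf f0.
have mulE x (y : 'rV[R]_n) : (vcons x y *m
    (block_mx (a%:M : 'M[R]_1) c 0 S : 'M[R]_(1 + n)) = vcons (a * x) (x *: c + y *m S))%R.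
  rewrite !vconsE (@mul_row_block _ 1 1 n) mulmx0 addr0 -scalar_mxM mulrC.
  by rewrite mul_scalar_mx.
have mfv : measurable_fun setT (fun p : measurableTypeR R * 'rV[R]_n =>
    f (vcons p.1 p.2)).
  by apply: (measurableT_comp mf); apply: measurable_vcons.
have mfvx x : measurable_fun setT (fun y : 'rV[R]_n => f (vcons x y)).
  by apply: (measurableT_comp mf); apply: measurable_vcons.
pose g (x : measurableTypeR R) := \int[rvleb R n]_y f (vcons x y).
rewrite [LHS]integral_rvlebS//; last exact: (measurableT_comp mf (measurable_mulmxr _)).
rewrite [in RHS](integral_rvlebS mf f0).
transitivity (\int[lam]_x ((`|\det S|^-1)%:E * g (a * x + 0)%R)).
  apply: eq_integral => x _; rewrite addr0.
  under eq_integral do rewrite mulE.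
  rewrite (hS (fun y => f (vcons (a * x) (x *: c + y))%R))//.
    congr (_ * _); under eq_integral do rewrite addrC.
    by rewrite (rvleb_translate (x *: c) (mfvx (a * x)%R)).
  apply: (measurableT_comp mf); apply: measurable_vcons => //.
  apply: measurable_rvP => i; under eq_fun do rewrite mxE.
  by apply: measurable_funD => //; exact: measurable_coord.
have mg : measurable_fun setT g by exact: (measurable_fun_fubini_tonelli_F _ mfv).
have g0 x : 0 <= g x by apply: integral_ge0.
rewrite (ge0_integralZl_EFin _ measurableT (fun x _ => g0 _)
  (measurableT_comp mg (measurable_affine _ _))); last by rewrite invr_ge0.
rewrite (@integral_lebesgue_affine a 0%R a0 g)// muleA -EFinM.
by rewrite (@det_ublock _ 1 n) det_scalar1 normrM invfM mulrC.
Qed.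

(** The first coordinate is translated by a function of the others, so it has to be the inner
    variable: hence the exchange of the order of integration. *)
Lemma covM_shear n (b : 'cV[R]_n) :
  covM (block_mx (1%:M : 'M[R]_1) 0 b 1%:M : 'M[R]_(1 + n))%R.
Proof.
move=> f mf f0.
have mulE x (y : 'rV[R]_n) : (vcons x y *m
    (block_mx (1%:M : 'M[R]_1) 0 b 1%:M : 'M[R]_(1 + n)) =
    vcons (1 * x + (y *m b) 0 0) y)%R.
  rewrite !vconsE (@mul_row_block _ 1 1 n) mulmx0 add0r !mulmx1.
  congr row_mx; apply/matrixP => i j; rewrite !ord1 mxE.
  by rewrite !mxE !eqxx !mulr1n mul1r.
have mfv : measurable_fun setT (fun p : measurableTypeR R * 'rV[R]_n =>
    f (vcons p.1 p.2)).
  by apply: (measurableT_comp mf); apply: measurable_vcons.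
have mb : measurable_fun setT (fun y : 'rV[R]_n => (y *m b) 0 0)%R.
  apply: (measurableT_comp (measurable_coord 0%R)); exact: measurable_mulmxr.
rewrite [LHS]integral_rvlebS//; last exact: (measurableT_comp mf (measurable_mulmxr _)).
rewrite [in RHS](integral_rvlebS mf f0).
rewrite (@det_lblock _ 1 n) !det1 mulr1 normr1 invr1 mul1e.
rewrite integral_rvleb_swap//; last first.
  under eq_fun do rewrite mulE.
  apply: (measurableT_comp mf); apply: measurable_vcons => //.
  by apply: measurable_funD; [apply: measurable_funM|exact: (measurableT_comp mb)].
rewrite [RHS](integral_rvleb_swap mfv (fun x y => f0 _)).
apply: eq_integral => y _.
under eq_integral do rewrite mulE.
rewrite (@integral_lebesgue_affine 1%R _ (oner_neq0 _) (fun x => f (vcons x y)))//.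
  by rewrite normr1 invr1 mul1e.
by apply: (measurableT_comp mf); apply: measurable_vcons.
Qed.

(* Block elimination on the (0,0) entry; if it vanishes, a shear adding a row
   with non-zero first entry makes it non-zero. *)
Theorem covM_unit n (M : 'M[R]_n) : \det M != 0%R -> covM M.
Proof.
elim: n M => [|n IH] M.
  move=> _ f mf f0; rewrite det_mx00 normr1 invr1 mul1e.
  by apply: eq_integral => x _; rewrite (_ : x *m M = x)%R//; apply/rowP => -[].
have covM1 k : @covM k 1%:M%R.
  by move=> f mf f0; rewrite det1 normr1 invr1 mul1e; under eq_integral do rewrite mulmx1.
have pivot (A : 'M[R]_(1 + n)) : (ulsubmx A 0 0 != 0 -> \det A != 0 -> covM A)%R.
  set a := ulsubmx A 0%R 0%R => a0.
  (* [S] is the Schur complement of the pivot; the two factors are those of a block LU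
     decomposition. *)
  pose S := (drsubmx A - a^-1 *: (dlsubmx A *m ursubmx A))%R.
  have -> : (A = block_mx (1%:M : 'M[R]_1) 0 (a^-1 *: dlsubmx A) 1%:M *m
             block_mx (a%:M : 'M[R]_1) (ursubmx A) 0 S)%R.
    rewrite mulmx_block !mulmx0 !mul0mx !mul1mx !addr0.
    rewrite -scalemxAl -[a%:M]scalemx1 -scalemxAr mulmx1 scalerA mulVf// scale1r.
    rewrite -scalemxAl addrC subrK scalemx1.
    rewrite [LHS](esym (submxK A)); congr block_mx.
    by apply/matrixP => i j; rewrite !ord1 [RHS]mxE eqxx mulr1n.
  rewrite det_mulmx (@det_lblock _ 1 n) !det1 !mul1r (@det_ublock _ 1 n) det_scalar1.
  rewrite mulf_eq0 negb_or => /andP[_ S0].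
  by apply: covM_mul; [exact: covM_shear|apply: covM_utriang => //; exact: IH].
move=> M0; have [c0|] := eqVneq (ulsubmx (M : 'M[R]_(1 + n)) 0 0)%R 0%R; last first.
  by move=> h; exact: pivot.
have [dl0|[i ci]] : dlsubmx (M : 'M[R]_(1 + n)) = 0%R \/
    exists i, dlsubmx (M : 'M[R]_(1 + n)) i 0%R != 0%R.
  have [?|h] := eqVneq (dlsubmx (M : 'M[R]_(1 + n))) 0%R; first by left.
  right; apply/existsP; rewrite -negb_forall; apply/negP => /forallP h'.
  move/eqP: h; apply; apply/matrixP => i j; rewrite !ord1 [RHS]mxE; apply/eqP.
  exact: h'.
  move: M0; rewrite -(@submxK _ 1 n 1 n M) dl0 (@det_ublock _ 1 n).
  by rewrite {1}[ulsubmx _]mx11_scalar det_scalar1 c0 mul0r eqxx.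
pose U (e : R) : 'M[R]_(1 + n) :=
  block_mx (1%:M%R : 'M[R]_1) (e *: delta_mx 0%R i)%R 0%R 1%:M%R.
have detU e : \det (U e) = 1%R by rewrite (@det_ublock _ 1 n) !det1 mulr1.
have -> : M = (U (-1) *m (U 1 *m (M : 'M[R]_(1 + n))))%R.
  rewrite mulmxA mulmx_block !mulmx0 !mul0mx !mul1mx !mulmx1 !addr0 add0r.
  by rewrite scaleN1r scale1r subrr -(@scalar_mx_block _ 1 n) mul1mx.
apply: covM_mul; first by apply: covM_utriang; rewrite ?oner_neq0.
apply: pivot; last by rewrite det_mulmx detU mul1r.
rewrite -{1}(@submxK _ 1 n 1 n M) mulmx_block block_mxKul mul1mx mxE c0 add0r.
rewrite scale1r mxE (bigD1 i)//= big1 => [|j ji].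
  by rewrite mxE !eqxx mul1r addr0.
by rewrite mxE eqxx (negbTE ji) mul0r.
Qed.

End AffineChangeOfVariables.

(** * Euclidean norm, balls and hyperplanes *)

Section Euclidean.
Variables (R : realType) (n : nat).
Implicit Types (x y z : 'rV[R]_n) (a : R).

Lemma dotC x y : dot x y = dot y x.
Proof. by apply: eq_bigr => i _; rewrite mulrC. Qed.

Lemma dotDl x y z : dot (x + y) z = dot x z + dot y z.
Proof. by rewrite -big_split; apply: eq_bigr => i _; rewrite mxE mulrDl. Qed.

Lemma dotZl a x y : dot (a *: x) y = a * dot x y.
Proof. by rewrite mulr_sumr; apply: eq_bigr => i _; rewrite mxE mulrA. Qed.

Lemma dotDr x y z : dot z (x + y) = dot z x + dot z y.
Proof. by rewrite dotC dotDl !(dotC z). Qed.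

Lemma dotZr a x y : dot x (a *: y) = a * dot x y.
Proof. by rewrite dotC dotZl dotC. Qed.

Lemma dotNl x y : dot (- x) y = - dot x y.
Proof. by rewrite -scaleN1r dotZl mulN1r. Qed.

Lemma dotNr x y : dot x (- y) = - dot x y.
Proof. by rewrite dotC dotNl dotC. Qed.

Lemma dotBl x y z : dot (x - y) z = dot x z - dot y z.
Proof. by rewrite dotDl dotNl. Qed.

Lemma dotBr x y z : dot z (x - y) = dot z x - dot z y.
Proof. by rewrite dotDr dotNr. Qed.

Lemma dot0l x : dot 0 x = 0.
Proof. by rewrite -(scale0r 0) dotZl mul0r. Qed.

Lemma dot0r x : dot x 0 = 0.
Proof. by rewrite dotC dot0l. Qed.

Lemma dotE x y : dot x y = (x *m y^T) 0 0.
Proof. by rewrite mxE; apply: eq_bigr => i _; rewrite mxE. Qed.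

Lemma dot_ge0 x : 0 <= dot x x.
Proof. by apply: sumr_ge0 => i _; rewrite -expr2 sqr_ge0. Qed.

Lemma dot_eq0 x : (dot x x == 0) = (x == 0).
Proof.
apply/idP/eqP => [|->]; last by rewrite dot0l.
rewrite /dot psumr_eq0 => [/allP h|i _]; last by rewrite -expr2 sqr_ge0.
apply/rowP => i; rewrite mxE; apply/eqP; rewrite -sqrf_eq0 expr2.
by have := h i; rewrite mem_index_enum => /(_ isT).
Qed.

Lemma dot_delta x (i : 'I_n) : dot x (delta_mx 0 i) = x 0 i.
Proof.
rewrite /dot (bigD1 i)//= mxE !eqxx mulr1 big1 ?addr0// => j ji.
by rewrite mxE eqxx (negbTE ji) mulr0.
Qed.

Lemma enorm_ge0 x : 0 <= enorm x.
Proof. exact: sqrtr_ge0. Qed.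

Lemma sqr_enorm x : enorm x ^+ 2 = dot x x.
Proof. by rewrite sqr_sqrtr// dot_ge0. Qed.

Lemma enorm_eq0 x : (enorm x == 0) = (x == 0).
Proof. by rewrite -dot_eq0 -sqr_enorm sqrf_eq0. Qed.

Lemma enorm0 : enorm (0 : 'rV[R]_n) = 0.
Proof. by apply/eqP; rewrite enorm_eq0. Qed.

Lemma enorm_gt0 x : (0 < enorm x) = (x != 0).
Proof. by rewrite lt_def enorm_ge0 andbT enorm_eq0. Qed.

Lemma enormZ a x : enorm (a *: x) = `|a| * enorm x.
Proof.
by rewrite /enorm dotZl dotZr mulrA -expr2 sqrtrM ?sqr_ge0// sqrtr_sqr.
Qed.

Lemma enormN x : enorm (- x) = enorm x.
Proof. by rewrite -scaleN1r enormZ normrN1 mul1r. Qed.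

Lemma enorm_normalize x : x != 0 -> enorm ((enorm x)^-1 *: x) = 1.
Proof.
move=> x0; rewrite enormZ ger0_norm ?invr_ge0 ?enorm_ge0//.
by rewrite mulVf// enorm_eq0.
Qed.

Lemma enorm_sqr_le x a : 0 <= a -> (enorm x <= a) = (dot x x <= a ^+ 2).
Proof.
by move=> a0; rewrite -sqr_enorm ler_pXn2r ?nnegrE ?enorm_ge0.
Qed.

(** Cauchy-Schwarz, from the nonnegativity of the square of (|y| / |x|) x - y. *)
Lemma dot_le x y : dot x y <= enorm x * enorm y.
Proof.
have [->|x0] := eqVneq x 0; first by rewrite dot0l enorm0 mul0r.
have xp : 0 < enorm x by rewrite enorm_gt0.
have := dot_ge0 ((enorm y / enorm x) *: x - y).
rewrite dotBl !dotBr !dotZl !dotZr -!sqr_enorm (dotC y).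
have -> : enorm y / enorm x * (enorm y / enorm x * enorm x ^+ 2) = enorm y ^+ 2.
  by field; rewrite gt_eqF.
move=> h; have [y0|y0] := eqVneq y 0; first by rewrite y0 dot0r enorm0 mulr0.
have yp : 0 < enorm y by rewrite enorm_gt0.
have : enorm y / enorm x * dot x y <= enorm y ^+ 2 by lra.
by rewrite mulrAC ler_pdivrMr// expr2 -mulrA ler_pM2l// mulrC.
Qed.

Lemma normr_dot_le x y : `|dot x y| <= enorm x * enorm y.
Proof.
rewrite ler_norml dot_le andbT lerNl -dotNl -(enormN x); exact: dot_le.
Qed.

Lemma ler_enormD x y : enorm (x + y) <= enorm x + enorm y.
Proof.
rewrite enorm_sqr_le ?addr_ge0 ?enorm_ge0// dotDl !dotDr sqrrD -!sqr_enorm.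
by have := dot_le x y; rewrite (dotC y x); lra.
Qed.

Lemma enorm_distC x y : enorm (x - y) = enorm (y - x).
Proof. by rewrite -enormN opprB. Qed.

Lemma coord_le_enorm x i : `|x 0 i| <= enorm x.
Proof.
rewrite -dot_delta (le_trans (normr_dot_le _ _))//.
rewrite ler_piMr ?enorm_ge0// enorm_sqr_le// expr1n.
by rewrite dot_delta mxE !eqxx.
Qed.

Lemma enorm_le_coord x a : (forall i, `|x 0 i| <= a) -> enorm x <= n%:R * a.
Proof.
move=> h; have [i0|] := pickP (@predT 'I_n); last first.
  move=> n0; rewrite (_ : x = 0) ?enorm0; last by apply/rowP => i; have := n0 i.
  case: n n0 => [_|m /(_ ord0)//]; by rewrite mul0r.
have a0 : 0 <= a by exact: le_trans (h i0).
have n1 : 1 <= n%:R :> R by rewrite ler1n; case: n i0 => // -[].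
move=> _; rewrite enorm_sqr_le ?mulr_ge0 ?ler0n//.
apply: (@le_trans _ _ (\sum_(i < n) a ^+ 2)).
  by apply: ler_sum => i _; rewrite -expr2 -real_normK ?num_real// lerXn2r ?nnegrE.
rewrite sumr_const card_ord -[leLHS]mulr_natl exprMn ler_wpM2r ?sqr_ge0//.
by rewrite expr2 ler_peMr// ler0n.
Qed.

(** The topology on row vectors is that of the sup norm; it is compared with the Euclidean one up to
    the factor [n]. The denominator [n.+1] covers dimension 0 as well. *)
Lemma nbhs_enormP x (A : set 'rV[R]_n) :
  nbhs x A <-> exists2 e : R, 0 < e & forall y, enorm (y - x) < e -> A y.
Proof.
split.
  move=> /nbhs_ballP[e /= e0 xA]; exists e => // y yx; apply: xA; split => // i j.
  rewrite ord1 /ball /= distrC (le_lt_trans _ yx)//.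
  by have := coord_le_enorm (y - x) j; rewrite !mxE.
move=> [e e0 xA]; apply/nbhs_ballP; exists (e / n.+1%:R) => /=.
  by rewrite divr_gt0// ltr0n.
move=> y [_ xy]; apply: xA; apply: (@le_lt_trans _ _ (n%:R * (e / n.+1%:R))).
  apply: enorm_le_coord => i; rewrite !mxE; have := xy 0 i.
  by rewrite /ball /= distrC => /ltW.
by rewrite mulrCA gtr_pMr// ltr_pdivrMr ?ltr0n// mul1r ltr_nat.
Qed.

Lemma enorm_continuous : continuous (@enorm R n).
Proof.
move=> x A /nbhs_ballP[e /= e0 xA]; apply/nbhs_enormP; exists e => // y yx.
apply: xA; rewrite /ball /=; apply: le_lt_trans yx; rewrite ler_norml; apply/andP; split.
  by have := ler_enormD (y - x) x; rewrite subrK; lra.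
by have := ler_enormD (x - y) y; rewrite subrK enorm_distC; lra.
Qed.

Lemma dot_continuous y : continuous (fun x => dot x y).
Proof.
move=> x A /nbhs_ballP[e /= e0 xA]; apply/nbhs_enormP.
exists (e / (enorm y + 1)).
  by rewrite divr_gt0// ltr_wpDl// enorm_ge0.
move=> z zx; apply: xA; rewrite /ball /= -dotBl (le_lt_trans (normr_dot_le _ _))// enorm_distC.
move: zx; rewrite ltr_pdivlMr ?ltr_wpDl ?enorm_ge0// => zx.
apply: le_lt_trans zx; rewrite ler_wpM2l ?enorm_ge0//; lra.
Qed.

Lemma bounded_enormP (A : set 'rV[R]_n) :
  bounded_set A <-> exists M : R, forall x, A x -> enorm x <= M.
Proof.
split=> [[M [Mr h]]|[M h]].
  exists (n%:R * (M + 1)) => x Ax; apply: enorm_le_coord => i.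
  apply: le_trans (h (M + 1) _ x Ax); last by rewrite ltrDl.
  rewrite [leRHS]mx_normrE; exact: (le_bigmax _ (fun ij => `|x ij.1 ij.2|) (0, i)).
exists (Num.max M 0); split; first by rewrite num_real.
move=> M' MM' x Ax; rewrite /= [leLHS]mx_normrE; apply: bigmax_le.
  by rewrite (le_trans _ (ltW MM'))// le_max lexx orbT.
move=> [i j] _ /=; rewrite ord1 (le_trans (coord_le_enorm _ _))//.
by rewrite (le_trans (h _ Ax))// (le_trans _ (ltW MM'))// le_max lexx.
Qed.

End Euclidean.

Lemma dot_mulmx (R : realType) n m (x : 'rV[R]_n) (T : 'M[R]_(n, m)) y :
  dot (x *m T) y = dot x (y *m T^T).
Proof. by rewrite !dotE trmx_mul trmxK mulmxA. Qed.

Lemma dot_vcons (R : realType) n a b (x y : 'rV[R]_n) :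
  dot (vcons a x) (vcons b y) = a * b + dot x y.
Proof.
rewrite /dot big_ord_recl !vcons0; congr (_ + _).
by apply: eq_bigr => i _; rewrite !vconsS.
Qed.

(** * Volumes of affine images, balls, cubes and hyperplanes *)

Section Volumes.
Variable R : realType.
Local Open Scope ereal_scope.

Definition eball n (r : R) : set 'rV[R]_n := [set x | (enorm x <= r)%R].

Lemma closed_eball n r : closed (@eball n r).
Proof.
apply: (@closed_comp _ _ (@enorm R n) [set t | (t <= r)%R]); last exact: closed_le.
by move=> x _; exact: enorm_continuous.
Qed.

Lemma measurable_eball n r : measurable (@eball n r).
Proof. by apply: closed_measurable_rv; exact: closed_eball. Qed.

Lemma measurable_affine_rv n m (T : 'M[R]_(n, m)) (c : 'rV[R]_m) :
  measurable_fun setT (fun x : 'rV[R]_n => x *m T + c)%R.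
Proof.
apply: measurable_rvP => i; under eq_fun do rewrite mxE.
apply: measurable_funD => //.
exact: (measurableT_comp (measurable_coord i) (measurable_mulmxr T)).
Qed.

Lemma rvleb_indic n (A : set 'rV[R]_n) : measurable A ->
  rvleb R n A = \int[rvleb R n]_x (\1_A x)%:E.
Proof. by move=> mA; rewrite integral_indic// setIT. Qed.

Lemma rvleb_affine_preimage n (T : 'M[R]_n) c (A : set 'rV[R]_n) :
  \det T != 0%R -> measurable A ->
  rvleb R n ((fun x => x *m T + c)%R @^-1` A) =
  (`|\det T|^-1)%:E * rvleb R n A.
Proof.
move=> T0 mA; have mT := measurable_affine_rv T c.
have mpA : measurable ((fun x => x *m T + c)%R @^-1` A).
  by rewrite -[X in measurable X]setTI; exact: mT.
have mD : measurable_fun setT (fun x : 'rV[R]_n => x + c)%R.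
  by have := measurable_affine_rv 1%:M%R c; under eq_fun do rewrite mulmx1.
have mI : measurable_fun setT (fun x : 'rV[R]_n => (\1_A x)%:E : \bar R).
  by apply/measurable_EFinP; exact: measurable_indic.
transitivity (\int[rvleb R n]_x (\1_A (x *m T + c)%R)%:E).
  by rewrite rvleb_indic//; apply: eq_integral => x _;
    rewrite !indicE; congr (_%:R%:E); apply/idP/idP; rewrite !inE.
rewrite (covM_unit T0 (f := fun x => (\1_A (x + c)%R)%:E)) //; last exact: (measurableT_comp mI mD).
congr (_ * _); by rewrite (rvleb_translate c mI) ?integral_indic ?setIT.
Qed.

Lemma affine_imageE n (T : 'M[R]_n) c (A : set 'rV[R]_n) : T \in unitmx ->
  [set c + z *m T | z in A]%R =
  (fun y => y *m invmx T + - (c *m invmx T))%R @^-1` A.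
Proof.
move=> uT; apply/seteqP; split => [_ [z Az <-]|y Ay] /=.
  by rewrite mulmxDl mulmxK// [X in (X - _)%R]addrC addrK.
exists (y *m invmx T + - (c *m invmx T))%R => //.
by rewrite mulmxDl mulNmx !mulmxKV// addrC subrK.
Qed.

Lemma measurable_affine_image n (T : 'M[R]_n) c (A : set 'rV[R]_n) :
  T \in unitmx -> measurable A -> measurable [set c + z *m T | z in A]%R.
Proof.
move=> uT mA; rewrite affine_imageE// -[X in measurable X]setTI.
exact: measurable_affine_rv.
Qed.

Lemma rvleb_affine_image n (T : 'M[R]_n) c (A : set 'rV[R]_n) :
  T \in unitmx -> measurable A ->
  rvleb R n [set c + z *m T | z in A]%R = `|\det T|%:E * rvleb R n A.
Proof.
move=> uT mA; rewrite affine_imageE// rvleb_affine_preimage//.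
  by rewrite det_inv normrV ?invrK// unitfE -unitfE -unitmxE.
by rewrite det_inv invr_eq0 -unitfE -unitmxE.
Qed.

Lemma rvleb_scale n (r : R) (A : set 'rV[R]_n) : (0 < r)%R -> measurable A ->
  rvleb R n [set (r *: z)%R | z in A] = (r ^+ n)%:E * rvleb R n A.
Proof.
move=> r0 mA; have ur : (r%:M : 'M[R]_n) \in unitmx.
  by rewrite unitmxE det_scalar unitfE expf_neq0// gt_eqF.
have := rvleb_affine_image 0%R ur mA.
rewrite det_scalar ger0_norm ?exprn_ge0 ?ltW// => <-.
by congr (rvleb R n _); apply: eq_imagel => z _; rewrite add0r mul_mx_scalar.
Qed.

Lemma eball_scale n (r : R) : (0 < r)%R ->
  @eball n r = [set (r *: z)%R | z in eball 1].
Proof.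
move=> r0; apply/seteqP; split => [x xr|_ [x x1 <-]]; last first.
  by rewrite /eball /= enormZ gtr0_norm// ler_piMr// ltW.
exists (r^-1 *: x)%R; last by rewrite scalerA divff ?scale1r// gt_eqF.
by rewrite /eball /= enormZ gtr0_norm ?invr_gt0// mulrC ler_pdivrMr// mul1r.
Qed.

Lemma rvleb_eballZ n (r : R) : (0 < r)%R ->
  rvleb R n (eball r) = (r ^+ n)%:E * rvleb R n (eball 1).
Proof. by move=> r0; rewrite eball_scale// rvleb_scale//; exact: measurable_eball. Qed.

(** Cubes have volumes computable coordinate by coordinate. A cube around a bounded set gives
    finiteness of its volume, a cube inside the ball gives positivity of [vball]. *)
Definition cube n (r : R) : set 'rV[R]_n := [set x | forall i, (`|x 0%R i| <= r)%R].

Lemma measurable_cube n r : measurable (@cube n r).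
Proof.
have -> : @cube n r = \bigcap_(i in [set: 'I_n])
    ((fun x : 'rV[R]_n => x 0%R i) @^-1` `[- r, r]%classic)%R.
  by apply/seteqP; split=> x h i; have := h i; rewrite /= in_itv /= ler_norml//;
    apply.
apply: fin_bigcap_measurable => // i _; rewrite -[X in measurable X]setTI.
exact: measurable_coord.
Qed.

Lemma rvlebS_prod n (A : set R) (B : set 'rV[R]_n) :
  measurable (A : set (measurableTypeR R)) -> measurable B ->
  rvleb R n.+1 [set x : 'rV[R]_n.+1 | A (x 0%R ord0) /\ B (vtail x)] =
  @lebesgue_measure R A * rvleb R n B.
Proof.
move=> mA mB; rewrite -(product_measure1E (@lebesgue_measure R) (rvleb R n))//.
congr ((@lebesgue_measure R \x rvleb R n) _); apply/seteqP; split => -[x y] /=;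
  by rewrite vcons0 vtail_vcons.
Qed.

Lemma rvleb_cube n r : (0 <= r)%R -> rvleb R n (cube r) = ((2 * r) ^+ n)%:E.
Proof.
move=> r0; elim: n => [|n IH].
  rewrite expr0 /= diracE mem_set//; by case.
have -> : @cube n.+1 r = [set x : 'rV[R]_n.+1 | `[- r, r]%classic%R (x 0%R ord0) /\ cube r (vtail x)].
  apply/seteqP; split => [x h|x [h0 h] i].
    split; first by rewrite /= in_itv /= -ler_norml; exact: h.
    by move=> i; rewrite mxE; exact: h.
  case: (unliftP ord0 i) => [j ->|->]; first by have := h j; rewrite mxE.
  by move: h0; rewrite /= in_itv /= -ler_norml.
rewrite rvlebS_prod//; last exact: measurable_cube.
rewrite IH lebesgue_measure_itv/= lte_fin; case: ifPn => h.
  by rewrite -EFinB -EFinM exprS; congr (_%:E); ring.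
have -> : (r = 0)%R by apply/eqP; lra.
by rewrite mul0e mulr0 exprS mul0r.
Qed.

Lemma rvleb_bounded n (A : set 'rV[R]_n) M : measurable A ->
  (forall x, A x -> (enorm x <= M)%R) -> rvleb R n A < +oo.
Proof.
move=> mA AM; apply: (@le_lt_trans _ _ (rvleb R n (cube (Num.max M 0%R)))).
  apply: le_measure; rewrite ?inE//; first exact: measurable_cube.
  move=> x Ax i; rewrite (le_trans (coord_le_enorm _ _))// le_max.
  by rewrite (AM _ Ax).
by rewrite rvleb_cube ?ltry// le_max lexx orbT.
Qed.

Lemma vballE n : rvleb R n (eball 1) = (vball R n)%:E.
Proof.
rewrite /vball /volR -/(@eball n 1) volE ?fineK//; last exact: measurable_eball.
rewrite ge0_fin_numE//; apply: (@rvleb_bounded _ _ 1%R) => //.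
exact: measurable_eball.
Qed.

Lemma rvleb_eball n (r : R) : (0 < r)%R ->
  rvleb R n (eball r) = (r ^+ n * vball R n)%:E.
Proof. by move=> r0; rewrite rvleb_eballZ// vballE EFinM. Qed.

Lemma vball_gt0 n : (0 < vball R n)%R.
Proof.
rewrite -lte_fin -vballE.
apply: (@lt_le_trans _ _ (rvleb R n (cube n.+1%:R^-1%R))).
  by rewrite rvleb_cube ?lte_fin ?exprn_gt0 ?mulr_gt0 ?invr_gt0 ?invr_ge0 ?ltr0n//.
apply: le_measure; rewrite ?inE; [exact: measurable_cube|exact: measurable_eball|].
move=> x h; rewrite /eball /= (le_trans (enorm_le_coord h))//.
by rewrite ler_pdivrMr ?ltr0n// mul1r ler_nat.
Qed.

(** Slicing by the first coordinate: if [vtail u] is non-zero, each slice is a hyperplane, null by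
    induction; otherwise the only nonempty slice is at abscissa [c], and a point of the line is
    null. *)
Lemma rvleb_hyperplane n (u : 'rV[R]_n) a : u != 0%R ->
  rvleb R n [set x | dot x u = a] = 0.
Proof.
elim: n u a => [|n IH] u a u0.
  by exfalso; move/eqP: u0; apply; apply/rowP => -[].
have mH m (v : 'rV[R]_m) b : measurable [set x : 'rV[R]_m | dot x v = b].
  apply: closed_measurable_rv.
  apply: (@closed_comp _ _ (fun x : 'rV[R]_m => dot x v) [set t | t = b]); last exact: closed_eq.
  by move=> x _; exact: dot_continuous.
rewrite (rvleb_indic (mH n.+1 u a)).
rewrite integral_rvlebS//; last first.
  by apply/measurable_EFinP; apply: measurable_indic; exact: mH.
have vconsH x : (fun y : 'rV[R]_n => (\1_[set z | dot z u = a] (vcons x y))%:E : \bar R) =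
    (fun y => (\1_[set z | dot z (vtail u) = a - x * u 0%R ord0] y)%:E)%R.
  apply/funext => y; rewrite !indicE; congr ((nat_of_bool _)%:R%:E).
  have E : dot (vcons x y) u = (x * u 0 ord0 + dot y (vtail u))%R.
    by rewrite -{1}(vcons_eta u) dot_vcons.
  by apply/idP/idP; rewrite !inE /= E => h; lra.
under eq_integral do rewrite vconsH -(rvleb_indic (mH _ _ _)).
have [ut|ut] := eqVneq (vtail u) 0%R; last first.
  by rewrite integral0_eq// => x _; exact: IH.
have u00 : u 0%R ord0 != 0%R.
  apply: contra_neq u0 => u00; rewrite -(vcons_eta u) ut u00.
  apply/rowP => i; rewrite [RHS]mxE; case: (unliftP ord0 i) => [j ->|->].
    by rewrite vconsS mxE.
  by rewrite vcons0.
pose c := (a / u 0 ord0)%R.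
rewrite (eq_integral (fun x : measurableTypeR R =>
    (\1_[set c] x)%:E * rvleb R n setT)); last first.
  move=> x _; rewrite ut indicE; have [->|xc] := eqVneq x c.
    rewrite mem_set// mul1e; congr (rvleb R n _); apply/seteqP; split => // y _ /=.
    by rewrite dot0r /c divfK// subrr.
  rewrite memNset ?mul0e; last by move/eqP: xc.
  rewrite (_ : [set _ | _] = set0) ?measure0//; apply/seteqP; split => // y /=.
  rewrite dot0r => h; move/eqP: xc; apply; rewrite /c.
  by have -> : (a = x * u 0 ord0)%R; [lra|rewrite mulfK].
rewrite ge0_integralZr//.
  rewrite integral_indic// setIT.
  by rewrite [X in X * _](_ : _ = 0) ?mul0e//; exact: lebesgue_measure_set1.
by apply/measurable_EFinP; exact: measurable_indic.
Qed.

End Volumes.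

(** * Polar coordinates *)

Lemma expr_unbounded (R : realType) (c q : R) : 1 < q -> exists k, c < q ^+ k.
Proof.
move=> q1; have bernoulli k : 1 + k%:R * (q - 1) <= q ^+ k.
  elim: k => [|k IH]; first by rewrite mul0r addr0 expr0.
  rewrite exprS (@le_trans _ _ (q * (1 + k%:R * (q - 1))))//; last first.
    by rewrite ler_wpM2l//; lra.
  have : 0 <= k%:R * (q - 1) ^+ 2 by rewrite mulr_ge0// sqr_ge0.
  by rewrite -natr1; lra.
have q10 : 0 < q - 1 by rewrite subr_gt0.
exists (Num.bound (`|c| / (q - 1))); apply: lt_le_trans (bernoulli _).
have := @archi_boundP R (`|c| / (q - 1)).
rewrite divr_ge0 ?normr_ge0 ?(ltW q10)// => /(_ isT); rewrite ltr_pdivrMr//.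
by have := ler_norm c; lra.
Qed.

Section PolarCoordinates.
Variables (R : realType) (n : nat).
Local Open Scope ereal_scope.

(** The origin is removed because x / |x| is meaningless there; [pball 1] is the domain over which
    [sphint] integrates. *)
Definition pball (r : R) : set 'rV[R]_n :=
  [set x | (0 < enorm x)%R /\ (enorm x <= r)%R].

Lemma measurable_enorm : measurable_fun setT (@enorm R n).
Proof. by apply: continuous_measurable_rv; exact: enorm_continuous. Qed.

Lemma measurable_pball r : measurable (pball r).
Proof.
rewrite (_ : pball r = @enorm R n @^-1` `]0%R, r]%classic).
  by rewrite -[X in measurable X]setTI; exact: measurable_enorm.
by apply/seteqP; split => x /=; rewrite in_itv /= => /andP.
Qed.

Lemma rvleb_cone (A : set 'rV[R]_n) r : measurable A ->
  (forall x t, (0 < t)%R -> A x -> A (t *: x)%R) -> (0 < r)%R ->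
  rvleb R n (A `&` pball r) = (r ^+ n)%:E * rvleb R n (A `&` pball 1).
Proof.
move=> mA hA r0; rewrite -rvleb_scale//; last first.
  by apply: measurableI => //; exact: measurable_pball.
congr (rvleb R n _); apply/seteqP; split => [x [Ax [x0 xr]]|_ [x [Ax [x0 x1]] <-]].
  exists (r^-1 *: x)%R; last by rewrite scalerA divff ?scale1r// gt_eqF.
  rewrite /pball /= enormZ gtr0_norm ?invr_gt0//; split.
    by apply: hA; rewrite ?invr_gt0.
  by rewrite mulr_gt0 ?invr_gt0// mulrC ler_pdivrMr// mul1r.
split; first exact: hA.
by rewrite /pball /= enormZ gtr0_norm// mulr_gt0// ler_piMr// ltW.
Qed.

Section StarBody.
Variables (rho : 'rV[R]_n -> R) (a b : R).
Hypotheses (mrho : measurable_fun setT rho) (a0 : (0 < a)%R)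
  (arho : forall x, x != 0%R -> (a <= rho x)%R)
  (rhob : forall x, x != 0%R -> (rho x <= b)%R)
  (rhoZ : forall x t, (0 < t)%R -> rho (t *: x)%R = rho x).

(** [E] is the star body with radial function [rho], deprived of the origin. As [rho] is constant on
    rays, [I] is 1/n times the integral of rho^n over the sphere. *)
Let E := [set x | (0 < enorm x)%R /\ (enorm x <= rho x)%R].
Let I := \int[rvleb R n]_(x in pball 1) (rho x ^+ n)%:E.

Let measurable_E : measurable E.
Proof.
rewrite (_ : E = @enorm R n @^-1` `]0%R, +oo[%classic `&`
      (fun x => rho x - enorm x)%R @^-1` `[0%R, +oo[%classic).
  apply: measurableI; rewrite -[X in measurable X]setTI; first exact: measurable_enorm.
  by apply: measurable_funB => //; exact: measurable_enorm.
by apply/seteqP; split => x /=; rewrite !in_itv /= !andbT subr_ge0.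
Qed.

(* On the cone [slice k] the function [rho] is constant up to a factor [q], so
   that both sides agree up to the factor [q ^+ n]; finally [q] tends to 1. *)
Section Slices.
Variable q : R.
Hypothesis q1 : (1 < q)%R.
Let q0 : (0 < q)%R. Proof. exact: lt_trans q1. Qed.

Let slice k := [set x | (0 < enorm x)%R /\ (a * q ^+ k <= rho x < a * q ^+ k.+1)%R].

Let mslice k : measurable (slice k).
Proof.
rewrite (_ : slice k = @enorm R n @^-1` `]0%R, +oo[%classic `&`
    rho @^-1` `[(a * q ^+ k)%R, (a * q ^+ k.+1)%R[%classic).
  apply: measurableI; rewrite -[X in measurable X]setTI; first exact: measurable_enorm.
  exact: mrho.
by apply/seteqP; split => x /=; rewrite !in_itv /= andbT.
Qed.

Let slice_cone k x t : (0 < t)%R -> slice k x -> slice k (t *: x)%R.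
Proof.
move=> t0 [x0 xk]; split; last by rewrite rhoZ.
by rewrite enormZ gtr0_norm// mulr_gt0.
Qed.

Let trivIset_slice : trivIset setT slice.
Proof.
have lt_slice i j x : (i < j)%N -> slice i x -> slice j x -> False.
  move=> ij [_ /andP[_ h1]] [_ /andP[h2 _]].
  have : (a * q ^+ i.+1 <= a * q ^+ j)%R.
    by rewrite ler_pM2l// ler_weXn2l// ltW.
  by move=> h; have := lt_le_trans (lt_le_trans h1 h) h2; rewrite ltxx.
apply/trivIsetP => i j _ _ ij; apply/seteqP; split => // x [si sj].
by move: ij; rewrite neq_ltn => /orP[ij|ji]; [exact: (lt_slice i j x)|exact: (lt_slice j i x)].
Qed.

Let slice_cover (x : 'rV[R]_n) : x != 0%R -> exists k, slice k x.
Proof.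
move=> x0.
have ex : exists k, (rho x < a * q ^+ k.+1)%R.
  have [k hk] := expr_unbounded (rho x / a)%R q1.
  exists k; rewrite mulrC -ltr_pdivrMr// (lt_le_trans hk)// ler_weXn2l// ltW//.
(* Minimality of [k] gives the lower bound of the slice when [k] is positive; for [k = 0] it is the
   hypothesis [arho]. *)
have := ex_minnP ex; case: ex_minnP => k hk kmin _; exists k.
split; first by rewrite enorm_gt0.
rewrite hk andbT; case: k hk kmin => [|k] hk kmin.
  by rewrite expr0 mulr1 arho.
by rewrite leNgt; apply/negP => /kmin; rewrite ltnn.
Qed.

Let m k := rvleb R n (slice k `&` pball 1).

Let rvleb_E : rvleb R n E = \sum_(0 <= k <oo) rvleb R n (slice k `&` E).
Proof.
have mE := measurable_E.
rewrite -measure_semi_bigcup.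
- congr (rvleb R n _); apply/seteqP; split => [x Ex|x [k _ []]//].
  have [k sk] : exists k, slice k x by apply: slice_cover; rewrite -enorm_gt0; case: Ex.
  by exists k.
- by move=> k; exact: measurableI.
- by apply: trivIset_setIr.
- by apply: bigcup_measurable => k _; exact: measurableI.
Qed.

Let intE : I = \sum_(0 <= k <oo) \int[rvleb R n]_(x in slice k `&` pball 1) (rho x ^+ n)%:E.
Proof.
have mN := measurable_pball 1.
rewrite -ge0_integral_bigcup.
- congr (\int[rvleb R n]_(x in _) _); apply/seteqP; split => [x Nx|x [k _ []]//].
  have [k sk] : exists k, slice k x by apply: slice_cover; rewrite -enorm_gt0; case: Nx.
  by exists k.
- by move=> k; exact: measurableI.
- apply/measurable_EFinP; apply: measurable_funX; exact: measurable_funTS.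
- move=> x [k _ [_ [x0 _]]]; rewrite lee_fin exprn_ge0// (le_trans (ltW a0))// arho//.
  by rewrite -enorm_gt0.
- by apply: trivIset_setIr.
Qed.

Let slice_bounds k :
  ((a * q ^+ k) ^+ n)%:E * m k <= rvleb R n (slice k `&` E) /\
  rvleb R n (slice k `&` E) <= ((a * q ^+ k.+1) ^+ n)%:E * m k.
Proof.
have mE := measurable_E.
rewrite /m -!rvleb_cone ?mulr_gt0 ?exprn_gt0//; first last.
- exact: slice_cone.
- exact: slice_cone.
split; apply: le_measure; rewrite ?inE;
  try by apply: measurableI => //; exact: measurable_pball.
- move=> x [sx [x0 xr]]; do 2!split => //; apply: le_trans xr _.
  by case: sx => _ /andP[].
- move=> x [sx [x0 xr]]; do 2!split => //; apply: le_trans xr _.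
  by case: sx => _ /andP[_ /ltW].
Qed.

Let int_bounds k :
  ((a * q ^+ k) ^+ n)%:E * m k <=
    \int[rvleb R n]_(x in slice k `&` pball 1) (rho x ^+ n)%:E /\
  \int[rvleb R n]_(x in slice k `&` pball 1) (rho x ^+ n)%:E <=
    ((a * q ^+ k.+1) ^+ n)%:E * m k.
Proof.
have mN := measurable_pball 1.
have mS : measurable (slice k `&` pball 1) by exact: measurableI.
have mrn : measurable_fun (slice k `&` pball 1) (fun x => (rho x ^+ n)%:E).
  by apply/measurable_EFinP; apply: measurable_funX; exact: measurable_funTS.
have p0 j : (0 <= a * q ^+ j)%R by rewrite mulr_ge0 ?exprn_ge0// ltW.
rewrite /m -!integral_cst//; split; apply: ge0_le_integral => //=.
- by move=> x _; rewrite lee_fin exprn_ge0.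
- move=> x [[_ /andP[h _]] _]; rewrite lee_fin lerXn2r ?nnegrE//.
  exact: le_trans h.
- move=> x [[_ /andP[h _]] _]; rewrite lee_fin exprn_ge0//.
  exact: le_trans h.
- move=> x [[_ /andP[h1 /ltW h2]] _]; rewrite lee_fin lerXn2r ?nnegrE//.
  exact: le_trans h1.
Qed.

Let step k : ((a * q ^+ k.+1) ^+ n)%:E * m k = (q ^+ n)%:E * (((a * q ^+ k) ^+ n)%:E * m k).
Proof. by rewrite muleA -EFinM -exprMn exprS mulrCA. Qed.

Lemma rvleb_star_le : rvleb R n E <= (q ^+ n)%:E * I.
Proof.
have qn0 : (0 <= q ^+ n)%R by rewrite exprn_ge0// ltW.
have I0 k : 0 <= \int[rvleb R n]_(x in slice k `&` pball 1) (rho x ^+ n)%:E.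
  apply: le_trans (int_bounds k).1; rewrite mule_ge0// lee_fin exprn_ge0//.
  by rewrite mulr_ge0 ?exprn_ge0// ltW.
rewrite rvleb_E intE -nneseriesZl//; apply: lee_nneseries => // k _.
apply: le_trans (slice_bounds k).2 _; rewrite step.
by apply: lee_wpmul2l; rewrite ?lee_fin//; exact: (int_bounds k).1.
Qed.

Lemma rvleb_star_ge : I <= (q ^+ n)%:E * rvleb R n E.
Proof.
have qn0 : (0 <= q ^+ n)%R by rewrite exprn_ge0// ltW.
have I0 k : 0 <= \int[rvleb R n]_(x in slice k `&` pball 1) (rho x ^+ n)%:E.
  apply: le_trans (int_bounds k).1; rewrite mule_ge0// lee_fin exprn_ge0//.
  by rewrite mulr_ge0 ?exprn_ge0// ltW.
rewrite rvleb_E intE -nneseriesZl//; apply: lee_nneseries => // k _.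
apply: le_trans (int_bounds k).2 _; rewrite step.
by apply: lee_wpmul2l; rewrite ?lee_fin//; exact: (slice_bounds k).1.
Qed.

End Slices.

Theorem rvleb_star : rvleb R n E = I /\ I < +oo.
Proof.
have Efin : rvleb R n E < +oo.
  apply: (@rvleb_bounded _ _ _ b) => [|x [x0 xr]]; first exact: measurable_E.
  by apply: le_trans xr _; rewrite rhob// -enorm_gt0.
have Ifin : I < +oo.
  (* Any ratio above 1 serves here; finiteness must come first, as the limit q -> 1 is taken between
     real numbers. *)
  apply: le_lt_trans (@rvleb_star_ge 2%R _) _; first lra.
  by rewrite lte_mul_pinfty// lee_fin exprn_ge0.
split => //; have I0 : 0 <= I.
  apply: integral_ge0 => x [x0 _]; rewrite lee_fin exprn_ge0//.
  by rewrite (le_trans (ltW a0))// arho// -enorm_gt0.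
have : rvleb R n E \is a fin_num by rewrite ge0_fin_numE.
have : I \is a fin_num by rewrite ge0_fin_numE.
have := @rvleb_star_ge; have := @rvleb_star_le.
case: (rvleb R n E) => // x; case: I => // y hxy hyx _ _.
have cvgq z : (fun q : R => q ^+ n * z)%R @ 1^'+ --> z.
  suff : (fun q : R => q ^+ n * z)%R @ 1^'+ --> (1 ^+ n * z)%R by rewrite expr1n mul1r.
  apply: cvg_at_right_filter; apply: cvgM; last exact: cvg_cst.
  exact: exprn_continuous.
have [cx cy] := (cvgP _ (cvgq x), cvgP _ (cvgq y)).
congr EFin; apply/eqP; rewrite eq_le; apply/andP; split.
  rewrite -(cvg_lim (@Rhausdorff R) (cvgq y)); apply: limr_ge => //.
  near=> q; rewrite -lee_fin EFinM; apply: hxy; near: q; exact: nbhs_right_gt.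
rewrite -(cvg_lim (@Rhausdorff R) (cvgq x)); apply: limr_ge => //.
near=> q; rewrite -lee_fin EFinM; apply: hyx; near: q; exact: nbhs_right_gt.
Unshelve. all: by end_near.
Qed.

End StarBody.
End PolarCoordinates.

(** * Volume of a spherical cap *)

Section CapVolume.
Variable R : realType.

Lemma sqrt_onem_continuous m : continuous (fun x : R => Num.sqrt (1 - x) ^+ m).
Proof.
move=> x; apply: (@continuous_comp _ _ _ (fun y : R => Num.sqrt (1 - y)) (fun y => y ^+ m)).
  apply: (@continuous_comp _ _ _ (fun y : R => 1 - y) Num.sqrt).
    by apply: continuousB; [exact: cvg_cst|exact: cvg_id].
  exact: sqrt_continuous.
exact: exprn_continuous.
Qed.

Lemma integral_sqrt_onem m (t : R) : 0 < t ->
  (\int[@lebesgue_measure R]_(x in `[(1 - t)%R, 1%R]) (Num.sqrt (1 - x) ^+ m)%:E =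
  (2 / m.+2%:R * Num.sqrt t ^+ m.+2)%:E)%E.
Proof.
(* An antiderivative below 1. The chain rule through the square root fails at [x = 1], but
   continuity of [F] at the endpoints is enough for the fundamental theorem. *)
move=> t0; pose F (x : R) := - (2 / m.+2%:R) * Num.sqrt (1 - x) ^+ m.+2.
have cF : continuous F.
  by move=> x; apply: cvgM; [exact: cvg_cst|exact: sqrt_onem_continuous].
have dF (x : R) : x < 1 -> is_derive x 1 F (Num.sqrt (1 - x) ^+ m).
  move=> x1; have x10 : 0 < 1 - x by rewrite subr_gt0.
  have s0 : Num.sqrt (1 - x) != 0 by rewrite gt_eqF// sqrtr_gt0.
  have d1 : is_derive x 1 (fun y : R => 1 - y) (-1).
    by apply: is_derive_eq; rewrite add0r mul1r.
  have d2 := @is_derive1_comp _ Num.sqrt (fun y : R => 1 - y) x _ _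
    (is_derive1_sqrt x10) d1.
  have d3 : is_derive (Num.sqrt (1 - x)) 1 (fun y : R => - (2 / m.+2%:R) * y ^+ m.+2)
      (- (2 / m.+2%:R) * (m.+2%:R * Num.sqrt (1 - x) ^+ m.+1)).
    have dX : is_derive (Num.sqrt (1 - x)) 1 (@GRing.exp R ^~ m.+2)
        (m.+2%:R * Num.sqrt (1 - x) ^+ m.+1).
      apply: DeriveDef; first exact: exprn_derivable.
      by rewrite exp_derive /GRing.scale /= mulr1.
    exact: (is_deriveZ (- (2 / m.+2%:R)) dX).
  apply: (is_derive_eq (@is_derive1_comp _ (fun y : R => - (2 / m.+2%:R) * y ^+ m.+2)
    (Num.sqrt \o (fun y : R => 1 - y)) x _ _ d3 d2)).
  rewrite exprS.
  by field; rewrite s0 -natrD pnatr_eq0.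
rewrite (@continuous_FTC2 _ _ F) ?gtrBl//.
- rewrite -EFinB; congr EFin; rewrite /F subrr sqrtr0 subKr expr0n /= mulr0 sub0r.
  by rewrite mulNr opprK.
- exact/continuous_subspaceT/sqrt_onem_continuous.
- split => [x|| ]; last 2 first.
    by apply: cvg_at_right_filter; exact: cF.
    by apply: cvg_at_left_filter; exact: cF.
  by rewrite in_itv /= => /andP[_ /dF] [].
- by move=> x; rewrite in_itv /= => /andP[_ /dF] h; rewrite derive1E; exact: derive_val.
Qed.

(* A Householder reflection. *)
Lemma rotate_to_coord m (w : 'rV[R]_m.+1) : enorm w = 1 ->
  exists H : 'M[R]_m.+1, H *m H^T = 1%:M /\
    forall z : 'rV[R]_m.+1, dot z w = (z *m H) 0 ord0.
Proof.
move=> w1; pose e : 'rV[R]_m.+1 := delta_mx 0 ord0; pose v := w - e.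
have ze z : dot z e = z 0 ord0 by exact: dot_delta.
have [v0|v0] := eqVneq v 0.
  exists 1%:M; split; first by rewrite trmx1 mulmx1.
  by move=> z; rewrite mulmx1 -ze; move/eqP: v0; rewrite subr_eq0 => /eqP ->.
have vv : dot v v != 0 by rewrite dot_eq0.
have ww : dot w w = 1 by rewrite -sqr_enorm w1 expr1n.
have ee : dot e e = 1 by rewrite ze mxE !eqxx.
have vvE : dot v v = 2 - 2 * dot w e.
  by rewrite /v !dotBl !dotBr ww ee (dotC e w); ring.
pose H : 'M[R]_m.+1 := 1%:M - (2 / dot v v) *: (v^T *m v).
have zH z : z *m H = z - (2 / dot v v * dot z v) *: v.
  rewrite mulmxBr mulmx1; congr (_ - _); rewrite -scalemxAr mulmxA.
  rewrite [z *m v^T]mx11_scalar -dotE mul_scalar_mx scalerA //.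
have HT : H^T = H.
  by rewrite /H linearB /= trmx1 linearZ /= trmx_mul trmxK.
exists H; split; last first.
  move=> z; rewrite zH -ze dotBl dotZl.
  have vE : dot v e = - (dot v v / 2) by rewrite vvE /v dotBl ee; field.
  have zv : dot z v = dot z w - dot z e by rewrite /v dotBr.
  by rewrite vE zv; field.
have zHH (z : 'rV[R]_m.+1) : z *m H *m H = z.
  have zHv : dot (z *m H) v = - dot z v by rewrite zH dotBl dotZl; field.
  by rewrite (zH (z *m H)) zHv mulrN scaleNr opprK zH subrK.
by rewrite HT; apply/row_matrixP => i; rewrite !rowE mulmxA zHH mulmx1.
Qed.

Definition cap n (w : 'rV[R]_n) (t : R) : set 'rV[R]_n :=
  [set z | enorm z <= 1 /\ 1 - t <= dot z w].

Lemma measurable_cap n (w : 'rV[R]_n) t : measurable (cap w t).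
Proof.
apply: measurableI; first exact: measurable_eball.
apply: closed_measurable_rv.
apply: (@closed_comp _ _ (fun x => dot x w) [set a | 1 - t <= a]); last exact: closed_ge.
by move=> x _; exact: dot_continuous.
Qed.

(** An orthogonal change of variables turns [w] into the first coordinate, along which the cap is
    sliced. The right-hand side does not involve [w]: caps of equal depth have equal volume, which
    [floating_inner] exploits. *)
Lemma rvleb_cap m (w : 'rV[R]_m.+1) t : enorm w = 1 ->
  (rvleb R m.+1 (cap w t) = \int[@lebesgue_measure R]_(x in `[(1 - t)%R, 1%R])
    rvleb R m [set y : 'rV[R]_m | (x ^+ 2 + dot y y <= 1)%R])%E.
Proof.
move=> w1; have [H [HH Hw]] := rotate_to_coord w1.
have detH : `|\det H| = 1.
  have /(congr1 determinant) := HH; rewrite det_mulmx det_tr det1 => /eqP.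
  rewrite -expr2 -real_normK ?num_real// sqrf_eq1 => /orP[/eqP//|/eqP h].
  by have := normr_ge0 (\det H); rewrite h; lra.
have H0 : \det H != 0 by rewrite -normr_eq0 detH oner_neq0.
pose C : set 'rV[R]_m.+1 := [set z | enorm z <= 1 /\ 1 - t <= z 0 ord0].
have mC : measurable C.
  rewrite (_ : C = eball 1 `&` (fun z : 'rV[R]_m.+1 => z 0 ord0) @^-1` `[1 - t, +oo[%classic).
    apply: measurableI; first exact: measurable_eball.
    by rewrite -[X in measurable X]setTI; exact: (measurable_coord ord0).
  by apply/seteqP; split => z; rewrite /C /eball /= in_itv /= andbT.
have -> : cap w t = (fun x => x *m H + 0) @^-1` C.
  apply/seteqP; split => z; rewrite /cap /C /= addr0 Hw /enorm dot_mulmx;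
  by rewrite -mulmxA HH mulmx1.
rewrite rvleb_affine_preimage// detH invr1 mul1e.
have mI : measurable_fun setT (fun x : 'rV[R]_m.+1 => (\1_C x)%:E : \bar R).
  by apply/measurable_EFinP; exact: measurable_indic.
rewrite rvleb_indic// integral_rvlebS// [RHS]integral_mkcond.
apply: eq_integral => x _; rewrite patchE.
have enorm1 y : (enorm (vcons x y) <= 1) = (x ^+ 2 + dot y y <= 1).
  by rewrite enorm_sqr_le// expr1n dot_vcons.
have mS : measurable [set y : 'rV[R]_m | x ^+ 2 + dot y y <= 1].
  rewrite (_ : [set y | _] = (fun y => vcons x y) @^-1` (eball 1)).
    rewrite -[X in measurable X]setTI.
    apply: (measurable_vcons _ _ _ (measurable_eball 1)) => //.
  by apply/seteqP; split => y; rewrite /eball /= enorm1.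
case: ifPn => [|/negP xI].
  rewrite inE /= in_itv /= => /andP[tx x1].
  rewrite [RHS]rvleb_indic//; apply: eq_integral => y _; rewrite !indicE.
  congr ((nat_of_bool _)%:R%:E); apply/idP/idP; rewrite !inE /C /= vcons0 enorm1 //.
  by case.
(* Outside the interval the slice is empty: below by definition of the cap, above because x > 1
   forces x^2 > 1. *)
rewrite integral0_eq// => y _; rewrite indicE memNset// => -[].
rewrite vcons0 enorm1 => h1 h2; apply: xI; rewrite inE /= in_itv /= h2 /=.
have := dot_ge0 y; move: h1; case: (ltP 1 x) => // x1 h1.
have : 1 < x ^+ 2 by rewrite exprn_egt1.
by lra.
Qed.

Section Bounds.
Variables (m : nat) (w : 'rV[R]_m.+2).
Hypothesis w1 : enorm w = 1.

(** The radius is that of a slice of a paraboloid, to which the ball is compared below. At the apex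
    the slice is a point, null because it lies in a hyperplane. *)
Let vol_slice c (x : R) : 0 < c -> x <= 1 ->
  rvleb R m.+1 (eball (Num.sqrt (c * (1 - x)))) =
  (vball R m.+1 * Num.sqrt c ^+ m.+1 * Num.sqrt (1 - x) ^+ m.+1)%:E.
Proof.
move=> c0; rewrite le_eqVlt => /predU1P[->|x1].
  rewrite subrr mulr0 sqrtr0 expr0n /= mulr0; apply/eqP; rewrite eq_le.
  rewrite measure_ge0 andbT.
  apply: (@le_trans _ _ (rvleb R m.+1 [set y | dot y (delta_mx 0 ord0) = 0])); last first.
    rewrite rvleb_hyperplane// -enorm_eq0 -sqrf_eq0 sqr_enorm dot_delta.
    by rewrite mxE !eqxx oner_neq0.
  apply: le_measure; rewrite ?inE.
  - exact: measurable_eball.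
  - apply: closed_measurable_rv.
    apply: (@closed_comp _ _ (fun x => dot x (delta_mx 0 ord0)) [set t | t = 0]);
      last exact: closed_eq.
    by move=> y _; exact: dot_continuous.
  - move=> y; rewrite /eball /= => y0; have /eqP : enorm y == 0.
      by rewrite eq_le y0 enorm_ge0.
    by move/eqP; rewrite enorm_eq0 => /eqP ->; rewrite dot0l.
have x10 : 0 < 1 - x by rewrite subr_gt0.
rewrite rvleb_eball ?sqrtr_gt0 ?mulr_gt0// sqrtrM ?ltW// exprMn.
by congr EFin; ring.
Qed.

Let int_slice c (t : R) : 0 < c -> 0 < t ->
  (\int[@lebesgue_measure R]_(x in `[(1 - t)%R, 1%R])
     rvleb R m.+1 (eball (Num.sqrt (c * (1 - x)))) =
  (2 * vball R m.+1 / m.+3%:R * Num.sqrt c ^+ m.+1 * Num.sqrt t ^+ m.+3)%:E)%E.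
Proof.
move=> c0 t0.
under eq_integral.
  move=> x; rewrite inE /= in_itv /= => /andP[_ x1]; rewrite vol_slice// EFinM.
  over.
have k0 : (0 <= (vball R m.+1 * Num.sqrt c ^+ m.+1)%:E)%E.
  by rewrite lee_fin mulr_ge0 ?exprn_ge0 ?sqrtr_ge0// ltW// vball_gt0.
rewrite ge0_integralZl//.
- by rewrite integral_sqrt_onem// -EFinM; congr EFin; ring.
- apply/measurable_EFinP; apply: measurable_funTS.
  by apply: continuous_measurable_fun; exact: sqrt_onem_continuous.
Qed.

Let eball_sqrt (a : R) : 0 <= a ->
  eball (Num.sqrt a) = [set y : 'rV[R]_m.+1 | dot y y <= a].
Proof.
move=> h; apply/seteqP; split => y; rewrite /eball /= enorm_sqr_le ?sqrtr_ge0//;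
by rewrite sqr_sqrtr.
Qed.

Let dot_slice (a : R) : set 'rV[R]_m.+1 := [set y | dot y y <= a].

Let measurable_slice a : measurable (dot_slice a).
Proof.
rewrite (_ : dot_slice a = (fun y => enorm y ^+ 2) @^-1` `]-oo, a]%classic).
  rewrite -[X in measurable X]setTI.
  have : measurable_fun setT (fun y : 'rV[R]_m.+1 => enorm y ^+ 2).
    by apply: measurable_funX; exact: measurable_enorm.
  by move=> h; exact: h.
by apply/seteqP; split => y; rewrite /= in_itv /= sqr_enorm.
Qed.

Let measurable_rvleb_slice (f : R -> R) : continuous f ->
  measurable_fun setT (fun x : measurableTypeR R => rvleb R m.+1 (dot_slice (f x))).
Proof.
move=> cf; pose A : set (measurableTypeR R * 'rV[R]_m.+1) :=
  [set p | dot p.2 p.2 <= f p.1].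
have mA : measurable A.
  rewrite (_ : A = (fun p => f p.1 - enorm p.2 ^+ 2) @^-1` `[0, +oo[%classic).
    rewrite -[X in measurable X]setTI.
    have : measurable_fun setT (fun p : measurableTypeR R * 'rV[R]_m.+1 =>
        f p.1 - enorm p.2 ^+ 2).
      apply: measurable_funB.
        exact: (measurableT_comp (continuous_measurable_fun cf) measurable_fst).
      apply: measurable_funX.
      exact: (measurableT_comp (@measurable_enorm R _) measurable_snd).
    by move=> h; exact: h.
  by apply/seteqP; split => p /=; rewrite in_itv /= andbT subr_ge0 sqr_enorm.
have := measurable_fun_xsection (rvleb R m.+1) mA.
congr (measurable_fun _ _); apply/funext => x /=; congr (rvleb R m.+1 _).
by apply/seteqP; split => y /=; rewrite xsectionE.
Qed.

Let capE t : rvleb R m.+2 (cap w t) =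
  (\int[@lebesgue_measure R]_(x in `[(1 - t)%R, 1%R])
    rvleb R m.+1 (dot_slice (1 - x ^+ 2)))%E.
Proof.
have sliceE (x : R) :
    [set y : 'rV[R]_m.+1 | x ^+ 2 + dot y y <= 1] = dot_slice (1 - x ^+ 2).
  by apply/seteqP; split => y; rewrite /dot_slice /= lerBrDl.
by rewrite (rvleb_cap t w1); under eq_integral do rewrite sliceE.
Qed.

Let int_sliceE c t : 0 < c -> 0 < t ->
  (\int[@lebesgue_measure R]_(x in `[(1 - t)%R, 1%R])
    rvleb R m.+1 (dot_slice (c * (1 - x))))%E =
  (2 * vball R m.+1 / m.+3%:R * Num.sqrt c ^+ m.+1 * Num.sqrt t ^+ m.+3)%:E.
Proof.
move=> c0 t0; apply: etrans (int_slice c0 t0); apply: eq_integral => x.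
rewrite inE /= in_itv /= => /andP[_ x1].
have h : 0 <= c * (1 - x) by rewrite mulr_ge0 ?(ltW c0)// subr_ge0.
by rewrite (eball_sqrt h).
Qed.

Let continuous_slice c : continuous (fun x : R => c * (1 - x)).
Proof.
move=> x; apply: cvgM; first exact: cvg_cst.
by apply: cvgB; [exact: cvg_cst|exact: cvg_id].
Qed.

Let continuous_sphere : continuous (fun x : R => 1 - x ^+ 2).
Proof. by move=> x; apply: cvgB; [exact: cvg_cst|exact: exprn_continuous]. Qed.

Let le_slice a b : a <= b ->
  (rvleb R m.+1 (dot_slice a) <= rvleb R m.+1 (dot_slice b))%E.
Proof.
move=> ab; apply: le_measure; rewrite ?inE; [exact: measurable_slice..|].
by move=> y /le_trans; apply.
Qed.

(** The ball lies inside a paraboloid: 1 - x^2 <= 2 (1 - x). *)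
Lemma rvleb_cap_le t : 0 < t -> (rvleb R m.+2 (cap w t) <=
  (2 * vball R m.+1 / m.+3%:R * Num.sqrt 2 ^+ m.+1 * Num.sqrt t ^+ m.+3)%:E)%E.
Proof.
move=> t0; rewrite (capE t) -(int_sliceE (ltr0Sn R 1) t0).
apply: ge0_le_integral => //.
- by apply: measurable_funTS; exact: measurable_rvleb_slice.
- by apply: measurable_funTS; exact: measurable_rvleb_slice.
- by move=> x _; apply: le_slice; have := sqr_ge0 (1 - x); lra.
Qed.

(** On [1 - t, 1] one has 1 + x >= 2 - t, hence (2 - t) (1 - x) <= 1 - x^2: the cap contains that of
    a slightly narrower paraboloid. *)
Lemma rvleb_cap_ge t : 0 < t <= 1 ->
  ((2 * vball R m.+1 / m.+3%:R * Num.sqrt (2 - t) ^+ m.+1 * Num.sqrt t ^+ m.+3)%:E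
   <= rvleb R m.+2 (cap w t))%E.
Proof.
move=> /andP[t0 t1]; have c0 : 0 < 2 - t by lra.
rewrite (capE t) -(int_sliceE c0 t0).
apply: ge0_le_integral => //.
- by apply: measurable_funTS; exact: measurable_rvleb_slice.
- by apply: measurable_funTS; exact: measurable_rvleb_slice.
- move=> x; rewrite /= in_itv /= => /andP[tx x1]; apply: le_slice.
  have : 0 <= (1 - x) * (x - (1 - t)) by rewrite mulr_ge0 ?subr_ge0.
  by lra.
Qed.

End Bounds.
End CapVolume.

(** * First and second order Taylor expansions *)

Section DirectionalDerivatives.
Variable R : realType.

Lemma is_derive_epsP (V : normedModType R) (f : V -> R) (a v : V) (d : R) :
  is_derive a v f d <-> forall e, 0 < e -> exists2 r, 0 < r &
    forall h, h != 0 -> `|h| < r -> `|d - h^-1 * (f (h *: v + a) - f a)| < e.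
Proof.
have cvgE (d' : R) : (h^-1 *: ((f \o shift a) (h *: v) - f a) @[h --> 0^'] --> d') <->
    forall e, 0 < e -> exists2 r, 0 < r &
    forall h, h != 0 -> `|h| < r -> `|d' - h^-1 * (f (h *: v + a) - f a)| < e.
  split=> [/cvgrPdist_lt h e /h [r /= r0 hr]|h].
    exists r => // k k0 kr; by apply: hr => //=; rewrite add0r normrN.
  apply/cvgrPdist_lt => e /h[r r0 hr]; exists r => //= k.
  by rewrite /= distrC subr0 => kr k0; exact: hr.
split=> [[dv <-]|h]; first by apply: (iffLR (cvgE _)).
have {}h := iffRL (cvgE _) h.
by apply: DeriveDef; [exact: cvgP h|exact: cvg_lim h].
Qed.

Lemma is_derive1_continuous (f : R -> R) (x d : R) : is_derive x 1 f d -> {for x, continuous f}.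
Proof.
by move=> [dx _]; apply/differentiable_continuous; exact/derivable1_diffP.
Qed.

Lemma MVT0 (f df : R -> R) (a : R) :
  (forall s : R, `|s| <= `|a| -> is_derive s 1 f (df s)) ->
  exists2 t, 0 <= t <= 1 & f a - f 0 = a * df (t * a).
Proof.
move=> dfs; have cf x : `|x| <= `|a| -> {for x, continuous f}.
  by move=> /dfs; exact: is_derive1_continuous.
have [a0|a0|<-] := ltgtP 0 a.
- have [||c] := @MVT R f df 0 a a0.
  + move=> x; rewrite in_itv /= => /andP[x0 xa]; apply: dfs.
    by rewrite !gtr0_norm// ltW.
  + apply: continuous_in_subspaceT => x; rewrite inE /= in_itv /= => /andP[x0 xa].
    by apply: cf; rewrite ger0_norm// ger0_norm// (le_trans x0).
  rewrite in_itv /= => /andP[c0 ca] ->; exists (c / a).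
    by rewrite ler_pdivrMr// mul1r (ltW ca) divr_ge0 ?ltW.
  by rewrite subr0 mulrC divfK// gt_eqF.
- have [||c] := @MVT R f df a 0 a0.
  + move=> x; rewrite in_itv /= => /andP[x0 xa]; apply: dfs.
    by rewrite !ltr0_norm// lerN2 ltW.
  + apply: continuous_in_subspaceT => x; rewrite inE /= in_itv /= => /andP[x0 xa].
    by apply: cf; rewrite ler0_norm// ler0_norm ?lerN2// (le_trans x0).
  rewrite in_itv /= => /andP[c0 ca] h; exists (c / a).
    by rewrite ler_ndivrMr// mul1r (ltW c0) andbT mulr_le0 ?invr_le0 ?ltW.
  by rewrite divfK ?lt_eqF// -opprB h; ring.
- by exists 0; rewrite ?lexx ?ler01// subrr mul0r.
Qed.

Lemma is_derive_line (V : normedModType R) (f : V -> R) (a v : V) (s d : R) :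
  is_derive (s *: v + a) v f d -> is_derive s 1 (fun t => f (t *: v + a)) d.
Proof.
move/is_derive_epsP => h; apply/is_derive_epsP => e /h[r r0 hr]; exists r => // k k0 kr.
have := hr k k0 kr; rewrite addrA -scalerDl.
by rewrite (_ : k *: 1 + s = k + s)// [k *: 1]mulr1.
Qed.

Variable n : nat.
Implicit Types (f : 'rV[R]_n -> R) (x v e : 'rV[R]_n).

Lemma MVT_line f x v (a : R) (df : 'rV[R]_n -> R) :
  (forall s : R, `|s| <= `|a| -> is_derive (s *: v + x) v f (df (s *: v + x))) ->
  exists2 c, `|c| <= `|a| & f (a *: v + x) - f x = a * df (c *: v + x).
Proof.
move=> dfv; have [t /andP[t0 t1]] := @MVT0 (fun t => f (t *: v + x)) (fun t => df (t *: v + x)) a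
    (fun s sa => is_derive_line (dfv s sa)).
rewrite scale0r add0r => h; exists (t * a) => //.
by rewrite normrM ger0_norm// ler_piMl.
Qed.

(** Move along [v] first, then along [e]: the mean value theorem expresses the second increment by
    [df] at a nearby point, and continuity of [df] replaces that point by [x]. This is the inductive
    step of [is_derive_grad]. *)
Lemma is_derive_addv f x v e (c d : R) (df : 'rV[R]_n -> R) :
  (\forall y \near x, is_derive y e f (df y)) -> {for x, continuous df} ->
  is_derive x v f d -> is_derive x (v + c *: e) f (d + c * df x).
Proof.
move=> /nbhs_enormP[r r0 dfe] cdf dv; apply/is_derive_epsP => eps eps0.
have c10 : 0 < `|c| + 1 by rewrite ltr_wpDl.
pose eta := eps / 2 / (`|c| + 1).
have eta0 : 0 < eta by rewrite !divr_gt0.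
have /nbhs_enormP[r' r'0 cdf'] : \forall y \near x, `|df x - df y| < eta.
  by move/cvgrPdist_lt : cdf; exact.
have [|r'' r''0 dv'] := (iffLR (is_derive_epsP _ _ _ _) dv) (eps / 2).
  by rewrite divr_gt0.
pose N := enorm v + `|c| * enorm e + 1.
have N0 : 0 < N by rewrite ltr_wpDl// addr_ge0 ?mulr_ge0 ?enorm_ge0.
exists (Num.min r'' (Num.min r r' / N)).
  by rewrite lt_min r''0 divr_gt0// lt_min r0.
move=> h h0; rewrite lt_min => /andP[hr''].
rewrite ltr_pdivlMr// lt_min => /andP[hr hr'].
have near_x s : `|s| <= `|h * c| -> enorm (s *: e + (h *: v + x) - x) <= `|h| * N.
  move=> sh; rewrite addrA addrK (le_trans (ler_enormD _ _))// !enormZ /N.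
  rewrite !mulrDr mulr1 addrC -addrA lerD2l ler_wpDr// mulrA -normrM.
  by rewrite ler_wpM2r ?enorm_ge0.
have [|s sh E] := @MVT_line f (h *: v + x) e (h * c) df.
  by move=> s /near_x sx; apply: dfe; exact: le_lt_trans hr.
have -> : h^-1 * (f (h *: (v + c *: e) + x) - f x) =
    h^-1 * (f (h *: v + x) - f x) + c * df (s *: e + (h *: v + x)).
  have -> : f (h *: (v + c *: e) + x) - f x =
      (f (h *: v + x) - f x) + h * c * df (s *: e + (h *: v + x)).
    rewrite (_ : h *: (v + c *: e) + x = (h * c) *: e + (h *: v + x)).
      by rewrite -E; ring.
    by rewrite scalerDr scalerA addrA [(h * c) *: e + _]addrC.
  by rewrite mulrDr -[h * c * _]mulrA mulKf.
rewrite opprD addrACA -mulrBr (le_lt_trans (ler_normD _ _))// (splitr eps) ltrD//.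
  exact: dv'.
rewrite normrM; have := cdf' _ (le_lt_trans (near_x _ sh) hr').
rewrite /eta ltr_pdivlMr// => k; apply: le_lt_trans k.
by rewrite mulrC ler_wpM2l// lerDl.
Qed.

(** Only coordinate derivatives are given; [v] is built up from multiples of the basis vectors, one
    at a time. *)
Lemma is_derive_grad f x v :
  (forall i, (\forall y \near x, derivable f y (evec R i)) /\
             {for x, continuous (partial i f)}) ->
  is_derive x v f (dot (grad f x) v).
Proof.
move=> fi.
have sum_derive (r : seq 'I_n) :
    is_derive x (\sum_(i <- r) v 0 i *: evec R i) f (\sum_(i <- r) v 0 i * partial i f x).
  elim: r => [|i r IH].
    rewrite !big_nil; apply/is_derive_epsP => e e0; exists 1 => // h h0 _.
    by rewrite scaler0 !add0r subrr mulr0 oppr0 normr0.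
  rewrite !big_cons addrC [X in is_derive _ _ _ X]addrC.
  apply: (@is_derive_addv f x _ (evec R i) _ _ (partial i f)) => //.
    have [+ _] := fi i; apply: filterS => y dy; exact: DeriveDef.
  by have [] := fi i.
have := sum_derive (index_enum 'I_n).
rewrite (_ : \sum_(i <- _) _ *: _ = v); last first.
  by rewrite [RHS]row_sum_delta.
congr is_derive; rewrite /dot; apply: eq_bigr => i _.
by rewrite mxE mulrC.
Qed.

End DirectionalDerivatives.

Section SecondOrder.
Variable R : realType.

(** Subtracting the quadratic polynomial with second derivative [M] leaves a function with
    nonpositive derivative on [0, 1]. Applied to [- f], the same bound gives the lower estimate. *)
Lemma taylor2_le (f df ddf : R -> R) (M : R) :
  (forall s : R, `|s| <= 1 -> is_derive s 1 f (df s)) ->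
  (forall s : R, `|s| <= 1 -> is_derive s 1 df (ddf s)) ->
  (forall s : R, `|s| <= 1 -> ddf s <= M) ->
  f 1 <= f 0 + df 0 + M / 2.
Proof.
move=> f' df' ddfM.
have dfM s : 0 <= s <= 1 -> df s <= df 0 + M * s.
  move=> /andP[s0 s1]; have ns : `|s| <= 1 by rewrite ger0_norm.
  have [|t /andP[t0 t1] h] := @MVT0 R df ddf s.
    by move=> r rs; apply: df'; exact: le_trans ns.
  have : s * ddf (t * s) <= s * M.
    rewrite ler_wpM2l//; apply: ddfM; rewrite normrM (ger0_norm t0).
    by rewrite mulr_ile1.
  by rewrite -h; lra.
pose k s := f s - (df 0 * s + M / 2 * s ^+ 2).
pose dk s := df s - (df 0 + M * s).
have dkP (s : R) : `|s| <= `|1 : R| -> is_derive s 1 k (dk s).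
  rewrite normr1 => s1; have := f' s s1.
  have dlin : is_derive s 1 (fun s : R => df 0 * s) (df 0).
    by apply: (is_derive_eq (is_deriveZ (df 0) (is_derive_id s (1 : R)))); rewrite [LHS]mulr1.
  have dX : is_derive s 1 (@GRing.exp R ^~ 2%N) (2 * s).
    apply: DeriveDef; first exact: exprn_derivable.
    by rewrite exp_derive /GRing.scale /= mulr1 expr1.
  have dq : is_derive s 1 (fun s : R => M / 2 * s ^+ 2) (M * s).
    by apply: (is_derive_eq (is_deriveZ (M / 2) dX)); rewrite /GRing.scale /=; field.
  by move=> dfs; exact: (is_deriveB dfs (is_deriveD dlin dq)).
have [t /andP[t0 t1]] := MVT0 dkP.
rewrite mulr1 mul1r /k /dk => h.
have := dfM t; rewrite t0 t1 => /(_ isT) ht.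
by move: h; rewrite !mulr1 expr1n mulr1 !mulr0 expr0n /= mulr0 !addr0 subr0; lra.
Qed.

Variables (n : nat) (U : set 'rV[R]_n) (F : 'rV[R]_n -> R).
Hypotheses (oU : open U) (C2 : C2_on U F).
Implicit Types x y v w : 'rV[R]_n.

Lemma C2_is_derive x v : U x -> is_derive x v F (dot (grad F x) v).
Proof.
move=> Ux; apply: is_derive_grad => i; split.
  apply: filterS (open_nbhs_nbhs (conj oU Ux)) => y Uy.
  by have [_ /(_ i i)[]] := C2 Uy.
by have [_ /(_ i i)[_ []]] := C2 Ux.
Qed.

Lemma C2_is_derive_grad x v w : U x ->
  is_derive x w (fun y => dot (grad F y) v) (dot (v *m hess F x) w).
Proof.
move=> Ux.
have dpart i : is_derive x w (partial i F) (dot (grad (partial i F) x) w).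
  apply: is_derive_grad => j; split.
    apply: filterS (open_nbhs_nbhs (conj oU Ux)) => y Uy.
    by have [_ /(_ i j)[_ [_ []]]] := C2 Uy.
  by have [_ /(_ i j)[_ [_ []]]] := C2 Ux.
have -> : (fun y => dot (grad F y) v) = \sum_(i < n) (v 0 i \*: partial i F).
  by apply/funext => y; rewrite fct_sumE; apply: eq_bigr => i _; rewrite !mxE mulrC.
apply: (is_derive_eq (is_derive_sum (fun i => is_deriveZ (v 0 i) (dpart i)))).
under eq_bigr => i _ do rewrite /GRing.scale /= /dot mulr_sumr.
rewrite exchange_big; apply: eq_bigr => j _ /=; rewrite mxE mulr_suml.
by apply: eq_bigr => i _; rewrite !mxE mulrA.
Qed.

Lemma C2_taylor_le x v M : (forall s : R, `|s| <= 1 -> U (s *: v + x)) ->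
  (forall s : R, `|s| <= 1 -> dot (v *m hess F (s *: v + x)) v <= M) ->
  F (v + x) <= F x + dot (grad F x) v + M / 2.
Proof.
move=> Uv hM; have := @taylor2_le (fun s => F (s *: v + x))
  (fun s => dot (grad F (s *: v + x)) v) _ M _ _ hM.
rewrite scale1r scale0r add0r; apply => s s1.
  by apply: is_derive_line; apply: C2_is_derive; exact: Uv.
apply: (@is_derive_line _ _ (fun y => dot (grad F y) v)).
by apply: C2_is_derive_grad; exact: Uv.
Qed.

Lemma C2_taylor_ge x v M : (forall s : R, `|s| <= 1 -> U (s *: v + x)) ->
  (forall s : R, `|s| <= 1 -> M <= dot (v *m hess F (s *: v + x)) v) ->
  F x + dot (grad F x) v + M / 2 <= F (v + x).
Proof.
move=> Uv hM; have := @taylor2_le (- (fun s => F (s *: v + x)))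
  (- (fun s => dot (grad F (s *: v + x)) v))
  (- (fun s => dot (v *m hess F (s *: v + x)) v)) (- M).
rewrite !opprfctE scale1r scale0r add0r => H.
suff : - F (v + x) <= - F x + - dot (grad F x) v + - M / 2 by lra.
apply: H => s s1; last by rewrite lerN2 hM.
  by apply: is_deriveN; apply: is_derive_line; apply: C2_is_derive; exact: Uv.
apply: is_deriveN; apply: (@is_derive_line _ _ (fun y => dot (grad F y) v)).
by apply: C2_is_derive_grad; exact: Uv.
Qed.

Lemma quad_le (A : 'M[R]_n) v (eta : R) : (forall i j, `|A i j| <= eta) ->
  `|dot (v *m A) v| <= n%:R * n%:R * eta * enorm v ^+ 2.
Proof.
move=> Aeta; rewrite /dot (le_trans (ler_norm_sum _ _ _))//.
apply: (@le_trans _ _ (\sum_(j < n) (n%:R * eta * enorm v ^+ 2))); last first.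
  by rewrite sumr_const card_ord -[leLHS]mulr_natl !mulrA.
apply: ler_sum => j _; rewrite mxE mulr_suml (le_trans (ler_norm_sum _ _ _))//.
apply: (@le_trans _ _ (\sum_(i < n) (eta * enorm v ^+ 2))); last first.
  by rewrite sumr_const card_ord -[leLHS]mulr_natl !mulrA.
apply: ler_sum => i _; rewrite !normrM mulrAC mulrC expr2.
by apply: ler_pM => //; apply: ler_pM => //; exact: coord_le_enorm.
Qed.

Lemma hess_near x (eta : R) : U x -> 0 < eta ->
  \forall y \near x, forall i j, `|(hess F y - hess F x) i j| <= eta.
Proof.
move=> Ux eta0; have H i j : \forall y \near x, `|(hess F y - hess F x) i j| <= eta.
  have [_ /(_ i j)[_ [_ [_ ]]]] := C2 Ux.
  have E y : (hess F y - hess F x) i j =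
      partial j (partial i F) y - partial j (partial i F) x by rewrite !mxE.
  move: (partial j (partial i F)) E => p E /cvgrPdist_lt/(_ _ eta0).
  by apply: filterS => y; rewrite E distrC; exact: ltW.
have H' i : \forall y \near x, forall j, `|(hess F y - hess F x) i j| <= eta.
  exact: (filter_forall _ (H i)).
exact: (filter_forall _ H').
Qed.

Lemma C2_taylor x (eps : R) : U x -> 0 < eps ->
  exists2 r, 0 < r & forall v, enorm v < r ->
    `|F (v + x) - F x - dot (grad F x) v - dot (v *m hess F x) v / 2| <=
      eps * enorm v ^+ 2.
Proof.
move=> Ux eps0; pose eta := eps / (n%:R * n%:R + 1).
have nn0 : 0 < n%:R * n%:R + 1 :> R by rewrite ltr_wpDl// mulr_ge0.
have eta0 : 0 < eta by rewrite divr_gt0.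
have /nbhs_enormP[r r0 hr] : \forall y \near x, U y /\
    forall i j, `|(hess F y - hess F x) i j| <= eta.
  by apply: filterI; [exact: open_nbhs_nbhs|exact: hess_near].
exists r => // v vr.
have line s : `|s| <= 1 -> enorm (s *: v + x - x) < r.
  by move=> s1; rewrite addrK enormZ (le_lt_trans _ vr)// ler_piMl// enorm_ge0.
have quad s : `|s| <= 1 ->
    `|dot (v *m hess F (s *: v + x)) v - dot (v *m hess F x) v| <= eps * enorm v ^+ 2.
  move=> /line /hr[_ h]; rewrite -dotBl -mulmxBr (le_trans (quad_le v h))//.
  rewrite ler_wpM2r ?sqr_ge0// /eta mulrA ler_pdivrMr// mulrC ler_wpM2l ?ltW//.
  by rewrite ltrDl.
have Uv s : `|s| <= 1 -> U (s *: v + x) by move=> /line /hr[].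
have E0 : 0 <= eps * enorm v ^+ 2 by rewrite mulr_ge0 ?sqr_ge0 ?ltW.
have h1 := @C2_taylor_le x v (dot (v *m hess F x) v + eps * enorm v ^+ 2) Uv.
have h2 := @C2_taylor_ge x v (dot (v *m hess F x) v - eps * enorm v ^+ 2) Uv.
have {}h1 : F (v + x) <=
    F x + dot (grad F x) v + (dot (v *m hess F x) v + eps * enorm v ^+ 2) / 2.
  by apply: h1 => s /quad; rewrite ler_distl => /andP[].
have {}h2 : F x + dot (grad F x) v + (dot (v *m hess F x) v - eps * enorm v ^+ 2) / 2
    <= F (v + x).
  by apply: h2 => s /quad; rewrite ler_distl => /andP[].
move: h1 h2 E0; rewrite ler_norml.
move: (F (v + x)) (F x) (dot (grad F x) v) (dot (v *m hess F x) v) (eps * _) => *.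
by apply/andP; split; lra.
Qed.

(** The constants serve all base points [y] near [x]; this local uniformity is what [uniform_ball]
    feeds to compactness. *)
Lemma C2_quad_upper x : U x -> exists M r, [/\ 0 < M, 0 < r &
  forall y z, enorm (y - x) < r -> enorm (z - x) < r ->
    U y /\ F z <= F y + dot (grad F y) (z - y) + M * enorm (z - y) ^+ 2].
Proof.
move=> Ux; pose B := \sum_i \sum_j `|hess F x i j| + 1.
have /nbhs_enormP[r r0 hr] : \forall y \near x, U y /\
    forall i j, `|(hess F y - hess F x) i j| <= 1.
  by apply: filterI; [exact: open_nbhs_nbhs|exact: hess_near].
have B0 : 0 < B by rewrite ltr_wpDl// sumr_ge0// => i _; rewrite sumr_ge0.
have hB y i j : enorm (y - x) < r -> `|hess F y i j| <= B.
  move=> /hr[_ /(_ i j)]; rewrite !mxE => h.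
  rewrite -[partial j _ y](subrK (partial j (partial i F) x)).
  rewrite (le_trans (ler_normD _ _))// addrC lerD//.
  rewrite (bigD1 i)//= (bigD1 j)//= !mxE -addrA lerDl addr_ge0//.
    by rewrite sumr_ge0.
  by rewrite sumr_ge0// => k _; rewrite sumr_ge0.
(* One third, so that s (z - y) + y stays within r of x for |s| <= 1: its distance is at most |z -
   y| + |y - x| < 3 (r / 3). *)
exists (n%:R * n%:R * B + 1), (r / 3); split.
- by rewrite ltr_wpDl// !mulr_ge0// ltW.
- by rewrite divr_gt0.
move=> y z yr zr.
have line s : `|s| <= 1 -> enorm (s *: (z - y) + y - x) < r.
  move=> s1; rewrite -addrA (le_lt_trans (ler_enormD _ _))// enormZ.
  have : `|s| * enorm (z - y) <= enorm (z - y) by rewrite ler_piMl ?enorm_ge0.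
  have := ler_enormD (z - x) (x - y); rewrite addrA subrK.
  by rewrite (enorm_distC x y); lra.
have Uy : U y by apply: (hr _ _).1; lra.
split => //.
have := @C2_taylor_le y (z - y) (2 * (n%:R * n%:R * B * enorm (z - y) ^+ 2)).
rewrite subrK => h; apply: le_trans (h _ _) _.
- by move=> s /line /hr[].
- move=> s /line sr; rewrite (le_trans (ler_norm _))//.
  rewrite (le_trans (@quad_le _ _ B _))//; first by move=> i j; exact: hB.
  have : 0 <= n%:R * n%:R * B * enorm (z - y) ^+ 2.
    by rewrite mulr_ge0 ?sqr_ge0// mulr_ge0 ?(ltW B0)// mulr_ge0.
  by move: (_ * _ ^+ 2) => t t0; lra.
rewrite [X in _ + X <= _](_ : _ = n%:R * n%:R * B * enorm (z - y) ^+ 2); last by field.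
by rewrite lerD2l ler_wpM2r ?sqr_ge0// lerDl.
Qed.

Let evec1 (i : 'I_n) : enorm (evec R i) = 1 :> R.
Proof.
apply/eqP; rewrite -(@eqrXn2 _ 2%N) ?enorm_ge0// sqr_enorm dot_delta mxE !eqxx.
by rewrite expr1n.
Qed.

Lemma is_derive_shift (f : 'rV[R]_n -> R) x e c (d : R) :
  is_derive (x + c) e f d -> is_derive x e (fun y => f (y + c)) d.
Proof.
move/is_derive_epsP => h; apply/is_derive_epsP => eps /h[r r0 hr]; exists r => // k k0 kr.
by rewrite -addrA; exact: hr.
Qed.

(** Mean value theorem in direction i for the increment in direction j, then in direction j for the
    partial derivative. *)
Lemma second_difference x i j (r h : R) : 0 < h -> 2 * h < r ->
  (forall y, enorm (y - x) < r -> U y) ->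
  exists2 p, enorm (p - x) <= 2 * h &
    F (h *: evec R i + x + h *: evec R j) - F (h *: evec R i + x)
      - (F (x + h *: evec R j) - F x) = h * h * partial j (partial i F) p.
Proof.
move=> h0 hr Ur.
have near_x (s t : R) : `|s| <= `|h| -> `|t| <= `|h| ->
    enorm (t *: evec R j + (s *: evec R i + x) - x) <= 2 * h.
  rewrite (gtr0_norm h0) => sh th; rewrite addrA addrK (le_trans (ler_enormD _ _))//.
  by rewrite !enormZ !evec1 !mulr1; lra.
have U_ (s t : R) : `|s| <= `|h| -> `|t| <= `|h| -> U (t *: evec R j + (s *: evec R i + x)).
  by move=> sh th; apply: Ur; exact: le_lt_trans (near_x s t sh th) hr.
have n0 : `|0 : R| <= `|h| by rewrite normr0.
pose f y := F (y + h *: evec R j) - F y.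
have [|s sh Es] := @MVT_line R n f x (evec R i) h
    (fun y => partial i F (y + h *: evec R j) - partial i F y).
  move=> s sh; have dF y : U y -> is_derive y (evec R i) F (partial i F y).
    by move=> Uy; apply: DeriveDef => //; have [_ /(_ i i)[]] := C2 Uy.
  apply: is_deriveB.
    by apply: is_derive_shift; apply: dF; rewrite addrC; exact: U_.
  by apply: dF; have := U_ s 0 sh n0; rewrite scale0r add0r.
have [|t th Et] := @MVT_line R n (partial i F) (s *: evec R i + x) (evec R j) h
    (partial j (partial i F)).
  move=> t th; have [_ /(_ i j)[_ [_ [dd _]]]] := C2 (U_ s t sh th).
  exact: DeriveDef.
exists (t *: evec R j + (s *: evec R i + x)); first exact: near_x.
by rewrite -mulrA -Et [h *: evec R j + _]addrC.
Qed.

(** Schwarz's theorem: the second difference is symmetric in i and j, so the two mixed derivatives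
    agree at suitable points close to x, and continuity brings both points to x. *)
Lemma hess_sym x : U x -> (hess F x)^T = hess F x.
Proof.
move=> Ux; apply/matrixP => i j; rewrite mxE.
apply/eqP; rewrite -subr_eq0 -normr_le0; apply/ler_addgt0Pr => eps eps0.
have e20 : 0 < eps / 2 by rewrite divr_gt0.
have /nbhs_enormP[r r0 hr] : \forall y \near x, U y /\
    forall i j, `|(hess F y - hess F x) i j| <= eps / 2.
  by apply: filterI; [exact: open_nbhs_nbhs|exact: hess_near].
pose h := r / 3; have h0 : 0 < h by rewrite divr_gt0.
have h2 : 2 * h < r by rewrite /h; lra.
have Ur y : enorm (y - x) < r -> U y by move=> /hr[].
have [p px Ep] := second_difference i j h0 h2 Ur.
have [q qx Eq] := second_difference j i h0 h2 Ur.
have pq : hess F p i j = hess F q j i.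
  have hh : h * h != 0 by rewrite mulf_neq0 ?gt_eqF.
  have hE y k l : hess F y k l = partial l (partial k F) y by rewrite mxE.
  apply: etrans (hE p i j) (etrans _ (esym (hE q j i))).
  move: (partial j (partial i F) p) (partial i (partial j F) q) Ep Eq => a b Ep Eq.
  apply: (mulfI hh); rewrite -Ep -Eq.
  have -> : h *: evec R i + x + h *: evec R j = h *: evec R j + x + h *: evec R i.
    by rewrite addrC addrA addrAC.
  rewrite (addrC x (h *: evec R j)) (addrC x (h *: evec R i)).
  move: (F (_ + _ + _)) (F (h *: evec R j + x)) (F (h *: evec R i + x)) (F x) => *; ring.
have [_ hp] := hr p (le_lt_trans px h2); have [_ hq] := hr q (le_lt_trans qx h2).
move: (hess F p) (hess F q) (hess F x) pq hp hq => A B C pq hp hq.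
have := hp i j; have := hq j i; rewrite !mxE pq add0r.
move: (B j i) (C j i) (C i j) => a b c.
rewrite !ler_norml => /andP[a1 a2] /andP[b1 b2]; clear -a1 a2 b1 b2.
by apply/andP; split; lra.
Qed.

End SecondOrder.

(** * Quadratic forms and ellipsoids *)

Section QuadraticForms.
Variable R : realType.

Definition bordered n (M : 'M[R]_n) (g : 'rV[R]_n) : 'M[R]_(n + 1) :=
  block_mx M g^T g (0 : 'M[R]_(1, 1)).

(** Induction on the Schur complement of the first diagonal entry. *)
Lemma cholesky n (M : 'M[R]_n) : M^T = M ->
  (forall v, v != 0 -> 0 < dot (v *m M) v) ->
  exists2 S, S \in unitmx & M = S *m S^T.
Proof.
elim: n M => [|n IH] M symM pdM.
  by exists 1%:M; [exact: unitmx1|apply/matrixP => -[]].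
pose M' : 'M[R]_(1 + n) := M.
pose a := ulsubmx M' 0 0; pose r := ursubmx M'; pose N := drsubmx M'.
have rT : dlsubmx M' = r^T.
  by rewrite /r trmx_ursub; congr dlsubmx; exact: esym symM.
have ME : M = block_mx (a%:M : 'M[R]_1) r r^T N.
  have -> : (a%:M : 'M[R]_1) = ulsubmx M' by rewrite [RHS]mx11_scalar.
  by rewrite -rT; exact: (esym (submxK M')).
have NT : N^T = N by rewrite /N trmx_drsub; congr drsubmx; exact: symM.
have a0 : 0 < a.
  have := pdM (row_mx (1%:M : 'M[R]_1) (0 : 'rV[R]_n)).
  have -> : row_mx (1%:M : 'M[R]_1) (0 : 'rV[R]_n) != 0.
    apply/eqP => /(congr1 (@lsubmx _ 1 1 n)) /matrixP /(_ 0 0).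
    by rewrite row_mxKl !mxE eqxx => /eqP; rewrite oner_eq0.
  move=> /(_ isT); rewrite ME (@mul_row_block _ 1 1 n 1 n) ?(mul0mx,mulmx0,mul1mx,mulmx1) ?(addr0,add0r).
  rewrite dotE (@tr_row_mx _ 1 1 n) (@mul_row_col _ 1 1 n) trmx1 trmx0 mulmx1 mulmx0 addr0.
  by rewrite mxE eqxx.
pose K := N - a^-1 *: (r^T *m r).
have KT : K^T = K by rewrite /K linearB /= NT linearZ /= trmx_mul trmxK.
have [y y0|S uS KE] := IH K KT.
  (* The first coordinate that minimizes the form for a given [y]; the minimum is the value at [y]
     of the form of [K], which is therefore positive. *)
  pose x := - (a^-1 *: (y *m r^T)).
  have := pdM (row_mx x y).
  have -> : row_mx x y != 0.
    apply: contra_neq y0 => /(congr1 (@rsubmx _ 1 1 n)); rewrite row_mxKr => ->.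
    by apply/matrixP => i j; rewrite !mxE.
  move=> /(_ isT); rewrite ME (@mul_row_block _ 1 1 n 1 n) mul_mx_scalar.
  rewrite /x scalerN scalerA mulfV ?gt_eqF// scale1r addNr.
  rewrite dotE (@tr_row_mx _ 1 1 n) (@mul_row_col _ 1 1 n) mul0mx add0r -dotE.
  by rewrite /K mulmxBr mulNmx -scalemxAl -mulmxA scalemxAr addrC.
pose s := Num.sqrt a; have s0 : 0 < s by rewrite sqrtr_gt0.
have ss : s * s = a by rewrite -expr2 sqr_sqrtr ?ltW.
exists (block_mx (s%:M : 'M[R]_1) 0 (s^-1 *: r^T) S : 'M[R]_(1 + n)).
  rewrite unitmxE (@det_lblock _ 1 n) det_scalar1 unitrM unitfE gt_eqF//=.
rewrite (@tr_block_mx _ 1 n 1 n) (@mulmx_block _ 1 n 1 n 1 n) ME.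
rewrite tr_scalar_mx trmx0 linearZ /= trmxK ?(mul0mx,mulmx0,mul1mx,mulmx1) ?(addr0,add0r) -KE.
rewrite -scalar_mxM ss mul_scalar_mx scalerA mulfV ?gt_eqF// scale1r.
rewrite mul_mx_scalar scalerA mulfV ?gt_eqF// scale1r.
rewrite -scalemxAl -scalemxAr scalerA -invfM ss /K addrC subrK //.
Qed.

(** Schur complement of the block [M]. For an invertible Hessian the curvature thus reads <g M^-1,
    g> det M / |g|^(n+1). *)
Lemma det_bordered n (M : 'M[R]_n) g : M \in unitmx ->
  - \det (bordered M g) = dot (g *m invmx M) g * \det M.
Proof.
move=> uM.
have -> : bordered M g = block_mx 1%:M 0 (g *m invmx M) 1%:M *m
    block_mx M g^T 0 (- (g *m invmx M *m g^T)).
  rewrite mulmx_block ?(mul0mx,mulmx0,mul1mx,mulmx1) ?(addr0,add0r) mulmxKV//.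
  by rewrite subrr.
rewrite det_mulmx det_lblock !det1 !mul1r det_ublock.
by rewrite [X in _ * \det X]mx11_scalar det_scalar1 mxE -dotE mulrN opprK mulrC.
Qed.

(* Hence the Gauss curvature does not see the term [lambda *: (g^T *m g)] that
   makes the Hessian positive definite ([quad_shear_pos]). *)
Lemma det_bordered_shear n (M : 'M[R]_n) g (lambda : R) :
  \det (bordered (M + lambda *: (g^T *m g)) g) = \det (bordered M g).
Proof.
have -> : bordered (M + lambda *: (g^T *m g)) g =
    block_mx 1%:M (lambda *: g^T) 0 1%:M *m bordered M g.
  rewrite mulmx_block ?(mul0mx,mulmx0,mul1mx,mulmx1) ?(addr0,add0r).
  by rewrite -scalemxAl.
by rewrite det_mulmx det_ublock !det1 !mul1r.
Qed.

Lemma det_borderedZ n (M : 'M[R]_n) g (c : R) :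
  \det (bordered M (c *: g)) = c ^+ 2 * \det (bordered M g).
Proof.
have -> : bordered M (c *: g) =
    block_mx 1%:M 0 0 (c%:M : 'M[R]_1) *m bordered M g *m block_mx 1%:M 0 0 (c%:M : 'M[R]_1).
  rewrite !mulmx_block ?(mul0mx,mulmx0,mul1mx,mulmx1) ?(addr0,add0r) ?(mul0mx,mulmx0,mul1mx,mulmx1).
  by rewrite mul_scalar_mx mul_mx_scalar /bordered linearZ.
rewrite !det_mulmx !det_lblock !det1 !mul1r det_scalar1; ring.
Qed.

(** Sublevel set of a second order Taylor polynomial: for non-zero [g], the origin lies on its
    boundary with outer normal [g]. *)
Definition ellipsoid n (M : 'M[R]_n) (g : 'rV[R]_n) : set 'rV[R]_n :=
  [set y | dot g y + dot (y *m M) y / 2 <= 0].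

(** Complete the square with M = S S^T. The third clause says that the support function of the
    ellipsoid in the direction of [g] is 0, so the supporting hyperplane passes through the origin;
    the fourth identifies the ratio that governs cap depths with the curvature formula. *)
Lemma ellipsoidP n (M : 'M[R]_n) (g : 'rV[R]_n) : g != 0 -> M^T = M ->
  (forall v, v != 0 -> 0 < dot (v *m M) v) ->
  exists c T, [/\ T \in unitmx,
    ellipsoid M g = [set c + z *m T | z in eball 1],
    dot c ((enorm g)^-1 *: g) + enorm ((enorm g)^-1 *: g *m T^T) = 0 &
    enorm ((enorm g)^-1 *: g *m T^T) ^+ n.+1 / (\det T) ^+ 2 =
      - \det (bordered M g) / enorm g ^+ n.+1].
Proof.
move=> g0 symM pdM; have [S uS MS] := cholesky symM pdM.
have gn0 : enorm g != 0 by rewrite enorm_eq0.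
have gp : 0 < enorm g by rewrite enorm_gt0.
(* The polynomial equals (|y S + b|^2 - |b|^2) / 2, so in the variable y S its sublevel set is the
   ball of centre -b and radius [rho]. *)
pose P := invmx S; pose b := g *m P^T; pose rho := enorm b.
have uP : P \in unitmx by rewrite unitmx_inv.
have b0 : b != 0.
  apply: contra_neq g0 => /(congr1 (mulmx^~ (S^T))).
  by rewrite /b -mulmxA -trmx_mul mulmxV// trmx1 mulmx1 mul0mx.
have rho0 : 0 < rho by rewrite enorm_gt0.
have uM : M \in unitmx by rewrite MS unitmx_mul uS unitmx_tr.
have invM : invmx M = P^T *m P.
  apply: (can_inj (mulmxK uM)); rewrite mulVmx// [in RHS]MS.
  by rewrite -mulmxA (mulmxA P S) mulVmx// mul1mx -trmx_mul mulmxV// trmx1.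
have detS : \det S != 0 by rewrite -unitfE -unitmxE.
exists (- (b *m P)), (rho *: P); split.
- by rewrite unitmxZ// unitfE gt_eqF.
- have qE y : dot g y + dot (y *m M) y / 2 =
      (dot (y *m S + b) (y *m S + b) - rho ^+ 2) / 2.
    have -> : dot g y = dot b (y *m S).
      by rewrite /b dot_mulmx trmxK mulmxK.
    have -> : dot (y *m M) y = dot (y *m S) (y *m S).
      by rewrite [in LHS]MS mulmxA dot_mulmx trmxK.
    rewrite dotDl !dotDr /rho sqr_enorm (dotC (y *m S) b).
    by field.
  apply/seteqP; split => [y|_ [z z1 <-]]; rewrite /ellipsoid /= qE.
    move=> h; exists (rho^-1 *: (y *m S + b)); last first.
      rewrite -scalemxAr -scalemxAl scalerA mulfV ?gt_eqF// scale1r mulmxDl.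
      by rewrite mulmxK// addrC addrK.
    rewrite /eball /= enormZ gtr0_norm ?invr_gt0// mulrC ler_pdivrMr// mul1r.
    by rewrite enorm_sqr_le ?(ltW rho0)//; lra.
  have -> : (- (b *m P) + z *m (rho *: P)) *m S + b = rho *: z.
    by rewrite mulmxDl -scalemxAr -scalemxAl mulmxKV// mulNmx mulmxKV// addrAC addNr add0r.
  rewrite dotZl dotZr -sqr_enorm; have : enorm z ^+ 2 <= 1.
    by rewrite expr_le1// enorm_ge0.
  move=> h; have : rho ^+ 2 * enorm z ^+ 2 <= rho ^+ 2 by rewrite ler_piMr ?sqr_ge0.
  by rewrite expr2; lra.
- rewrite linearZ /= -scalemxAr -scalemxAl -/b !enormZ !gtr0_norm ?invr_gt0//.
  rewrite dotNl dotZr dot_mulmx -/b -sqr_enorm -/rho; ring.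
- rewrite linearZ /= -scalemxAr -scalemxAl -/b !enormZ !gtr0_norm ?invr_gt0// -/rho.
rewrite det_bordered// invM mulmxA dot_mulmx -/b -sqr_enorm -/rho.
rewrite MS det_mulmx det_tr detZ det_inv.
have rn0 : rho ^+ n != 0 by rewrite expf_neq0 ?gt_eqF.
have gnn : enorm g ^+ n.+1 != 0 by rewrite expf_neq0.
rewrite !exprMn exprVn exprS.
move: (rho ^+ n) (enorm g ^+ n.+1) rn0 gnn => r G r0 G0.
by field; rewrite detS G0 r0.
Qed.
Lemma continuous_det n (A : R -> 'M[R]_n) :
  (forall i j, continuous (fun e => A e i j)) -> continuous (fun e => \det (A e)).
Proof.
move=> cA; rewrite /determinant.
have cprod (s : {perm 'I_n}) (r : seq 'I_n) : continuous (fun e => \prod_(i <- r) A e i (s i)).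
  elim: r => [|i r IH]; first by under eq_fun do rewrite big_nil; exact: cst_continuous.
  under eq_fun do rewrite big_cons.
  by move=> e; apply: cvgM; [exact: cA|exact: IH].
have csum (r : seq {perm 'I_n}) : continuous (fun e => \sum_(s <- r) (-1) ^+ s * \prod_i A e i (s i)).
  elim: r => [|s r IH]; first by under eq_fun do rewrite big_nil; exact: cst_continuous.
  under eq_fun do rewrite big_cons.
  move=> e; apply: cvgD; last exact: IH.
  by apply: cvgM; [exact: cvg_cst|exact: cprod].
exact: csum.
Qed.

Lemma continuous_det_bordered n (M : 'M[R]_n) g :
  continuous (fun e => \det (bordered (M + e%:M) g)).
Proof.
apply: continuous_det => i j.
case: (split_ordP i) => i' ->; case: (split_ordP j) => j' ->.
- under eq_fun do rewrite block_mxEul !mxE.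
  move=> e; apply: cvgD; first exact: cvg_cst.
  by case: (i' == j'); [exact: cvg_id|exact: cvg_cst].
- by under eq_fun do rewrite block_mxEur; exact: cst_continuous.
- by under eq_fun do rewrite block_mxEdl; exact: cst_continuous.
- by under eq_fun do rewrite block_mxEdr; exact: cst_continuous.
Qed.

Lemma enorm_mulmx_le n (M : 'M[R]_n) :
  exists2 C, 0 <= C & forall v, enorm (v *m M) <= C * enorm v.
Proof.
pose C := n%:R * \sum_i \sum_j `|M i j|; exists C.
  by rewrite mulr_ge0// sumr_ge0// => i _; rewrite sumr_ge0.
move=> v; rewrite /C -mulrA; apply: enorm_le_coord => j.
rewrite mxE (le_trans (ler_norm_sum _ _ _))// mulr_suml; apply: ler_sum => i _.
rewrite normrM mulrC; apply: ler_pM => //; last exact: coord_le_enorm.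
by rewrite (bigD1 j)//= lerDl sumr_ge0.
Qed.

(** A zero v of the form on the hyperplane orthogonal to [g] would be a minimum there, so v H would
    be orthogonal to that hyperplane, say v H = mu g; then (v, -mu) lies in the kernel of the
    bordered matrix. *)
Lemma quad_orth_gt0 n (H : 'M[R]_n) g : H^T = H -> g != 0 ->
  (forall v, dot g v = 0 -> 0 <= dot (v *m H) v) ->
  \det (bordered H g) != 0 ->
  forall v, v != 0 -> dot g v = 0 -> 0 < dot (v *m H) v.
Proof.
move=> symH g0 Hge0 detB v v0 gv; rewrite lt_def Hge0// andbT.
apply: contra_neq v0 => qv.
have gg : dot g g != 0 by rewrite dot_eq0.
have orth z : dot g z = 0 -> dot (v *m H) z = 0.
  move=> gz; have key (t : R) : 0 <= 2 * t * dot (v *m H) z + t ^+ 2 * dot (z *m H) z.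
    have := Hge0 (v + t *: z); rewrite dotDr dotZr gv gz mulr0 addr0 => /(_ erefl).
    rewrite mulmxDl -scalemxAl !dotDl !dotDr !dotZl !dotZr qv.
    rewrite (_ : dot (z *m H) v = dot (v *m H) z); last first.
      by rewrite dotC dot_mulmx symH.
    by rewrite dotC -/(dot _ _); move: (dot z _) (dot (z *m H) z) => a b; lra.
  have q0 := Hge0 z gz; move: key q0; move: (dot (v *m H) z) (dot (z *m H) z) => a b key b0.
  (* A nearly optimal t; [b + 1] instead of [b] avoids a division by zero. *)
  have := key (- a / (b + 1)); have b1 : 0 < b + 1 by lra.
  have -> : 2 * (- a / (b + 1)) * a + (- a / (b + 1)) ^+ 2 * b =
      - (a ^+ 2 * (b + 2)) / (b + 1) ^+ 2 by field; rewrite gt_eqF.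
  rewrite pmulr_lge0 ?invr_gt0 ?exprn_gt0// oppr_ge0 => h.
  apply/eqP; rewrite -sqrf_eq0 eq_le sqr_ge0 andbT.
  by rewrite -(pmulr_lle0 _ (_ : 0 < b + 2))//; lra.
pose mu := dot (v *m H) g / dot g g.
have vH : v *m H = mu *: g.
  apply/eqP; rewrite -subr_eq0 -dot_eq0; set z := _ - _.
  have gz : dot g z = 0 by rewrite /z dotBr dotZr (dotC g) /mu divfK// subrr.
  by rewrite {1}/z dotBl orth// dotZl gz mulr0 subrr.
have uB : bordered H g \in unitmx by rewrite unitmxE unitfE.
have : row_mx v (- mu)%:M *m bordered H g = 0.
  rewrite mul_row_block vH mul_scalar_mx scaleNr subrr mulmx0 addr0.
  rewrite [v *m g^T]mx11_scalar -dotE dotC gv.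
  by rewrite (_ : (0 : R)%:M = 0) ?row_mx0//; apply/matrixP => i j; rewrite !mxE mul0rn.
move/(congr1 (mulmx^~ (invmx (bordered H g)))); rewrite mulmxK// mul0mx.
by move/(congr1 lsubmx); rewrite row_mxKl => ->; apply/matrixP => i j; rewrite !mxE.
Qed.

(** Split v into a part orthogonal to [g], where compactness of the unit sphere gives a lower bound,
    and a multiple of [g]; a large lambda absorbs the cross term. *)
Lemma quad_shear_pos n (H : 'M[R]_n) g : H^T = H -> g != 0 ->
  (forall v, v != 0 -> dot g v = 0 -> 0 < dot (v *m H) v) ->
  exists lambda m, [/\ 0 <= lambda, 0 < m &
    forall v, m * enorm v ^+ 2 <= dot (v *m H) v + lambda * dot g v ^+ 2].
Proof.
move=> symH g0 Hgt0; have [C C0 HC] := enorm_mulmx_le H.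
have gg : 0 < dot g g by rewrite lt_def dot_ge0 dot_eq0 g0.
have [m0 m00 Hm0] : exists2 m0, 0 < m0 &
    forall v, dot g v = 0 -> m0 * enorm v ^+ 2 <= dot (v *m H) v.
  pose S0 : set 'rV[R]_n := [set v | enorm v = 1 /\ dot v g = 0].
  have normS0 v : v != 0 -> dot g v = 0 -> S0 ((enorm v)^-1 *: v).
    by move=> v0 gv; split; [exact: enorm_normalize|rewrite dotZl dotC gv mulr0].
  (* [S0] is empty only if the hyperplane is reduced to 0, where any constant is suitable. *)
  have [S00|S00] := pselect (S0 !=set0); last first.
    exists 1 => // v gv; have [->|v0] := eqVneq v 0.
      by rewrite mul0mx dot0l enorm0 expr0n /= mulr0.
    by case: S00; exists ((enorm v)^-1 *: v); exact: normS0.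
  have cS0 : compact S0.
    apply: bounded_closed_compact.
      by apply/bounded_enormP; exists 1 => v [-> _].
    apply: closedI.
      apply: (@closed_comp _ _ (@enorm R n) [set t | t = 1]); last exact: closed_eq.
      by move=> x _; exact: enorm_continuous.
    apply: (@closed_comp _ _ (fun v => dot v g) [set t | t = 0]); last exact: closed_eq.
    by move=> x _; exact: dot_continuous.
  have cq : continuous (fun v : 'rV[R]_n => dot (v *m H) v).
    move=> x A /nbhs_ballP[e /= e0 xA]; apply/nbhs_enormP.
    pose D := C * (2 * enorm x + 1) + 1.
    have D0 : 0 < D.
      by rewrite ltr_wpDl// mulr_ge0// addr_ge0// mulr_ge0// enorm_ge0.
    exists (Num.min 1 (e / D)); first by rewrite lt_min ltr01 divr_gt0.
    move=> y; rewrite lt_min => /andP[y1 ye]; apply: xA; rewrite /ball /=.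
    have -> : dot (x *m H) x - dot (y *m H) y = - dot ((y - x) *m H) (x + y).
      rewrite mulmxBl dotBl !dotDr.
      rewrite (_ : dot (x *m H) y = dot (y *m H) x); last by rewrite dotC dot_mulmx symH.
      by ring.
    rewrite normrN (le_lt_trans (normr_dot_le _ _))//.
    have h1 := HC (y - x).
    have h2 : enorm (x + y) <= 2 * enorm x + 1.
      have := ler_enormD (x + x) (y - x); rewrite addrACA subrr addr0.
      have := ler_enormD x x; clear -y1; lra.
    move: ye; rewrite ltr_pdivlMr// => ye; apply: le_lt_trans ye.
    apply: (@le_trans _ _ (C * enorm (y - x) * (2 * enorm x + 1))).
      by apply: ler_pM => //; exact: enorm_ge0.
    rewrite -mulrA [enorm _ * _]mulrC mulrA mulrC ler_wpM2l ?enorm_ge0//.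
    by rewrite /D lerDl.
  have [|c cS cmin] := @EVT_min_rV R n (fun v => dot (v *m H) v) S0 S00 cS0.
    exact: continuous_subspaceT.
  move: cS; rewrite inE => -[c1 gc].
  have c0 : c != 0 by rewrite -enorm_gt0 c1.
  exists (dot (c *m H) c); first by apply: Hgt0 => //; rewrite dotC.
  move=> v gv; have [->|v0] := eqVneq v 0.
    by rewrite mul0mx dot0l enorm0 expr0n /= mulr0.
  have := cmin ((enorm v)^-1 *: v); rewrite inE => /(_ (normS0 v v0 gv)).
  rewrite -scalemxAl dotZl dotZr mulrA -expr2 exprVn mulrC ler_pdivlMr//.
  by rewrite exprn_gt0// enorm_gt0.
(* The three summands pay, in this order, for the lower bound along [g], for the cross term (by a
   weighted square, which also uses half of [m0]) and for the form at [g]. *)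
pose L := m0 / 2 + 2 * C ^+ 2 / m0 + C.
have L0 : 0 <= L by rewrite !addr_ge0 ?mulr_ge0 ?invr_ge0 ?sqr_ge0 ?(ltW m00).
exists (L / dot g g), (m0 / 2); split; [by rewrite divr_ge0 ?(ltW gg)|by rewrite divr_gt0|].
move=> v; pose al := dot g v / dot g g; pose y := v - al *: g.
have gy : dot g y = 0 by rewrite /y dotBr dotZr /al divfK ?subrr ?gt_eqF.
have vE : v = y + al *: g by rewrite /y subrK.
clearbody y; clearbody al.
have [G GE] : exists G, enorm g = G by exists (enorm g).
have GG : dot g g = G ^+ 2 by rewrite -sqr_enorm GE.
have gv : dot g v = al * G ^+ 2 by rewrite vE dotDr dotZr gy add0r GG.
have vv : enorm v ^+ 2 = enorm y ^+ 2 + al ^+ 2 * G ^+ 2.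
  rewrite !sqr_enorm vE dotDl !dotDr !dotZl !dotZr (dotC y g) gy GG.
  by ring.
have qv : dot (v *m H) v = dot (y *m H) y + 2 * al * dot (g *m H) y +
    al ^+ 2 * dot (g *m H) g.
  rewrite vE mulmxDl -scalemxAl dotDl !dotDr !dotZl !dotZr.
  rewrite (_ : dot (y *m H) g = dot (g *m H) y); last by rewrite dotC dot_mulmx symH.
  by ring.
have hy := Hm0 y gy.
have G0 : 0 <= G by rewrite -GE enorm_ge0.
have hgy : `|dot (g *m H) y| <= C * G * enorm y.
  by rewrite (le_trans (normr_dot_le _ _))// ler_wpM2r ?enorm_ge0// -GE.
have hgg : `|dot (g *m H) g| <= C * G ^+ 2.
  by rewrite (le_trans (normr_dot_le _ _))// GE expr2 mulrA ler_wpM2r// -GE.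
have -> : L / dot g g * dot g v ^+ 2 = L * (al ^+ 2 * G ^+ 2).
  by rewrite gv GG; field; rewrite -GE enorm_eq0.
rewrite vv qv.
have cross : - (2 * C ^+ 2 / m0 * (al ^+ 2 * G ^+ 2) + m0 / 2 * enorm y ^+ 2) <=
    2 * al * dot (g *m H) y.
  have h2 : - (2 * (`|al| * G) * (C * enorm y)) <= 2 * al * dot (g *m H) y.
    rewrite lerNl -mulNr -mulrN (le_trans (ler_norm _))// !normrM normrN.
    rewrite ger0_norm// -!mulrA ler_pM2l// ler_wpM2l//.
    by rewrite (le_trans hgy)// mulrAC mulrC mulrA.
  apply: le_trans h2; rewrite lerN2.
  have := sqr_ge0 (2 * C * (`|al| * G) / m0 - enorm y).
  have -> : al ^+ 2 = `|al| ^+ 2 by rewrite real_normK ?num_real.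
  move: (enorm y) (`|al|) => Y A.
  have -> : (2 * C * (A * G) / m0 - Y) ^+ 2 = 2 / m0 *
     (2 * C ^+ 2 / m0 * (A ^+ 2 * G ^+ 2) + m0 / 2 * Y ^+ 2 - 2 * (A * G) * (C * Y)).
    by field; rewrite gt_eqF.
  by rewrite pmulr_rge0 ?divr_gt0// subr_ge0.
have hal : - (C * (al ^+ 2 * G ^+ 2)) <= al ^+ 2 * dot (g *m H) g.
  have : al ^+ 2 * - (C * G ^+ 2) <= al ^+ 2 * dot (g *m H) g.
    by rewrite ler_wpM2l ?sqr_ge0//; move: hgg; rewrite ler_norml => /andP[].
  by rewrite mulrN mulrCA.
move: cross hal hy; rewrite /L !(mulrDl _ _ (al ^+ 2 * G ^+ 2)).
move: (2 * C ^+ 2 / m0 * (al ^+ 2 * G ^+ 2)) (C * (al ^+ 2 * G ^+ 2))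
  (al ^+ 2 * G ^+ 2) (2 * al * _) (al ^+ 2 * dot _ _) (dot (y *m H) y)
  (enorm y ^+ 2) => k l s p q r t; clear; lra.
Qed.

End QuadraticForms.

(** * Ellipsoids touching the boundary *)

Section LocalGeometry.
Variables (R : realType) (n : nat) (K : set 'rV[R]_n).
Hypotheses (convK : Defs.convex_set K) (compK : compact K).

Lemma closedK : closed K.
Proof. exact: compact_closed (@norm_hausdorff _ _) compK. Qed.

Lemma bd_sub x : bd K x -> K x.
Proof. by move=> [+ _]; rewrite -(iffLR (closure_id _) closedK). Qed.

Lemma convex_segment x v t : K x -> K (x + v) -> 0 <= t <= 1 -> K (t *: v + x).
Proof.
move=> Kx Kxv t01; have := convK Kxv Kx t01.
by rewrite (_ : _ + _ = t *: v + x)//; apply/rowP => i; rewrite !mxE; ring.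
Qed.

Section AtBoundaryPoint.
Variables (x : 'rV[R]_n) (U : set 'rV[R]_n) (F : 'rV[R]_n -> R).
Hypotheses (bdx : bd K x) (locF : local_def K x U F).

Let g := grad F x.
Let H := hess F x.
Let u := (enorm g)^-1 *: g.

Let oU : open U. Proof. by case: locF. Qed.
Let Ux : U x. Proof. by case: locF => _ []. Qed.
Let C2 : C2_on U F. Proof. by case: locF => _ [_ []]. Qed.
Let FK y : U y -> K y <-> F y <= 0.
Proof. by case: locF => _ [_ [_ [_ h]]] /h. Qed.

Lemma grad_neq0 : g != 0.
Proof. by case: locF => _ [_ [_ [h _]]]; exact: h. Qed.

Let nearU : \forall y \near x, U y. Proof. exact: open_nbhs_nbhs. Qed.

(** A negative value would persist nearby and put [x] in the interior. *)
Lemma local_def0 : F x = 0.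
Proof.
have Fx0 : F x <= 0 by apply/(FK Ux)/bd_sub.
apply/eqP; rewrite eq_le Fx0 leNgt; apply/negP => Fx.
case: bdx => _; apply; have [cF _] := C2 Ux.
have Fneg : \forall y \near x, F y < 0 by exact: (cvgr_lt _ cF).
by rewrite /interior /=; near=> y; apply/FK; [near: y|apply: ltW; near: y].
Unshelve. all: by end_near.
Qed.

(** By convexity the segment from [x] to [y] stays in K, so F <= 0 along it while F x = 0: the
    derivative at [x] towards [y] cannot be positive. *)
Lemma grad_support y : K y -> dot g (y - x) <= 0.
Proof.
move=> Ky; rewrite leNgt; apply/negP => d0; set d := dot g (y - x) in d0.
have dF : is_derive x (y - x) F d by exact: (C2_is_derive oU C2).
have d20 : 0 < d / 2 by rewrite divr_gt0.
have [r r0 hr] := (iffLR (is_derive_epsP _ _ _ _) dF) _ d20.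
have [e e0 he] := iffLR (nbhs_enormP _ _) nearU.
pose N := enorm (y - x) + 1; have N0 : 0 < N by rewrite ltr_wpDl// enorm_ge0.
pose t := Num.min (r / 2) (Num.min 1 (e / N)).
have t0 : 0 < t by rewrite !lt_min !divr_gt0//= ltr01.
have tr : `|t| < r.
  by rewrite gtr0_norm// gt_min; apply/orP; left; lra.
have t1 : t <= 1 by rewrite !ge_min lexx orbT.
have te : t * N <= e by rewrite -ler_pdivlMr// !ge_min lexx !orbT.
have Kt : K (t *: (y - x) + x).
  by apply: convex_segment; [exact: bd_sub|rewrite addrC subrK|by rewrite (ltW t0)].
have Ut : U (t *: (y - x) + x).
  apply: he; rewrite addrK enormZ gtr0_norm// (lt_le_trans _ te)//.
  by rewrite ltr_pM2l// ltrDl.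
have := hr t (lt0r_neq0 t0) tr.
rewrite local_def0 subr0 ltr_norml => /andP[_].
have : t^-1 * F (t *: (y - x) + x) <= 0.
  by rewrite pmulr_rle0 ?invr_gt0//; exact/(FK Ut).
by move: (t^-1 * _) => a; lra.
Qed.

Let gp : 0 < enorm g. Proof. by rewrite enorm_gt0 grad_neq0. Qed.

Lemma supp_funE : supp_fun K u = dot x u.
Proof.
have ub y : K y -> dot u y <= dot x u.
  move=> /grad_support; rewrite dotBr subr_le0 (dotC x) => h.
  by rewrite /u !dotZl ler_pM2l ?invr_gt0.
apply/eqP; rewrite eq_le; apply/andP; split.
  apply: sup_le_ub; first by exists (dot u x), x => //; exact: bd_sub.
  by move=> _ [y Ky <-]; exact: ub.
apply: ub_le_sup; last by exists x; [exact: bd_sub|rewrite dotC].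
by exists (dot x u) => _ [y Ky <-]; exact: ub.
Qed.

Let taylor eps (eps0 : 0 < eps) := C2_taylor oU C2 Ux eps0.

Let taylorU eps : 0 < eps -> exists r, [/\ 0 < r, forall v, enorm v < r ->
    `|F (v + x) - dot g v - dot (v *m H) v / 2| <= eps * enorm v ^+ 2 &
    forall v, enorm v < r -> U (v + x)].
Proof.
move=> /taylor[r r0 hr]; have [e e0 he] := iffLR (nbhs_enormP _ _) nearU.
exists (Num.min r e); split; first by rewrite lt_min r0.
  by move=> v; rewrite lt_min => /andP[/hr + _]; rewrite local_def0 subr0.
by move=> v; rewrite lt_min => /andP[_ ve]; apply: he; rewrite addrK.
Qed.

(** Otherwise F would be negative at s v + x for a small s, hence also slightly further out along
    [g]: a point of K beyond the tangent hyperplane, against [grad_support]. *)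
Lemma hess_orth_ge0 v : dot g v = 0 -> 0 <= dot (v *m H) v.
Proof.
move=> gv; rewrite leNgt; apply/negP => q0.
set q := dot (v *m H) v in q0.
have N0 : 0 < enorm v ^+ 2 + 1 by rewrite ltr_wpDl// sqr_ge0.
pose eps := - q / 4 / (enorm v ^+ 2 + 1).
have eps0 : 0 < eps by rewrite !divr_gt0// oppr_gt0.
have [r r0 hr] := taylor eps0.
have [e e0 he] := iffLR (nbhs_enormP _ _) nearU.
pose s := Num.min r e / 2 / (enorm v + 1).
have v10 : 0 < enorm v + 1 by rewrite ltr_wpDl// enorm_ge0.
have re0 : 0 < Num.min r e by rewrite lt_min r0.
have s0 : 0 < s by rewrite !divr_gt0.
have sv : enorm (s *: v) < Num.min r e.
  rewrite enormZ gtr0_norm// /s mulrAC ltr_pdivrMr//.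
  rewrite mulrDr mulr1; have : Num.min r e / 2 * enorm v <= Num.min r e * enorm v.
    by rewrite ler_wpM2r ?enorm_ge0//; lra.
  by lra.
have svr : enorm (s *: v) < r by move: sv; rewrite lt_min => /andP[].
have Uv : U (s *: v + x).
  by apply: he; rewrite addrK; move: sv; rewrite lt_min => /andP[].
have Fneg : F (s *: v + x) < 0.
  have e1 : enorm (s *: v) ^+ 2 = s ^+ 2 * enorm v ^+ 2.
    by rewrite enormZ exprMn real_normK ?num_real.
  have e2 : dot (s *: v *m H) (s *: v) = s ^+ 2 * q.
    by rewrite -scalemxAl dotZl dotZr mulrA expr2.
  have := hr _ svr; rewrite local_def0 subr0 -/g dotZr gv mulr0 subr0 -/H e1 e2.
  rewrite ler_norml => /andP[_ h].
  have : eps * (s ^+ 2 * enorm v ^+ 2) <= s ^+ 2 * (- q / 4).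
    rewrite mulrCA ler_pM2l ?exprn_gt0// /eps mulrAC ler_pdivrMr//.
    by rewrite ler_wpM2l// ?lerDl//; lra.
  have : s ^+ 2 * q < 0 by rewrite pmulr_rlt0// exprn_gt0.
  move: h; move: (F _) (eps * _) => a b; lra.
have [cF _] := C2 Uv.
have nearF : \forall y \near s *: v + x, F y < 0 by exact: (cvgr_lt _ cF).
have nearU' : \forall y \near s *: v + x, U y by exact: open_nbhs_nbhs.
have [e' e'0 he'] := iffLR (nbhs_enormP _ _) (filterI nearF nearU').
pose w := (e' / 2 / enorm g) *: g.
have we : enorm w < e'.
  by rewrite /w enormZ gtr0_norm ?divr_gt0// divfK ?gt_eqF//; lra.
have [Fw Uw] := he' (w + (s *: v + x)) ltac:(by rewrite addrK).
have := grad_support (iffRL (FK Uw) (ltW Fw)).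
rewrite addrA addrK dotDr !dotZr gv mulr0 addr0 leNgt pmulr_rgt0 ?divr_gt0//.
by rewrite lt_def dot_eq0 grad_neq0 dot_ge0.
Qed.

Hypothesis curv_pos : 0 < gauss_curv F x.

Let symH : H^T = H. Proof. exact: (hess_sym oU C2 Ux). Qed.

Lemma gauss_curvE : gauss_curv F x = - \det (bordered H g) / enorm g ^+ n.+1.
Proof. by []. Qed.

Lemma hess_shear : exists lambda m, [/\ 0 <= lambda, 0 < m &
    forall v, m * enorm v ^+ 2 <= dot (v *m H) v + lambda * dot g v ^+ 2].
Proof.
apply: quad_shear_pos => //; first exact: grad_neq0.
apply: quad_orth_gt0 => //; [exact: grad_neq0|exact: hess_orth_ge0|].
apply/eqP => h; move: curv_pos; rewrite gauss_curvE h oppr0 mul0r ltxx //.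
Qed.

Let quadD (A : 'M[R]_n) e lambda v :
  dot (v *m (A + e%:M + lambda *: (g^T *m g))) v =
  dot (v *m A) v + e * enorm v ^+ 2 + lambda * dot g v ^+ 2.
Proof.
rewrite !mulmxDr !dotDl mul_mx_scalar dotZl sqr_enorm; congr (_ + _).
rewrite -scalemxAr dotZl mulmxA [v *m g^T]mx11_scalar -dotE mul_scalar_mx dotZl.
by rewrite (dotC v g) expr2.
Qed.

Let symM (e lambda : R) :
  (H + e%:M + lambda *: (g^T *m g))^T = H + e%:M + lambda *: (g^T *m g).
Proof.
by rewrite !linearD /= symH tr_scalar_mx linearZ /= trmx_mul trmxK.
Qed.

(* The ellipsoid is [ellipsoid M g] with
   [M = hess F x + eps%:M + lambda *: (g^T *m g)]: a large [lambda] makes it small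
   enough for Taylor's formula, without changing its curvature at [x]. *)
Lemma inner_ellipsoid k1 : gauss_curv F x < k1 ->
  exists c T, [/\ T \in unitmx, (forall z, enorm z <= 1 -> K (c + z *m T)),
    dot c u + enorm (u *m T^T) = dot x u &
    enorm (u *m T^T) ^+ n.+1 / (\det T) ^+ 2 <= k1].
Proof.
move=> kk1; have [l0 [m [l00 m0 Hm]]] := hess_shear.
have gn0 : 0 < enorm g ^+ n.+1 by rewrite exprn_gt0.
have [eps eps0 heps] : exists2 eps, 0 < eps &
    - \det (bordered (H + eps%:M) g) / enorm g ^+ n.+1 <= k1.
  have cvgb : - \det (bordered (H + e%:M) g) / enorm g ^+ n.+1 @[e --> 0^'+] -->
      - \det (bordered (H + 0%:M) g) / enorm g ^+ n.+1.
    apply: cvg_at_right_filter; apply: cvgM; last exact: cvg_cst.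
    by apply: cvgN; exact: continuous_det_bordered.
  have H0 : H + 0%:M = H by rewrite (_ : 0%:M = 0) ?addr0//; apply/matrixP => i j; rewrite !mxE mul0rn.
  have : \forall e \near 0^'+, - \det (bordered (H + e%:M) g) / enorm g ^+ n.+1 < k1.
    by apply: (cvgr_lt _ cvgb); rewrite H0.
  move=> near1; near (0 : R)^'+ => eps; exists eps; first by near: eps; exact: nbhs_right_gt.
  by apply: ltW; near: eps.
(* With [eps / 2] as precision, Taylor's error is what [eps%:M] contributes to half of the quadratic
   form. *)
have [r [r0 hr Ur]] := taylorU (divr_gt0 eps0 (ltr0Sn R 1)).
(* On the ellipsoid, w = <g, y> satisfies l1 w^2 + m |y|^2 <= -2 w. Hence -w <= 2 / l1 and m |y|^2
   <= 4 / l1 = m r^2 / 2, which keeps the ellipsoid in the ball of radius [r]. *)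
pose l1 := 8 / (m * r ^+ 2).
have mr0 : 0 < m * r ^+ 2 by rewrite mulr_gt0// exprn_gt0.
have l10 : 0 < l1 by rewrite divr_gt0.
pose l := l0 + l1; pose M := H + eps%:M + l *: (g^T *m g).
have qM v : m * enorm v ^+ 2 + l1 * dot g v ^+ 2 + eps * enorm v ^+ 2 <= dot (v *m M) v.
  have := Hm v; rewrite /M quadD /l mulrDl; move: (dot _ _) (l0 * _) (l1 * _) => a b c.
  by lra.
have pdM v : v != 0 -> 0 < dot (v *m M) v.
  move=> v0; apply: lt_le_trans (qM v).
  apply: ltr_wpDr; first by rewrite mulr_ge0 ?sqr_ge0 ?(ltW eps0).
  apply: ltr_wpDr; first by rewrite mulr_ge0 ?sqr_ge0 ?(ltW l10).
  by rewrite mulr_gt0// exprn_gt0// enorm_gt0.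
have [c [T [uT ET hT kT]]] := ellipsoidP grad_neq0 (symM eps l) pdM.
exists (x + c), T; split => //; last first.
- rewrite /u kT det_bordered_shear; exact: heps.
- by rewrite dotDl -addrA hT addr0.
move=> z z1; set y := c + z *m T.
have yE : dot g y + dot (y *m M) y / 2 <= 0.
  suff : ellipsoid M g y by [].
  by rewrite ET; exists z.
have yr : enorm y < r.
  rewrite -(@ltr_pXn2r _ 2%N) ?nnegrE ?enorm_ge0 ?(ltW r0)//.
  have := qM y; move: yE; move: (dot (y *m M) y) (dot g y) => Q w.
  move: (sqr_ge0 (enorm y)); move: (enorm y ^+ 2) => Y Y0 h1 h2.
  have wle : l1 * w ^+ 2 + m * Y <= - (2 * w).
    have : 0 <= eps * Y by rewrite mulr_ge0// ltW.
    by move: h1 h2; lra.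
  have mY : 0 <= m * Y by rewrite mulr_ge0// ltW.
  have l1w : l1 * w ^+ 2 <= - (2 * w) by move: wle mY; lra.
  have w2 : - w <= 2 / l1.
    rewrite ler_pdivlMr//; have [w0|w0] := leP 0 w.
      have : 0 <= w * l1 by rewrite mulr_ge0// ltW.
      by lra.
    rewrite -(@ler_nM2l _ w)//; move: l1w; rewrite expr2; lra.
  have : m * Y <= 4 / l1.
    move: wle w2; have : 0 <= l1 * w ^+ 2 by rewrite mulr_ge0 ?sqr_ge0 ?ltW.
    have -> : 4 / l1 = 2 * (2 / l1) by field; rewrite gt_eqF.
    by move: (2 / l1) (l1 * _) => a b; lra.
  have -> : 4 / l1 = m * (r ^+ 2 / 2).
    by rewrite /l1; field; rewrite !gt_eqF// exprn_gt0.
  rewrite ler_pM2l// => hY; apply: le_lt_trans hY _.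
  have : 0 < r ^+ 2 by rewrite exprn_gt0.
  by lra.
rewrite -addrA [x + _]addrC -/y; apply/(FK (Ur _ yr)).
have := hr _ yr; rewrite ler_norml => /andP[_].
move: yE; rewrite /M quadD.
have : 0 <= l * dot g y ^+ 2 by rewrite mulr_ge0 ?sqr_ge0// addr_ge0// ltW.
move: (F _) (dot g y) (dot _ _) (l * _) (enorm y ^+ 2) => a b p q t; lra.
Unshelve. all: by end_near.
Qed.

(* Here [M = hess F x - eps%:M + lambda *: (g^T *m g)] and the linear part is
   [(1 + eps) *: g]: in a thin slice the excess [eps * dot g v] absorbs the
   term [lambda * dot g v ^+ 2]. *)
Lemma outer_ellipsoid k1 : k1 < gauss_curv F x ->
  exists c T tau, [/\ T \in unitmx, 0 < tau,
    (forall y, K y -> dot x u - tau <= dot y u ->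
       exists2 z, enorm z <= 1 & y = c + z *m T),
    dot c u + enorm (u *m T^T) = dot x u &
    k1 <= enorm (u *m T^T) ^+ n.+1 / (\det T) ^+ 2].
Proof.
move=> kk1; have [l [m [l0 m0 Hm]]] := hess_shear.
have [eps [eps0 epsm heps]] : exists eps, [/\ 0 < eps, eps <= m / 2 &
    k1 <= - ((1 + eps) ^+ 2 * \det (bordered (H + (- eps)%:M) g)) /
          ((1 + eps) * enorm g) ^+ n.+1].
  have cvgb : - ((1 + e) ^+ 2 * \det (bordered (H + (- e)%:M) g)) /
          ((1 + e) * enorm g) ^+ n.+1 @[e --> 0^'+] -->
      - ((1 + 0) ^+ 2 * \det (bordered (H + (- 0)%:M) g)) / ((1 + 0) * enorm g) ^+ n.+1.
    have c1 : continuous (fun e : R => 1 + e).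
      by move=> e; apply: cvgD; [exact: cvg_cst|exact: cvg_id].
    apply: cvg_at_right_filter; apply: cvgM.
      apply: cvgN; apply: cvgM.
        exact: (@continuous_comp _ _ _ (fun e : R => 1 + e) (fun t => t ^+ 2) 0
          (c1 0) (@exprn_continuous _ _ _)).
      apply: (@continuous_comp _ _ _ (fun e : R => - e)
        (fun e => \det (bordered (H + e%:M) g)) 0); first exact: opp_continuous.
      exact: continuous_det_bordered.
    apply: cvgV; first by rewrite expf_neq0// addr0 mul1r gt_eqF.
    apply: (@continuous_comp _ _ _ (fun e : R => (1 + e) * enorm g) (fun t => t ^+ n.+1) 0).
      by apply: cvgM; [exact: c1|exact: cvg_cst].
    exact: exprn_continuous.
  have H0 : H + (- 0)%:M = H.
    by rewrite oppr0 (_ : 0%:M = 0) ?addr0//; apply/matrixP => i j; rewrite !mxE mul0rn.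
  have near1 : \forall e \near 0^'+,
      k1 < - ((1 + e) ^+ 2 * \det (bordered (H + (- e)%:M) g)) /
          ((1 + e) * enorm g) ^+ n.+1.
    by apply: (cvgr_gt _ cvgb); rewrite H0 addr0 expr1n !mul1r.
  near (0 : R)^'+ => eps; exists eps; split.
  - by near: eps; exact: nbhs_right_gt.
  - by near: eps; apply: nbhs_right_le; rewrite divr_gt0.
  - by apply: ltW; near: eps.
have [r [r0 hr Ur]] := taylorU (divr_gt0 eps0 (ltr0Sn R 1)).
pose g' := (1 + eps) *: g; have eps1 : 0 < 1 + eps by rewrite addr_gt0.
have g'n : enorm g' = (1 + eps) * enorm g by rewrite enormZ gtr0_norm.
have g'0 : g' != 0 by rewrite -enorm_gt0 g'n mulr_gt0.
have uE : (enorm g')^-1 *: g' = u.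
  rewrite g'n /g' scalerA invfM mulrAC mulVf ?gt_eqF// mul1r //.
pose M := H + (- eps)%:M + l *: (g^T *m g).
have qM v : m / 2 * enorm v ^+ 2 <= dot (v *m M) v.
  have := Hm v; rewrite /M quadD.
  have : eps * enorm v ^+ 2 <= m / 2 * enorm v ^+ 2 by rewrite ler_wpM2r ?sqr_ge0.
  by move: (dot _ _) (l * _) (enorm v ^+ 2) => a b t; lra.
have pdM v : v != 0 -> 0 < dot (v *m M) v.
  move=> v0; apply: lt_le_trans (qM v).
  by rewrite mulr_gt0 ?divr_gt0// exprn_gt0// enorm_gt0.
have [c [T [uT ET hT kT]]] := ellipsoidP g'0 (symM (- eps) l) pdM.
rewrite uE in hT kT.
(* Bound on the thickness of the slice. The first term confines the slice of K to the ball of radius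
   [r]; the second gives [l * om <= 1] for that argument and [l * om <= eps] for the absorption. *)
pose om := Num.min (m * r ^+ 2 / 64) (Num.min 1 eps / (l + 1)).
have l10 : 0 < l + 1 by rewrite ltr_wpDl.
have mr0 : 0 < m * r ^+ 2 by rewrite mulr_gt0// exprn_gt0.
have eps10 : 0 < Num.min 1 eps by rewrite lt_min ltr01.
have om0 : 0 < om by rewrite lt_min !divr_gt0.
have om1 : om <= m * r ^+ 2 / 64 by rewrite ge_min lexx.
have om2 : l * om <= Num.min 1 eps.
  apply: (@le_trans _ _ ((l + 1) * om)); first by rewrite ler_wpM2r ?(ltW om0)// lerDl.
  by rewrite mulrC -ler_pdivlMr// ge_min lexx orbT.
have om3 : l * om <= 1 by apply: le_trans om2 _; rewrite ge_min lexx.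
have om4 : l * om <= eps by apply: le_trans om2 _; rewrite ge_min lexx orbT.
have K_F v : enorm v < r -> K (v + x) ->
    dot g v + (dot (v *m H) v - eps * enorm v ^+ 2) / 2 <= 0.
  move=> vr /(FK (Ur _ vr)); have := hr _ vr; rewrite ler_norml => /andP[+ _].
  move: (F _) (dot g v) (dot _ _) (enorm v ^+ 2) => a b p t; lra.
have K_w v : enorm v < r -> K (v + x) ->
    m / 4 * enorm v ^+ 2 <= - dot g v + l / 2 * dot g v ^+ 2.
  move=> vr /(K_F _ vr); have := Hm v.
  have : eps * enorm v ^+ 2 <= m / 2 * enorm v ^+ 2 by rewrite ler_wpM2r ?sqr_ge0.
  have -> : l / 2 * dot g v ^+ 2 = l * dot g v ^+ 2 / 2 by ring.
  move: (dot g v) (l * _) (dot _ _) (enorm v ^+ 2) => a b p t; lra.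
exists (x + c), T, (om / enorm g); split => //.
- by rewrite divr_gt0.
- move=> y Ky hy; pose v := y - x; pose w := - dot g v.
  have w0 : 0 <= w by rewrite oppr_ge0; exact: grad_support.
  have wom : w <= om.
    have vu : dot v u = - (w / enorm g) by rewrite /w mulNr opprK dotC /u dotZl mulrC.
    have : - (om / enorm g) <= dot v u by rewrite /v dotBl; lra.
    by rewrite vu lerN2 ler_pM2r ?invr_gt0.
  have Kv : K (x + v) by rewrite /v addrC subrK.
  have gv : dot g v = - w by rewrite /w opprK.
  have vr : enorm v < r.
    (* By convexity a far point of the slice could be pulled back to distance [r / 2] from [x],
       still within depth [om]; there [K_w] forces a depth larger than that. *)
    rewrite ltNge; apply/negP => rv.
    have v0 : 0 < enorm v by exact: lt_le_trans rv.
    pose t := r / 2 / enorm v; have t0 : 0 < t by rewrite !divr_gt0.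
    have t1 : t <= 1 by rewrite ler_pdivrMr// mul1r (le_trans _ rv)// ler_pdivrMr//; lra.
    have tv : enorm (t *: v) = r / 2 by rewrite enormZ gtr0_norm// divfK ?gt_eqF.
    have Ktv : K (t *: v + x).
      by apply: convex_segment => //; [exact: bd_sub|rewrite (ltW t0)].
    have t2 : t <= 1 / 2 by rewrite ler_pdivrMr// mulrAC mul1r ler_pM2r ?invr_gt0.
    have := K_w (t *: v); rewrite tv => /(_ _ Ktv).
    have -> : - dot g (t *: v) = t * w by rewrite dotZr gv mulrN opprK.
    have -> : dot g (t *: v) ^+ 2 = (t * w) ^+ 2 by rewrite dotZr gv mulrN sqrrN.
    have tw0 : 0 <= t * w by rewrite mulr_ge0 ?(ltW t0).
    have twom : t * w <= om.
      by apply: le_trans wom; rewrite ler_piMl.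
    have : l / 2 * (t * w) ^+ 2 <= 1 / 2 * om.
      have : l * (t * w) <= 1.
        by apply: le_trans om3; rewrite ler_wpM2l.
      move=> h; have : l * (t * w) * (t * w) <= 1 * om by apply: ler_pM => //; rewrite mulr_ge0.
      by rewrite expr2; move: (t * w) => a; lra.
    have r20 : r / 2 < r by rewrite ltr_pdivrMr//; lra.
    have -> : m / 4 * (r / 2) ^+ 2 = m * r ^+ 2 / 16 by field.
    by move=> h1 h2; have := h2 r20; lra.
  have vE : ellipsoid M g' v.
    have Kv' : K (v + x) by rewrite addrC.
    have := K_F v vr Kv'; rewrite /ellipsoid /= /M quadD /g' dotZl.
    rewrite gv sqrrN.
    have : l * w ^+ 2 <= eps * w.
      rewrite expr2 mulrA ler_wpM2r//; apply: le_trans om4; rewrite ler_wpM2l//.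
    have ew : 0 <= eps * w by rewrite mulr_ge0 ?(ltW eps0).
    by move=> h1 h2; lra.
  move: vE; rewrite ET => -[z z1 zv]; exists z => //.
  by rewrite -addrA zv /v addrC subrK.
- by rewrite dotDl -addrA hT addr0.
- rewrite kT /M g'n /g' det_borderedZ det_bordered_shear.
  by have := heps.
Unshelve. all: by end_near.
Qed.
End AtBoundaryPoint.
End LocalGeometry.

(** * Outer normals, supporting points and a ball rolling inside K *)

Section Normals.
Variables (R : realType) (n : nat) (K : set 'rV[R]_n).
Hypotheses (convK : Defs.convex_set K) (compK : compact K).

(** For unit vectors u and e = g / |g| that differ, v = u - e has <g, v> < 0 < <u, v>: a short step
    along v stays in K but crosses the hyperplane supporting K with normal u. *)
Lemma normal_unique x U F u : bd K x -> local_def K x U F -> enorm u = 1 ->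
  (forall y, K y -> dot (y - x) u <= 0) -> (enorm (grad F x))^-1 *: grad F x = u.
Proof.
move=> bdx locF u1 hu; set g := grad F x.
have [oU [Ux [C2 [/(_ x Ux) g0 FK]]]] := locF.
have gp : 0 < enorm g by rewrite enorm_gt0.
pose e := (enorm g)^-1 *: g; have e1 : enorm e = 1 by exact: enorm_normalize.
have gE : g = enorm g *: e by rewrite /e scalerA mulfV ?gt_eqF// scale1r.
pose v := u - e; have uu : dot u u = 1 by rewrite -sqr_enorm u1 expr1n.
have ee : dot e e = 1 by rewrite -sqr_enorm e1 expr1n.
have vv : dot v v = 2 * (1 - dot u e).
  by rewrite /v dotBl !dotBr uu ee (dotC e u); ring.
suff : dot v v <= 0.
  move=> h; have : dot v v == 0 by rewrite eq_le h dot_ge0.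
  by rewrite dot_eq0 subr_eq0 => /eqP.
rewrite leNgt; apply/negP => vv0.
have d0 : dot g v < 0.
  by rewrite gE dotZl /v dotBr ee (dotC e u) pmulr_rlt0//; lra.
have dF : is_derive x v F (dot g v) by exact: (C2_is_derive oU C2).
have nd0 : 0 < - dot g v by rewrite oppr_gt0.
have [r r0 hr] := (iffLR (is_derive_epsP _ _ _ _) dF) _ nd0.
have [r' r'0 hr'] := iffLR (nbhs_enormP _ _) (open_nbhs_nbhs (conj oU Ux)).
pose N := enorm v + 1; have N0 : 0 < N by rewrite ltr_wpDl// enorm_ge0.
pose t := Num.min (r / 2) (r' / N).
have t0 : 0 < t by rewrite lt_min !divr_gt0.
have tr : `|t| < r by rewrite gtr0_norm// gt_min; apply/orP; left; lra.
have tN : t * N <= r' by rewrite -ler_pdivlMr// ge_min lexx orbT.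
have Ut : U (t *: v + x).
  apply: hr'; rewrite addrK enormZ gtr0_norm// (lt_le_trans _ tN)//.
  by rewrite ltr_pM2l// ltrDl.
have Fx := local_def0 compK bdx locF.
have := hr t (lt0r_neq0 t0) tr; rewrite Fx subr0 ltr_norml => /andP[h _].
have Kt : K (t *: v + x).
  apply/(FK _ Ut); rewrite -(pmulr_rle0 _ (_ : 0 < t^-1)) ?invr_gt0//.
  by move: h; move: (t^-1 * _) => a; lra.
have := hu _ Kt; rewrite addrK dotZl pmulr_rle0// /v dotBl uu (dotC e u) => h2.
by move: vv0; rewrite vv; lra.
Qed.

Lemma supp_point u : K !=set0 -> enorm u = 1 ->
  exists x, bd K x /\ forall y, K y -> dot (y - x) u <= 0.
Proof.
move=> K0 u1.
have [|x xK hx] := @EVT_max_rV R n (fun x => dot x u) K K0 compK.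
  by apply: continuous_subspaceT => y; exact: dot_continuous.
have hxK y : K y -> dot (y - x) u <= 0.
  by move=> Ky; rewrite dotBl subr_le0; apply: hx; rewrite inE.
exists x; split => //; split; first by apply: subset_closure; rewrite inE in xK.
move=> /nbhs_enormP[e e0 he].
have /hxK : K (x + (e / 2) *: u).
  by apply: he; rewrite addrC addKr enormZ u1 mulr1 gtr0_norm ?divr_gt0//; lra.
rewrite addrC addKr dotZl -sqr_enorm u1 expr1n mulr1; lra.
Qed.

Hypothesis C2K : C2_boundary K.

Lemma curv_at_normal_exists u : K !=set0 -> enorm u = 1 ->
  exists kappa, curv_at_normal K u kappa.
Proof.
move=> K0 u1; have [x [bdx hx]] := supp_point K0 u1.
have [U [F locF]] := C2K bdx.
exists (gauss_curv F x), x, U, F; do 3!split => //.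
exact: (normal_unique bdx locF).
Qed.

Lemma compact_bd : compact (bd K).
Proof.
apply: (subclosed_compact _ compK); last by move=> x; exact: bd_sub.
rewrite /bd setDE; apply: closedI; first exact: closed_closure.
by rewrite closedC; exact: open_interior.
Qed.

(** Numerical part of [uniform_ball], with p = <z, u> and q = |v|^2: the linear term gains gy rho (1
    - p), the quadratic one costs at most 2 M rho^2 (1 - p). *)
Lemma tangent_ball_estimate (M rho gx gy p q : R) : 0 < M -> 0 < rho ->
  rho < gx / (4 * M) -> gx / 2 < gy -> p <= 1 ->
  q <= rho * rho * (2 * (1 - p)) -> gy * (rho * (p - 1)) + M * q <= 0.
Proof.
move=> M0 rho0; rewrite ltr_pdivlMr ?mulr_gt0// => h1 h2 p1 hq.
have key : M * rho * 2 <= gy by lra.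
have : M * q <= M * (rho * rho * (2 * (1 - p))) by rewrite ler_wpM2l// ltW.
have : rho * (1 - p) * (M * rho * 2) <= rho * (1 - p) * gy.
  by rewrite ler_wpM2l// mulr_ge0 ?(ltW rho0)// subr_ge0.
by lra.
Qed.

Lemma uniform_ball : K !=set0 -> exists2 rho, 0 < rho & forall u, enorm u = 1 ->
  exists2 c, (forall z, enorm z <= 1 -> K (c + rho *: z)) &
    dot c u + rho = supp_fun K u.
Proof.
move=> K0; have aux (e p : R) : e <= 1 -> e - p - (p - 1) <= 2 * (1 - p) by lra.
pose P (rho : R) (x : 'rV[R]_n) := forall u z, bd K x -> enorm u = 1 ->
  (forall y, K y -> dot (y - x) u <= 0) -> enorm z <= 1 -> K (x - rho *: u + rho *: z).
(* Compactness in its near-covering form: an estimate valid jointly for boundary points near [x] and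
   radii near 0 yields a radius common to the whole boundary. *)
have : \forall rho \near 0^'+, bd K `<=` P rho.
  apply: (iffLR (@compact_near_coveringP _ (bd K)) compact_bd).
  move=> x bdx; have [U [F locF]] := C2K bdx.
  have [oU [Ux [C2 [gU FK]]]] := locF.
  have [M [r [M0 r0 hr]]] := C2_quad_upper oU C2 Ux.
  have gx0 : 0 < enorm (grad F x) by rewrite enorm_gt0; exact: gU.
  have cgrad : \forall y \near x, enorm (grad F x) / 2 < enorm (grad F y).
    pose eta := enorm (grad F x) / 3 / n.+1%:R.
    have eta0 : 0 < eta by rewrite !divr_gt0.
    have near_i i : \forall y \near x, `|partial i F x - partial i F y| < eta.
      have [_ /(_ i i)[_ [+ _]]] := C2 _ Ux.
      by move: (partial i F) => f /cvgrPdist_lt/(_ _ eta0).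
    apply: filterS (filter_forall _ near_i) => y hy.
    have : enorm (grad F x - grad F y) <= n%:R * eta.
      by apply: enorm_le_coord => i; rewrite !mxE; exact/ltW.
    have : n%:R * eta <= enorm (grad F x) / 3.
      rewrite /eta mulrCA ler_piMr ?divr_ge0 ?(ltW gx0)//.
      by rewrite ler_pdivrMr// mul1r ler_nat.
    have := ler_enormD (grad F x - grad F y) (grad F y); rewrite subrK.
    move: (enorm (_ - _)) (n%:R * eta) (enorm (grad F y)) (enorm (grad F x)) gx0 => a b c d; lra.
  pose s := r / 3; have s0 : 0 < s by rewrite divr_gt0.
  have nearx : \forall y \near x, enorm (y - x) < s by apply/nbhs_enormP; exists s.
  have M40 : 0 < enorm (grad F x) / (4 * M) by rewrite divr_gt0// mulr_gt0.
  near=> y rho => u z bdy u1 hu z1.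
  have ys : enorm (y - x) < s by near: y.
  have gy : enorm (grad F x) / 2 < enorm (grad F y) by near: y.
  have rho0 : 0 < rho by near: rho; exact: nbhs_right_gt.
  have rhos : rho < s by near: rho; exact: nbhs_right_lt.
  have rhoM : rho < enorm (grad F x) / (4 * M) by near: rho; exact: nbhs_right_lt.
  have sr : s < r by rewrite ltr_pdivrMr// ltr_pMr// ltr1n.
  have [Uy _] := hr y y (lt_trans ys sr) (lt_trans ys sr).
  have locFy : local_def K y U F by [].
  have uE := normal_unique bdy locFy u1 hu.
  have Fy := local_def0 compK bdy locFy.
  pose v := rho *: (z - u).
  have -> : y - rho *: u + rho *: z = y + v by rewrite /v scalerBr addrAC addrA.
  have vn : enorm v <= 2 * rho.
    rewrite /v enormZ gtr0_norm// mulrC ler_pM2r//.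
    apply: (le_trans (ler_enormD _ _)); rewrite enormN u1.
    by rewrite -[leRHS]/(1 + 1) lerD2r.
  have yvr : enorm (y + v - x) < r.
    rewrite addrAC (le_lt_trans (ler_enormD _ _))//.
    have -> : r = s + 2 * s by rewrite /s; field.
    by rewrite ltrD// (le_lt_trans vn)// ltr_pM2l.
  have [Uyv _] := hr (y + v) y yvr (lt_trans ys sr).
  have [_] := hr y (y + v) (lt_trans ys sr) yvr.
  rewrite [y + v]addrC addrK Fy add0r => h; apply/(FK _ _); first by rewrite addrC.
  have gyp : 0 < enorm (grad F y) by apply: lt_trans gy; rewrite divr_gt0.
  have gyE : grad F y = enorm (grad F y) *: u.
    by rewrite -uE scalerA mulfV ?scale1r// gt_eqF.
  have uv : dot u v = rho * (dot z u - 1).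
    by rewrite /v dotZr dotBr -(sqr_enorm u) u1 expr1n dotC.
  have vv : enorm v ^+ 2 <= rho * rho * (2 * (1 - dot z u)).
    rewrite sqr_enorm /v dotZl dotZr mulrA ler_pM2l ?mulr_gt0//.
    rewrite dotBl !dotBr -!sqr_enorm u1 expr1n (dotC u z).
    have : enorm z ^+ 2 <= 1 by rewrite expr_le1// enorm_ge0.
    exact: aux.
  apply: le_trans h _; rewrite gyE dotZl uv.
  have zu : dot z u <= 1 by have := dot_le z u; rewrite u1 mulr1 => /le_trans->.
  exact: tangent_ball_estimate M0 rho0 rhoM gy zu vv.
move=> nearP; near (0 : R)^'+ => rho.
have Prho : bd K `<=` P rho by near: rho.
have rho0 : 0 < rho by near: rho; exact: nbhs_right_gt.
exists rho => // u u1; have [x [bdx hx]] := supp_point K0 u1.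
exists (x - rho *: u) => [z z1|]; first exact: (Prho x bdx u z).
have [U [F locF]] := C2K bdx.
have uE := normal_unique bdx locF u1 hx.
have := supp_funE convK compK bdx locF; rewrite uE => ->.
by rewrite dotBl dotZl -(sqr_enorm u) u1 expr1n mulr1 subrK.
Unshelve. all: by end_near.
Qed.

End Normals.

(** * Support function of the floating body *)

Section FloatingBody.
Variables (R : realType) (m : nat).
Notation n := m.+2.

(* A cap of depth [t] of the unit ball has volume about
   [(cap_scale * Num.sqrt t) ^+ n.+1], and [cap_scale ^+ 2] is the constant $c_n$
   ([cap_scale_sqr]). *)
Definition cap_scale : R :=
  Num.sqrt 2 * (vball R m.+1 / n.+1%:R) `^ (n.+1%:R^-1).
Notation gam := cap_scale.

Lemma powR_invn_exp (x : R) k : 0 <= x -> (x `^ (k.+1%:R^-1)) ^+ k.+1 = x.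
Proof.
move=> x0; rewrite -powR_mulrn ?powR_ge0// -powRrM mulVf ?powRr1//.
Qed.

Lemma cap_scale_gt0 : 0 < gam.
Proof. by rewrite mulr_gt0 ?sqrtr_gt0// powR_gt0// divr_gt0// vball_gt0. Qed.

Lemma cap_scaleX : gam ^+ n.+1 = 2 * vball R m.+1 / m.+3%:R * Num.sqrt 2 ^+ m.+1.
Proof.
rewrite exprMn powR_invn_exp; last by rewrite divr_ge0// ltW// vball_gt0.
have s2 : Num.sqrt 2 ^+ 2 = 2 :> R by rewrite sqr_sqrtr.
by rewrite 2!exprS [Num.sqrt 2 * _]mulrA -expr2 s2; ring.
Qed.

Lemma cap_scale_sqr :
  gam ^+ 2 = 2 * (vball R m.+1 / n.+1%:R) `^ (2 / n.+1%:R).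
Proof.
rewrite exprMn sqr_sqrtr// -powR_mulrn ?powR_ge0// -powRrM; congr (_ * _ `^ _).
by rewrite mulrC.
Qed.

Lemma rvleb_cap_upper (w : 'rV[R]_n) t : enorm w = 1 -> 0 < t ->
  (rvleb R n (cap w t) <= ((gam * Num.sqrt t) ^+ n.+1)%:E)%E.
Proof. by move=> w1 t0; rewrite exprMn cap_scaleX; exact: rvleb_cap_le. Qed.

(** In [rvleb_cap_ge] the factor sqrt(1 - t / 2) has exponent n - 1. Raising it to n + 1 weakens the
    bound but makes it an exact (n+1)-st power, comparable with sigma^(n+1) by taking roots. *)
Lemma rvleb_cap_lower (w : 'rV[R]_n) t : enorm w = 1 -> 0 < t <= 1 ->
  (((gam * Num.sqrt (t * (1 - t / 2))) ^+ n.+1)%:E <= rvleb R n (cap w t))%E.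
Proof.
move=> w1 /andP[t0 t1]; apply: le_trans (rvleb_cap_ge w1 _); last by rewrite t0.
have s0 : 0 <= Num.sqrt (1 - t / 2) :> R by exact: sqrtr_ge0.
have s1 : Num.sqrt (1 - t / 2) <= 1 :> R by rewrite -[leRHS]sqrtr1 ler_sqrt//; lra.
have -> : 2 - t = 2 * (1 - t / 2) by field.
rewrite lee_fin exprMn cap_scaleX !sqrtrM ?(ltW t0)// !exprMn.
have r_le : Num.sqrt (1 - t / 2) ^+ m.+3 <= Num.sqrt (1 - t / 2) ^+ m.+1.
  by rewrite ler_wiXn2l// ltnW.
pose Y := 2 * vball R m.+1 / m.+3%:R * Num.sqrt 2 ^+ m.+1 * Num.sqrt t ^+ m.+3.
have Y0 : 0 <= Y.
  have v0 : 0 <= vball R m.+1 by exact/ltW/vball_gt0.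
  apply: mulr_ge0; last by rewrite exprn_ge0// sqrtr_ge0.
  apply: mulr_ge0; last by rewrite exprn_ge0// sqrtr_ge0.
  by rewrite divr_ge0// mulr_ge0.
rewrite [leLHS](_ : _ = Y * Num.sqrt (1 - t / 2) ^+ m.+3); last by rewrite /Y; ring.
rewrite [leRHS](_ : _ = Y * Num.sqrt (1 - t / 2) ^+ m.+1); last by rewrite /Y; ring.
exact: ler_wpM2l.
Qed.

Variable K : set 'rV[R]_n.
Hypothesis compK : compact K.

Lemma compact_measurable_rv : measurable K.
Proof.
by apply: closed_measurable_rv; exact: compact_closed (@norm_hausdorff _ _) compK.
Qed.

Definition slab (u : 'rV[R]_n) (a : R) : set 'rV[R]_n :=
  [set y | K y /\ a <= dot y u].

Lemma measurable_halfspace (u : 'rV[R]_n) a : measurable [set y | a <= dot y u].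
Proof.
apply: closed_measurable_rv.
apply: (@closed_comp _ _ (fun x => dot x u) [set t | a <= t]); last exact: closed_ge.
by move=> x _; exact: dot_continuous.
Qed.

Lemma measurable_slab u a : measurable (slab u a).
Proof.
by apply: measurableI; [exact: compact_measurable_rv|exact: measurable_halfspace].
Qed.

Lemma compact_enorm_bounded : exists M : R, forall x, K x -> enorm x <= M.
Proof. exact/bounded_enormP/compact_bounded. Qed.

Lemma rvleb_slab_fin u a : (rvleb R n (slab u a) < +oo)%E.
Proof.
have [M hM] := compact_enorm_bounded; apply: (@rvleb_bounded _ _ _ M).
  exact: measurable_slab.
by move=> x [Kx _]; exact: hM.
Qed.

Lemma rvleb_slab_le u a b : a <= b -> (rvleb R n (slab u b) <= rvleb R n (slab u a))%E.
Proof.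
move=> ab; apply: le_measure; rewrite ?inE; [exact: measurable_slab..|].
by move=> y [Ky yb]; split => //; exact: le_trans yb.
Qed.

(** A slab of volume [d] cutting the point off would contain the image of the cap of depth [t] in
    the slab's own direction; all caps of that depth have the same volume, so the slab would have
    volume larger than [d]. *)
Lemma floating_inner d (c w : 'rV[R]_n) (T : 'M[R]_n) t : T \in unitmx ->
  (forall z, enorm z <= 1 -> K (c + z *m T)) -> enorm w = 1 -> 0 < t <= 1 ->
  (d%:E < `|\det T|%:E * rvleb R n (cap w t))%E ->
  floating_body K d (c + (1 - t) *: w *m T).
Proof.
move=> uT KT w1 /andP[t0 t1] dT.
have t10 : 0 <= 1 - t by rewrite subr_ge0.
split; first by apply: KT; rewrite enormZ w1 mulr1 ger0_norm//; lra.
move=> v a v1; rewrite volE; last exact: measurable_slab.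
move=> vold; rewrite leNgt; apply/negP => av.
have v0 : v != 0 by rewrite -enorm_eq0 v1 oner_neq0.
pose q := v *m T^T; have q0 : q != 0.
  apply: contra_neq v0 => /(congr1 (mulmx^~ (invmx T^T))).
  by rewrite /q mulmxK ?unitmx_tr// mul0mx.
have qp : 0 < enorm q by rewrite enorm_gt0.
pose w' := (enorm q)^-1 *: q; have w'1 : enorm w' = 1 by exact: enorm_normalize.
have capE : rvleb R n (cap w' t) = rvleb R n (cap w t) by rewrite !rvleb_cap.
move: dT; rewrite ltNge => /negP; apply.
rewrite -capE -(rvleb_affine_image c uT (measurable_cap w' t)) -vold.
apply: le_measure; rewrite ?inE.
- exact: (measurable_affine_image c uT (measurable_cap w' t)).
- exact: (measurable_slab v a).
move=> _ [z [z1 zw] <-]; split; first exact: KT.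
apply: (le_trans (ltW av)); rewrite !dotDl lerD2l !dot_mulmx -/q dotZl.
have : (1 - t) * enorm q <= dot z q.
  by move: zw; rewrite /w' dotZr mulrC ler_pdivlMr.
have wq : dot w q <= enorm q by have := dot_le w q; rewrite w1 mul1r.
exact: le_trans (ler_wpM2l t10 wq).
Qed.

(* [floating_body] only mentions slabs of volume exactly [d]; one such slab is
   found at the supremum of the levels [a] with volume at least [d], the volume
   being continuous in [a] since hyperplanes are null. *)
Lemma floating_cut d u a0 a1 : enorm u = 1 -> (d%:E <= rvleb R n (slab u a0))%E ->
  (rvleb R n (slab u a1) <= d%:E)%E ->
  forall x, floating_body K d x -> dot x u <= a1.
Proof.
move=> u1 hd0 hd1 x [_ hx].
have u0 : u != 0 by rewrite -enorm_eq0 u1 oner_neq0.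
have volslab a : vol (slab u a) = rvleb R n (slab u a).
  by rewrite volE//; exact: measurable_slab.
have [e1|ne1] := eqVneq (rvleb R n (slab u a1)) d%:E.
  by apply: hx; [exact: u1|exact: etrans (volslab a1) e1].
have lt1 : (rvleb R n (slab u a1) < d%:E)%E by rewrite lt_neqAle ne1.
pose S : set R := [set a | (d%:E <= rvleb R n (slab u a))%E].
have Sub a : S a -> a <= a1.
  move=> Sa; rewrite leNgt; apply/negP => /ltW/(rvleb_slab_le u) h.
  by have := lt_le_trans (le_lt_trans h lt1) Sa; rewrite ltxx.
have supS : has_sup S by split; [exists a0|exists a1].
pose a := sup S; have aa1 : a <= a1 by apply: sup_le_ub => //; exists a0.
have ge_d : (d%:E <= rvleb R n (slab u a))%E.
  have E : slab u a = \bigcap_k slab u (a - k.+1%:R^-1).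
    apply/seteqP; split => [y [Ky ya] k _|y hy].
      by split => //; apply: le_trans ya; rewrite gerBl invr_ge0.
    split; first by have [] := hy 0%N I.
    rewrite leNgt; apply/negP => /ltr_add_invr[k hk].
    by have [_] := hy k I; rewrite lerBlDr leNgt hk.
  have h : rvleb R n (slab u (a - k.+1%:R^-1)) @[k --> \oo] --> rvleb R n (slab u a).
    rewrite E; apply: nonincreasing_cvg_mu => //.
    - exact: rvleb_slab_fin.
    - by move=> k; exact: measurable_slab.
    - by rewrite -E; exact: measurable_slab.
    - move=> i j ij; apply/subsetPset => y [Ky yj]; split => //.
      apply: le_trans yj; rewrite lerD2l lerN2 lef_pV2 ?posrE//.
      by rewrite ler_nat ltnS.
  rewrite -(cvg_lim (@ereal_hausdorff R) h); apply: lime_ge; first exact: cvgP h.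
  near=> k; have k0 : 0 < k.+1%:R^-1 :> R by rewrite invr_gt0.
  have [b Sb ab] := sup_adherent k0 supS.
  by apply: le_trans Sb _; apply: rvleb_slab_le; exact: ltW.
have le_d : (rvleb R n (slab u a) <= d%:E)%E.
  (* [W] is the slab without its bounding hyperplane, so it has the same volume. *)
  pose W : set 'rV[R]_n := \bigcup_k slab u (a + k.+1%:R^-1).
  have mW : measurable W by apply: bigcup_measurable => k _; exact: measurable_slab.
  have mH : measurable [set y : 'rV[R]_n | dot y u = a].
    apply: closed_measurable_rv.
    apply: (@closed_comp _ _ (fun x => dot x u) [set t | t = a]); last exact: closed_eq.
    by move=> y _; exact: dot_continuous.
  have : (rvleb R n (slab u a) <= rvleb R n (W `|` [set y | dot y u = a]))%E.
    apply: le_measure; rewrite ?inE; [exact: measurable_slab|exact: measurableU|].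
    move=> y [Ky]; rewrite le_eqVlt => /predU1P[->|ya]; first by right.
    by have [k hk] := ltr_add_invr ya; left; exists k => //; split => //; exact: ltW.
  rewrite (measureU0 mW mH (rvleb_hyperplane a u0)) => h1; apply: (le_trans h1).
  have h : rvleb R n (slab u (a + k.+1%:R^-1)) @[k --> \oo] --> rvleb R n W.
    apply: nondecreasing_cvg_mu => //.
    - by move=> k; exact: measurable_slab.
    - move=> i j ij; apply/subsetPset => y [Ky yj]; split => //.
      apply: le_trans yj; rewrite lerD2l lef_pV2 ?posrE//.
      by rewrite ler_nat ltnS.
  rewrite [leLHS](_ : _ = limn (fun k => rvleb R n (slab u (a + k.+1%:R^-1)))); last first.
    exact/esym/(cvg_lim (@ereal_hausdorff R) h).
  apply: lime_le; first exact: cvgP h.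
  near=> k; rewrite leNgt; apply/negP => /ltW Sk.
  have : a + k.+1%:R^-1 <= a by exact: (ub_le_sup (ex_intro _ a1 Sub) Sk).
  by rewrite gerDl leNgt invr_gt0 ltr0n.
apply: le_trans aa1; apply: hx => //.
by rewrite -[LHS]/(vol (slab u a)) volslab; apply/eqP; rewrite eq_le le_d ge_d.
Unshelve. all: by end_near.
Qed.

End FloatingBody.

Section SupportFunction.
Variables (R : realType) (n : nat).

Lemma supp_fun_le (A : set 'rV[R]_n) u a : A !=set0 ->
  (forall y, A y -> dot y u <= a) -> supp_fun A u <= a.
Proof.
move=> [y Ay] h; apply: sup_le_ub; first by exists (dot u y), y.
by move=> _ [z Az <-]; rewrite dotC; exact: h.
Qed.

Lemma le_supp_fun (A : set 'rV[R]_n) u y : bounded_set A -> A y ->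
  dot y u <= supp_fun A u.
Proof.
move=> /bounded_enormP[M hM] Ay; apply: ub_le_sup; last by exists y; rewrite // dotC.
exists (enorm u * M) => _ [z Az <-]; rewrite (le_trans (dot_le _ _))//.
by rewrite ler_wpM2l ?enorm_ge0// hM.
Qed.

End SupportFunction.

Section SupportOfFloatingBody.
Variables (R : realType) (m : nat).
Notation n := m.+2.
Notation gam := (cap_scale R m).

Variable K : set 'rV[R]_n.
Hypotheses (convK : Defs.convex_set K) (compK : compact K) (K0 : K !=set0).

Let bK : bounded_set K. Proof. exact: compact_bounded. Qed.

Lemma bounded_floating d : bounded_set (floating_body K d).
Proof.
have [M hM] := iffLR (bounded_enormP _) bK.
by apply/bounded_enormP; exists M => x [Kx _]; exact: hM.
Qed.

Lemma supp_floating_leK d u : floating_body K d !=set0 ->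
  supp_fun (floating_body K d) u <= supp_fun K u.
Proof. by move=> L0; apply: supp_fun_le => // y [Ky _]; exact: le_supp_fun. Qed.

(** The witness lies on the segment from the centre of the inner ellipsoid to its support point in
    direction [u]: this makes Cauchy-Schwarz an equality, so its height is exactly the claimed
    bound. *)
Lemma supp_floating_ge (c u : 'rV[R]_n) (T : 'M[R]_n) (t D sigma : R) :
  T \in unitmx -> (forall z, enorm z <= 1 -> K (c + z *m T)) -> enorm u = 1 ->
  0 < t <= 1 -> 0 < D -> D ^+ n.+1 = `|\det T| -> 0 < sigma ->
  sigma ^+ 2 < (D * gam) ^+ 2 * (t * (1 - t / 2)) ->
  floating_body K (sigma ^+ n.+1) !=set0 /\
  dot c u + (1 - t) * enorm (u *m T^T) <=
    supp_fun (floating_body K (sigma ^+ n.+1)) u.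
Proof.
move=> uT KT u1 t01 D0 DT s0 hs; pose q := u *m T^T.
have u0 : u != 0 by rewrite -enorm_eq0 u1 oner_neq0.
have q0 : q != 0.
  apply: contra_neq u0 => /(congr1 (mulmx^~ (invmx T^T))).
  by rewrite /q mulmxK ?unitmx_tr// mul0mx.
pose w := (enorm q)^-1 *: q; have w1 : enorm w = 1 by exact: enorm_normalize.
have detT0 : 0 < `|\det T| by rewrite -DT exprn_gt0.
have g0 := @cap_scale_gt0 R m.
have tt0 : 0 <= t * (1 - t / 2).
  by case/andP: t01 => t0 t1; rewrite mulr_ge0 ?(ltW t0)//; lra.
have Lp : floating_body K (sigma ^+ n.+1) (c + (1 - t) *: w *m T).
  apply: floating_inner => //.
  apply: (@lt_le_trans _ _ (`|\det T|%:E * ((gam * Num.sqrt (t * (1 - t / 2))) ^+ n.+1)%:E)%E).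
    rewrite -EFinM lte_fin -DT -exprMn ltr_pXn2r ?nnegrE ?(ltW s0)//.
      rewrite -(@ltr_pXn2r _ 2%N) ?nnegrE ?(ltW s0)//.
        by rewrite mulrA exprMn sqr_sqrtr.
      by rewrite mulr_ge0 ?(ltW D0)// mulr_ge0 ?(ltW g0) ?sqrtr_ge0.
    by rewrite mulr_ge0 ?(ltW D0)// mulr_ge0 ?(ltW g0) ?sqrtr_ge0.
  by rewrite lee_wpmul2l// rvleb_cap_lower.
split; first by exists (c + (1 - t) *: w *m T).
apply: le_trans (le_supp_fun u (bounded_floating _) Lp).
rewrite dotDl dot_mulmx -/q dotZl lerD2l le_eqVlt; apply/orP; left; apply/eqP.
have -> // : dot w q = enorm q.
by rewrite /w dotZl -sqr_enorm expr2 mulrA mulVf ?mul1r// enorm_eq0.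
Qed.

(** At the claimed level, the slab of K lies in the image of the cap of depth sigma^2 / (D gam)^2,
    whose volume is at most sigma^(n+1). The bound by [tau] is required because the ellipsoid
    contains K only near the support point. *)
Lemma supp_floating_le (c u : 'rV[R]_n) (T : 'M[R]_n) (D sigma h tau : R) :
  T \in unitmx -> enorm u = 1 -> floating_body K (sigma ^+ n.+1) !=set0 ->
  (forall y, K y -> h - tau <= dot y u -> exists2 z, enorm z <= 1 & y = c + z *m T) ->
  dot c u + enorm (u *m T^T) = h ->
  0 < D -> D ^+ n.+1 = `|\det T| -> 0 < sigma ->
  ((sigma ^+ n.+1)%:E <= rvleb R n K)%E ->
  enorm (u *m T^T) * sigma ^+ 2 / (D * gam) ^+ 2 <= tau ->
  supp_fun (floating_body K (sigma ^+ n.+1)) u <=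
    h - enorm (u *m T^T) * sigma ^+ 2 / (D * gam) ^+ 2.
Proof.
move=> uT u1 L0 hK hT D0 DT s0 sK stau; pose q := u *m T^T.
have u0 : u != 0 by rewrite -enorm_eq0 u1 oner_neq0.
have q0 : q != 0.
  apply: contra_neq u0 => /(congr1 (mulmx^~ (invmx T^T))).
  by rewrite /q mulmxK ?unitmx_tr// mul0mx.
have qp : 0 < enorm q by rewrite enorm_gt0.
pose w := (enorm q)^-1 *: q; have w1 : enorm w = 1 by exact: enorm_normalize.
have g0 := @cap_scale_gt0 R m.
have Dg0 : 0 < D * gam by rewrite mulr_gt0.
rewrite -/q in stau hT *; set tau' := enorm q * sigma ^+ 2 / (D * gam) ^+ 2 in stau *.
pose t := sigma ^+ 2 / (D * gam) ^+ 2.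
have t0 : 0 < t by rewrite divr_gt0// exprn_gt0.
have [M hM] := iffLR (bounded_enormP _) bK.
apply: supp_fun_le; first exact: L0.
suff [h0 h1] : ((sigma ^+ n.+1)%:E <= rvleb R n (slab K u (- M)))%E /\
    (rvleb R n (slab K u (h - tau')) <= (sigma ^+ n.+1)%:E)%E.
  exact: (floating_cut compK u1 h0 h1).
split.
  apply: le_trans sK _; apply: le_measure; rewrite ?inE.
  - exact: compact_measurable_rv.
  - exact: measurable_slab.
  move=> y Ky; split => //; have := normr_dot_le y u; rewrite u1 mulr1.
  by move/le_trans/(_ (hM _ Ky)); rewrite ler_norml => /andP[].
apply: (@le_trans _ _ (rvleb R n [set c + z *m T | z in cap w t])).
  apply: le_measure; rewrite ?inE.
  - exact: measurable_slab.
  - exact: (measurable_affine_image c uT (measurable_cap w t)).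
  move=> y [Ky hy]; have [|z z1 yE] := hK y Ky.
    by apply: le_trans hy; rewrite lerD2l lerN2.
  exists z => //; split => //; rewrite /w dotZr mulrC ler_pdivlMr//.
  move: hy; rewrite yE dotDl dot_mulmx -/q -hT.
  have -> : tau' = t * enorm q by rewrite /tau' /t; ring.
  rewrite mulrBl mul1r -addrA lerD2l.
  by [].
rewrite (rvleb_affine_image c uT (measurable_cap w t)).
apply: (@le_trans _ _ (`|\det T|%:E * ((gam * Num.sqrt t) ^+ n.+1)%:E)%E).
  by rewrite lee_wpmul2l// rvleb_cap_upper.
rewrite -EFinM lee_fin -DT -exprMn le_eqVlt; apply/orP; left; apply/eqP.
congr (_ ^+ _); rewrite /t -expr_div_n sqrtr_sqr gtr0_norm ?divr_gt0//.
by rewrite mulrA mulrC divfK// gt_eqF.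
Qed.

Lemma supp_floating_unif : C2_boundary K -> exists C s0, [/\ 0 < s0, 0 <= C &
  forall sigma u, 0 < sigma < s0 -> enorm u = 1 ->
    floating_body K (sigma ^+ n.+1) !=set0 /\
    supp_fun K u - C * sigma ^+ 2 <= supp_fun (floating_body K (sigma ^+ n.+1)) u].
Proof.
move=> C2K; have [rho rho0 hrho] := uniform_ball convK compK C2K K0.
pose D := (rho ^+ n) `^ (n.+1%:R^-1).
have D0 : 0 < D by rewrite powR_gt0// exprn_gt0.
have DE : D ^+ n.+1 = rho ^+ n by rewrite powR_invn_exp// exprn_ge0// ltW.
have g0 := @cap_scale_gt0 R m.
have Dg0 : 0 < D * gam by rewrite mulr_gt0.
exists (2 * rho / (D * gam) ^+ 2), (D * gam / 2); split.
- by rewrite divr_gt0.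
- by rewrite divr_ge0 ?sqr_ge0// mulr_ge0// ltW.
move=> sigma u /andP[s0 ss] u1; have [c Kc cE] := hrho u u1.
(* Twice the leading-order depth: as [t < 1], this leaves room for the factor [1 - t / 2]. *)
pose t := 2 * sigma ^+ 2 / (D * gam) ^+ 2.
have t0 : 0 < t by rewrite divr_gt0 ?exprn_gt0// mulr_gt0// exprn_gt0.
have t1 : t < 1.
  rewrite ltr_pdivrMr ?exprn_gt0// mul1r.
  have : sigma ^+ 2 < (D * gam / 2) ^+ 2 by rewrite ltr_pXn2r ?nnegrE ?(ltW s0)// ltW// divr_gt0.
  have : 0 < (D * gam) ^+ 2 by rewrite exprn_gt0.
  rewrite [(_ / 2) ^+ 2]exprMn; move: (_ ^+ 2) (_ ^+ 2) => a b; rewrite exprVn; lra.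
have rhoT : (rho%:M : 'M[R]_n) \in unitmx.
  by rewrite unitmxE det_scalar unitfE expf_neq0// gt_eqF.
have en : enorm (u *m (rho%:M : 'M[R]_n)^T) = rho.
  by rewrite tr_scalar_mx mul_mx_scalar enormZ u1 mulr1 gtr0_norm.
have := @supp_floating_ge c u rho%:M t D sigma rhoT _ u1 _ D0 _ s0 _.
rewrite en => h; have [|||| L0 hL] := h.
- by move=> z z1; rewrite mul_mx_scalar; exact: Kc.
- by rewrite t0 ltW.
- by rewrite det_scalar ger0_norm ?exprn_ge0// ltW.
- have -> : (D * gam) ^+ 2 * (t * (1 - t / 2)) = sigma ^+ 2 * (2 - t).
    by rewrite /t; field; rewrite !gt_eqF.
  by rewrite ltr_pMr ?exprn_gt0//; lra.
split => //; apply: le_trans hL; rewrite -cE.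
have -> : 2 * rho / (D * gam) ^+ 2 * sigma ^+ 2 = t * rho by rewrite /t; ring.
by rewrite le_eqVlt; apply/orP; left; apply/eqP; ring.
Qed.

End SupportOfFloatingBody.

(** * Pointwise limit of the difference of support functions *)

Section SupportLimit.
Variables (R : realType) (m : nat).
Notation n := m.+2.
Notation gam := (cap_scale R m).
Variable K : set 'rV[R]_n.
Hypotheses (convK : Defs.convex_set K) (compK : compact K).
Hypotheses (C2K : C2_boundary K) (curvK : pos_gauss_curv K).

Lemma det_root (T : 'M[R]_n) : T \in unitmx ->
  exists2 D, 0 < D & D ^+ n.+1 = `|\det T|.
Proof.
move=> uT; have dT : 0 < `|\det T| by rewrite normr_gt0 -unitfE -unitmxE.
exists (`|\det T| `^ (n.+1%:R^-1)); first exact: powR_gt0.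
by rewrite powR_invn_exp.
Qed.

(** The curvature of the ellipsoid has th / D^2 as (n+1)-st root, the quantity to which cap depths
    are proportional. *)
Lemma ratio_root (T : 'M[R]_n) (D th : R) : D ^+ n.+1 = `|\det T| ->
  th ^+ n.+1 / \det T ^+ 2 = (th / D ^+ 2) ^+ n.+1.
Proof.
by move=> DT; rewrite expr_div_n -exprM mulnC exprM DT real_normK// num_real.
Qed.

Lemma supp_floating_lim_upper u k b : curv_at_normal K u (k ^+ n.+1) -> 0 < k ->
  k / gam ^+ 2 < b ->
  exists2 s0, 0 < s0 & forall sigma, 0 < sigma < s0 ->
    supp_fun K u - supp_fun (floating_body K (sigma ^+ n.+1)) u <= b * sigma ^+ 2.
Proof.
move=> [x [U [F [bx [lF [uE kE]]]]]] k0 kb.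
have g0 := @cap_scale_gt0 R m; have gg0 : 0 < gam ^+ 2 by rewrite exprn_gt0.
have l0 : 0 < k / gam ^+ 2 by rewrite divr_gt0.
(* The slack between k / gam^2 and [b] is split: up to [b'] it pays for the curvature of the inner
   ellipsoid, and the ratio [b / b'] pays for the factor [1 - t / 2]. *)
have [b' [b'0 kb' b'b]] : exists b', [/\ 0 < b', k / gam ^+ 2 < b' & b' < b].
  exists ((k / gam ^+ 2 + b) / 2); move: l0 kb; move: (k / _) => a.
  by move=> *; split; lra.
have b0 : 0 < b := lt_trans b'0 b'b.
have cp := curvK bx lF.
have kk1 : gauss_curv F x < (b' * gam ^+ 2) ^+ n.+1.
  rewrite -kE ltr_pXn2r ?nnegrE ?(ltW k0)//; last exact/ltW/mulr_gt0.
  by rewrite -ltr_pdivrMr.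
have [c [T [uT KT hT rT]]] := inner_ellipsoid convK compK bx lF cp kk1.
have hxu : supp_fun K u = dot x u by rewrite -uE; exact: (supp_funE convK compK bx lF).
have u1 : enorm u = 1.
  by case: lF => _ [Ux [_ [gn _]]]; rewrite -uE enorm_normalize// gn.
rewrite uE -hxu in hT; rewrite uE in rT.
move: (enorm_ge0 (u *m T^T)) hT rT; set th := enorm (u *m T^T) => th0 hT rT.
have [D D0 DT] := det_root uT; rewrite (ratio_root _ DT) in rT.
have D20 : 0 < D ^+ 2 by rewrite exprn_gt0.
have {}rT : th / D ^+ 2 <= b' * gam ^+ 2.
  have h1 : 0 <= th / D ^+ 2 by rewrite divr_ge0// ltW.
  have h2 : 0 <= b' * gam ^+ 2 by rewrite mulr_ge0// ltW.
  by rewrite ler_pXn2r in rT.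
pose A := b / b' / (D * gam) ^+ 2.
have Dg0 : 0 < (D * gam) ^+ 2 by rewrite exprn_gt0// mulr_gt0.
have A0 : 0 < A by rewrite !divr_gt0.
pose e := Num.min 1 (1 - b' / b).
have bb1 : b' / b < 1 by rewrite ltr_pdivrMr// mul1r.
have e0 : 0 < e by rewrite lt_min ltr01 subr_gt0.
have [e1 e2] : e <= 1 /\ e <= 1 - b' / b by rewrite !ge_min !lexx orbT.
exists (Num.min 1 (e / A)); first by rewrite lt_min ltr01 divr_gt0.
move=> sigma /andP[s0]; rewrite lt_min => /andP[s1 sA].
have ss0 : 0 < sigma ^+ 2 by rewrite exprn_gt0.
pose t := A * sigma ^+ 2.
have t0 : 0 < t by rewrite mulr_gt0.
have te : t < e.
  rewrite /t mulrC -ltr_pdivlMr//; apply: le_lt_trans sA.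
  by rewrite expr2 ger_pMr// ltW.
have [| |_ H] := supp_floating_ge compK uT KT u1 _ D0 DT s0 (t := t).
- by rewrite t0 (le_trans (ltW te)).
- have -> : (D * gam) ^+ 2 * (t * (1 - t / 2)) = sigma ^+ 2 * (b / b' * (1 - t / 2)).
    rewrite mulrA; have -> : (D * gam) ^+ 2 * t = sigma ^+ 2 * (b / b').
      by rewrite /t /A; field; rewrite !gt_eqF.
    by rewrite -mulrA.
  rewrite ltr_pMr// -[b / b']invf_div mulrC ltr_pdivlMr ?divr_gt0// mul1r.
  move: (lt_le_trans te e2) t0; move: (b' / b) (t) => r y *; lra.
apply: (@le_trans _ _ (t * th)).
  by move: H; rewrite -/th -hT mulrBl mul1r; move: (t * th) (dot c u) (supp_fun _ _) (th) => y z *; lra.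
rewrite /t /A -mulrA [_ * th]mulrC mulrA ler_pM2r//.
apply: (@le_trans _ _ (b / b' / (D * gam) ^+ 2 * (b' * gam ^+ 2 * D ^+ 2))).
  by rewrite ler_pM2l// -ler_pdivrMr.
by rewrite le_eqVlt; apply/orP; left; apply/eqP; field; rewrite !gt_eqF.
Qed.

Lemma supp_floating_lim_lower u k b : curv_at_normal K u (k ^+ n.+1) -> 0 < k ->
  (0 < rvleb R n K)%E -> b < k / gam ^+ 2 ->
  exists2 s0, 0 < s0 & forall sigma, 0 < sigma < s0 ->
    b * sigma ^+ 2 <= supp_fun K u - supp_fun (floating_body K (sigma ^+ n.+1)) u.
Proof.
move=> [x [U [F [bx [lF [uE kE]]]]]] k0 vK0 bk.
have K0 : K !=set0 by exists x; exact: (bd_sub compK).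
have [C [s0 [s00 C0 unif]]] := supp_floating_unif convK compK K0 C2K.
have u1 : enorm u = 1.
  by case: lF => _ [Ux [_ [gn _]]]; rewrite -uE enorm_normalize// gn.
(* For [b <= 0] the inclusion of the floating body in K suffices; otherwise [b] can be raised to a
   power monotonically. *)
have [b0|b0] := leP b 0.
  exists s0 => // sigma ss; have [L0 _] := unif _ _ ss u1.
  apply: (@le_trans _ _ 0); first by rewrite mulr_le0_ge0// sqr_ge0.
  by rewrite subr_ge0; exact: supp_floating_leK.
have g0 := @cap_scale_gt0 R m; have gg0 : 0 < gam ^+ 2 by rewrite exprn_gt0.
have cp := curvK bx lF.
have kk1 : (b * gam ^+ 2) ^+ n.+1 < gauss_curv F x.
  rewrite -kE ltr_pXn2r ?nnegrE ?(ltW k0)//; first by rewrite -ltr_pdivlMr.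
  exact/ltW/mulr_gt0.
have [c [T [tau [uT tau0 KT hT rT]]]] := outer_ellipsoid convK compK bx lF cp kk1.
have hxu : supp_fun K u = dot x u by rewrite -uE; exact: (supp_funE convK compK bx lF).
rewrite uE -hxu in hT KT; rewrite uE in rT.
move: (enorm_ge0 (u *m T^T)) (hT) rT; set th := enorm (u *m T^T) => th0 hT' rT.
have [D D0 DT] := det_root uT; rewrite (ratio_root _ DT) in rT.
have D20 : 0 < D ^+ 2 by rewrite exprn_gt0.
have {}rT : b * gam ^+ 2 <= th / D ^+ 2.
  have h1 : 0 <= th / D ^+ 2 by rewrite divr_ge0// ltW.
  have h2 : 0 <= b * gam ^+ 2 by rewrite mulr_ge0// ltW.
  by rewrite ler_pXn2r in rT.
pose A := th / (D * gam) ^+ 2.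
have Dg0 : 0 < (D * gam) ^+ 2 by rewrite exprn_gt0// mulr_gt0.
have A0 : 0 <= A by rewrite divr_ge0// ltW.
have [v v0 vK] : exists2 v, 0 < v & (v%:E <= rvleb R n K)%E.
  move: vK0; case: (rvleb R n K) => [r| |]//; first by rewrite lte_fin; exists r.
  by exists 1; rewrite ?leey.
(* [s0] keeps the floating body nonempty, 1 and [v] bound the removed volume by that of K, and the
   last term keeps the depth below [tau]; [A + 1] is positive even if [A] vanishes. *)
exists (Num.min s0 (Num.min 1 (Num.min v (tau / (A + 1))))).
  by rewrite !lt_min s00 ltr01 v0 divr_gt0// ltr_wpDl.
move=> sigma /andP[sp]; rewrite !lt_min => /andP[ss0 /andP[s1 /andP[sv sA]]].
have [|L0 _] := unif sigma u _ u1; first by rewrite sp.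
have sle k' : sigma ^+ k'.+1 <= sigma.
  by rewrite exprS ger_pMr// exprn_ile1// ltW.
have hA : ((sigma ^+ n.+1)%:E <= rvleb R n K)%E.
  by apply: le_trans vK; rewrite lee_fin (le_trans (sle _))// ltW.
have thE : th * sigma ^+ 2 / (D * gam) ^+ 2 = A * sigma ^+ 2 by rewrite mulrAC.
have hB : th * sigma ^+ 2 / (D * gam) ^+ 2 <= tau.
  rewrite thE (@le_trans _ _ ((A + 1) * sigma))//.
    by apply: ler_pM => //; rewrite ?sqr_ge0// ?ler_wpDr.
  by rewrite mulrC -ler_pdivlMr ?(ltW sA)// ltr_wpDl.
have := supp_floating_le compK uT u1 L0 KT hT D0 DT sp hA hB.
rewrite -/th thE => H.
apply: (@le_trans _ _ (A * sigma ^+ 2)).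
  rewrite ler_pM2r ?exprn_gt0// /A ler_pdivlMr// exprMn mulrA mulrAC.
  by rewrite -ler_pdivlMr// mulrC.
by move: H; move: (A * _) (supp_fun _ _) (supp_fun _ _) => y z w; lra.
Qed.

Lemma supp_floating_lim u k : curv_at_normal K u (k ^+ n.+1) -> 0 < k ->
  (0 < rvleb R n K)%E -> forall e, 0 < e ->
  exists2 s0, 0 < s0 & forall sigma, 0 < sigma < s0 ->
    `|(supp_fun K u - supp_fun (floating_body K (sigma ^+ n.+1)) u) / sigma ^+ 2
      - k / gam ^+ 2| <= e.
Proof.
move=> cK k0 vK e e0; pose l := k / gam ^+ 2.
have [|s1 s10 h1] := @supp_floating_lim_upper u k (l + e) cK k0.
  by rewrite ltrDl.
have [|s2 s20 h2] := @supp_floating_lim_lower u k (l - e) cK k0 vK.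
  by rewrite gtrBl.
exists (Num.min s1 s2); first by rewrite lt_min s10.
move=> sigma /andP[s0]; rewrite lt_min => /andP[ss1 ss2].
have q0 : 0 < sigma ^+ 2 by rewrite exprn_gt0.
have {}h1 : sigma < s1 -> _ := fun h => h1 sigma (introT andP (conj s0 h)).
have {}h2 : sigma < s2 -> _ := fun h => h2 sigma (introT andP (conj s0 h)).
rewrite -/l ler_norml; apply/andP; split.
  by rewrite lerBrDr addrC ler_pdivlMr// h2.
by rewrite lerBlDr [leRHS]addrC ler_pdivrMr// h1.
Qed.

End SupportLimit.

(** * Volume of the polar body *)

Section PolarVolume.
Variables (R : realType) (m : nat).
Notation n := m.+1.
Implicit Types (L : set 'rV[R]_n) (u x y : 'rV[R]_n).

Section SupportFunction.
Variable L : set 'rV[R]_n.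
Hypotheses (bL : bounded_set L) (L0 : L !=set0).

Lemma supp_funZ t u : 0 < t -> supp_fun L (t *: u) = t * supp_fun L u.
Proof.
have le_t v s : 0 < s -> supp_fun L (s *: v) <= s * supp_fun L v.
  move=> s0; apply: (supp_fun_le L0) => y Ly.
  by rewrite dotZr ler_wpM2l ?(ltW s0)// le_supp_fun.
move=> t0; apply/eqP; rewrite eq_le le_t//=.
rewrite -ler_pdivlMl// (le_trans _ (le_t (t *: u) _ _)) ?invr_gt0//.
by rewrite scalerA mulVf ?scale1r// gt_eqF.
Qed.

Lemma supp_fun0 : supp_fun L 0 = 0.
Proof.
apply/eqP; rewrite eq_le (supp_fun_le L0) => [|y _]; last by rewrite dotC dot0l.
by case: L0 => y Ly; have := le_supp_fun 0 bL Ly; rewrite dotC dot0l.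
Qed.

Lemma supp_fun_continuous : continuous (supp_fun L).
Proof.
have [M0 hM0] := iffLR (bounded_enormP _) bL.
pose M := Num.max 1 M0; have M0' : 0 < M by rewrite lt_max ltr01.
have hM y : L y -> enorm y <= M by move=> Ly; rewrite le_max hM0// orbT.
have lip x y : supp_fun L x <= supp_fun L y + M * enorm (x - y).
  apply: (supp_fun_le L0) => z Lz; have -> : dot z x = dot z y + dot z (x - y) by rewrite -dotDr addrC subrK.
  apply: lerD.
    exact: le_supp_fun.
  apply: le_trans (dot_le _ _) _; rewrite ler_wpM2r ?enorm_ge0//; exact: hM.
move=> x A /nbhs_ballP[e /= e0 xA]; apply/nbhs_enormP.
exists (e / M); first exact: divr_gt0.
move=> y yx; apply: xA; rewrite /ball /= ltr_norml.
have xy : M * enorm (x - y) < e.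
  by rewrite mulrC -ltr_pdivlMr// enorm_distC.
have := lip x y; have := lip y x; rewrite [enorm (y - x)]enorm_distC.
move: (supp_fun _ _) (supp_fun _ _) (M * _) xy => p q r *; apply/andP; split; lra.
Qed.

Lemma measurable_supp_fun : measurable_fun setT (supp_fun L).
Proof. by apply: continuous_measurable_rv; exact: supp_fun_continuous. Qed.

Lemma polarE : polar L = [set y | supp_fun L y <= 1].
Proof.
apply/seteqP; split => y /= h.
  by apply: (supp_fun_le L0) => z Lz; rewrite dotC; exact: h.
by move=> z Lz; apply: le_trans h; rewrite dotC; exact: le_supp_fun.
Qed.

(* Radial function of the polar body, with junk value 0 at the origin. *)
Definition radial_polar x := (supp_fun L ((enorm x)^-1 *: x))^-1.

Variable a : R.
Hypotheses (a0 : 0 < a) (la : forall u, enorm u = 1 -> a <= supp_fun L u).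

Lemma supp_fun_pos u : u != 0 -> 0 < supp_fun L u.
Proof.
move=> u0; have up : 0 < enorm u by rewrite enorm_gt0.
have := la (enorm_normalize u0); rewrite supp_funZ ?invr_gt0// => h.
by have := lt_le_trans a0 h; rewrite pmulr_rgt0// invr_gt0.
Qed.

(** Homogeneity removes the normalization; [powR] with exponent -1 replaces the inverse so that
    measurability follows from [measurable_powR]. *)
Lemma radial_polarE x : radial_polar x = enorm x * (supp_fun L x) `^ (-1).
Proof.
have [->|x0] := eqVneq x 0.
  by rewrite /radial_polar scaler0 supp_fun0 invr0 enorm0 mul0r.
have xp : 0 < enorm x by rewrite enorm_gt0.
rewrite powR_inv1 ?(ltW (supp_fun_pos x0))//.
by rewrite /radial_polar supp_funZ ?invr_gt0// invfM invrK.
Qed.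

Lemma measurable_radial_polar : measurable_fun setT radial_polar.
Proof.
rewrite (_ : radial_polar = (fun x => enorm x * (supp_fun L x) `^ (-1))); last first.
  by apply/funext => x; exact: radial_polarE.
apply: measurable_funM; first exact: measurable_enorm.
exact: measurableT_comp (measurable_powR _) measurable_supp_fun.
Qed.

Lemma rvleb_set0 : rvleb R n [set 0] = 0%E.
Proof.
have u0 : delta_mx 0 ord0 != 0 :> 'rV[R]_n.
  apply/eqP => /matrixP/(_ 0 ord0)/eqP.
  by rewrite !mxE !eqxx oner_eq0.
apply: (subset_measure0 _ _ _ (rvleb_hyperplane 0 u0)).
- exact: closed_measurable_rv (compact_closed (@norm_hausdorff _ _) (@compact_set1 _ 0)).
- apply: closed_measurable_rv.
  apply: (@closed_comp _ _ (fun x => dot x (delta_mx 0 ord0)) [set t | t = 0]).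
    by move=> y _; exact: dot_continuous.
  exact: closed_eq.
by move=> _ ->; rewrite /= dot0l.
Qed.

(** Without the null set {0}, the polar body is the star body of radial function 1 / h; boundedness
    of [L] and the bound [a] pinch this function between positive constants, as [rvleb_star]
    requires. *)
Lemma volR_polar :
  (volR (polar L))%:E = (\int[rvleb R n]_(x in pball 1) (radial_polar x ^+ n)%:E)%E /\
  (\int[rvleb R n]_(x in pball 1) (radial_polar x ^+ n)%:E < +oo)%E.
Proof.
have [M hM] := iffLR (bounded_enormP _) bL.
have mP : measurable (polar L).
  rewrite polarE; apply: closed_measurable_rv.
  apply: (@closed_comp _ _ (supp_fun L) [set t | t <= 1]); last exact: closed_le.
  by move=> y _; exact: supp_fun_continuous.
have m0 : measurable [set 0 : 'rV[R]_n].
  exact: closed_measurable_rv (compact_closed (@norm_hausdorff _ _) (@compact_set1 _ 0)).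
have hatn x : x != 0 -> a <= supp_fun L ((enorm x)^-1 *: x).
  by move=> x0; exact/la/enorm_normalize.
have aM : 0 < a^-1 by rewrite invr_gt0.
have PE : polar L `\` [set 0] =
    [set x | 0 < enorm x /\ enorm x <= radial_polar x].
  rewrite polarE; apply/seteqP; split => x /=.
    move=> [h /eqP x0]; rewrite enorm_gt0; split => //.
    rewrite radial_polarE powR_inv1 ?(ltW (supp_fun_pos x0))//.
    by rewrite ler_pdivlMr ?supp_fun_pos// ler_piMr ?enorm_ge0.
  rewrite enorm_gt0 => -[x0]; rewrite radial_polarE.
  rewrite powR_inv1 ?(ltW (supp_fun_pos x0))// ler_pdivlMr ?supp_fun_pos//.
  by rewrite ger_pMr ?enorm_gt0// => h; split => //; exact/eqP.
have bx x : x != 0 -> radial_polar x <= a^-1.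
  by move=> x0; rewrite lef_pV2 ?posrE ?hatn// (lt_le_trans a0)// hatn.
have cx x : x != 0 -> (`|M| + 1)^-1 <= radial_polar x.
  move=> x0; rewrite lef_pV2 ?posrE ?ltr_wpDl//; last by rewrite (lt_le_trans a0)// hatn.
  apply: (supp_fun_le L0) => y Ly; apply: le_trans (dot_le _ _) _.
  rewrite enorm_normalize// mulr1 (le_trans (hM _ Ly))// (le_trans (ler_norm _))//.
  by rewrite lerDl.
have M0 : 0 < (`|M| + 1)^-1 by rewrite invr_gt0 ltr_wpDl.
have rZ x t : 0 < t -> radial_polar (t *: x) = radial_polar x.
  move=> t0; rewrite /radial_polar enormZ gtr0_norm// invfM scalerA; congr (_^-1).
  by rewrite mulrAC mulVf ?mul1r// gt_eqF.
have [IE Ifin] := rvleb_star measurable_radial_polar M0 cx bx rZ.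
split=> //; rewrite /volR volE//.
have PU : polar L = (polar L `\` [set 0]) `|` [set 0].
  apply/seteqP; split => x.
    by have [->|/eqP x0] := eqVneq x 0; [right|left].
  by move=> [[]//|->] z _; rewrite dot0l.
have E1 : rvleb R n (polar L) = rvleb R n (polar L `\` [set 0]).
  by rewrite {1}PU; exact: measureU0 (measurableD mP m0) m0 rvleb_set0.
have E2 : rvleb R n (polar L) =
    (\int[rvleb R n]_(x in pball 1) (radial_polar x ^+ n)%:E)%E.
  by rewrite E1 PE; exact: IE.
rewrite -E2 fineK// ge0_fin_numE; first by rewrite E2.
exact: measure_ge0.
Qed.

End SupportFunction.
End PolarVolume.

(** * Difference quotients of inverse powers *)

Section InverseDifferenceQuotient.
Variables (R : realType) (n : nat).
Notation N := n.+1.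

Lemma invX_subE (h k : R) : h != 0 -> k != 0 ->
  k^-1 ^+ N - h^-1 ^+ N =
  (h - k) * (h^-1 * k^-1) * \sum_(i < N) k^-1 ^+ (n - i) * h^-1 ^+ i.
Proof.
move=> h0 k0; rewrite subrXX /=; congr (_ * _).
by rewrite mulrBl mulrA divff// mul1r mulrCA divff// mulr1.
Qed.

(** Source of the dominating constant: the bound is uniform in [h] and [k] because both stay above
    [a]. *)
Lemma invX_diff_bound (h k a C s : R) : 0 < a -> a <= h -> a <= k -> 0 < s ->
  0 <= h - k <= C * s ->
  `|(k^-1 ^+ N - h^-1 ^+ N) / s| <= C * (a^-1 ^+ 2 * (N%:R * a^-1 ^+ n)).
Proof.
move=> a0 ah ak s0 /andP[hk0 hkC].
have h0 : 0 < h := lt_le_trans a0 ah; have k0 : 0 < k := lt_le_trans a0 ak.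
have h1 : 0 <= h^-1 <= a^-1 by rewrite invr_ge0 (ltW h0) lef_pV2.
have k1 : 0 <= k^-1 <= a^-1 by rewrite invr_ge0 (ltW k0) lef_pV2.
case/andP: h1 => h1 h2; case/andP: k1 => k1 k2.
rewrite invX_subE ?gt_eqF//.
set S := \sum_(i < N) _.
have S0 : 0 <= S by apply: sumr_ge0 => i _; rewrite mulr_ge0// exprn_ge0.
have SA : S <= N%:R * a^-1 ^+ n.
  rewrite (_ : _ * _ = \sum_(i < N) a^-1 ^+ n); last first.
    by rewrite sumr_const card_ord mulr_natl.
  apply: ler_sum => i _.
  rewrite -[X in a^-1 ^+ X](@subnK i); last by rewrite -ltnS.
  have ai : 0 <= a^-1 by rewrite invr_ge0 ltW.
  by rewrite exprD; apply: ler_pM; rewrite ?exprn_ge0//; apply: lerXn2r.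
have P0 : 0 <= h^-1 * k^-1 by exact: mulr_ge0.
have PA : h^-1 * k^-1 <= a^-1 ^+ 2 by rewrite expr2 ler_pM.
have PS : h^-1 * k^-1 * S <= a^-1 ^+ 2 * (N%:R * a^-1 ^+ n) by exact: ler_pM.
rewrite ger0_norm; last by rewrite divr_ge0 ?(ltW s0)// !mulr_ge0.
rewrite ler_pdivrMr// -mulrA [leRHS]mulrAC; apply: ler_pM => //.
exact: mulr_ge0.
Qed.

(** Chain rule for x^-N along a sequence; the limit of the quotient already forces [k i] to tend to
    [h]. *)
Lemma invX_diff_cvg (h l a C : R) (k s : nat -> R) : 0 < a -> a <= h ->
  (forall i, a <= k i) -> (forall i, 0 < s i) -> s i @[i --> \oo] --> (0 : R) ->
  (h - k i) / s i @[i --> \oo] --> l ->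
  ((k i)^-1 ^+ N - h^-1 ^+ N) / s i @[i --> \oo] --> N%:R * h^-1 ^+ N.+1 * l.
Proof.
move=> a0 ah ak s0 cs cl.
have h0 : 0 < h := lt_le_trans a0 ah.
have k0 i : 0 < k i := lt_le_trans a0 (ak i).
have ck : k i @[i --> \oo] --> h.
  have -> : k = fun i => h - (h - k i) / s i * s i.
    by apply/funext => i; rewrite divfK ?gt_eqF// subKr.
  rewrite -[X in _ --> X]subr0 -(mulr0 l).
  by apply: cvgB; [exact: cvg_cst|exact: cvgM].
have cki : (k i)^-1 @[i --> \oo] --> h^-1 by apply: cvgV; rewrite ?gt_eqF.
rewrite (_ : (fun i => _) = fun i => (h - k i) / s i * (h^-1 * (k i)^-1) *
  \sum_(j < N) (k i)^-1 ^+ (n - j) * h^-1 ^+ j); last first.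
  apply/funext => i; rewrite invX_subE ?gt_eqF//.
  by rewrite [LHS]mulrAC; congr (_ * _); exact: mulrAC.
rewrite (_ : _ * l = l * (h^-1 * h^-1) * \sum_(j < N) h^-1 ^+ (n - j) * h^-1 ^+ j).
  apply: cvgM; first by apply: cvgM => //; apply: cvgM => //; exact: cvg_cst.
  apply: (@cvg_big _ _ _ _ _ add_continuous) => j _.
  apply: cvgM; last exact: cvg_cst.
  exact: (cvg_comp _ _ cki (@exprn_continuous R (n - j) h^-1)).
rewrite (eq_bigr (fun=> h^-1 ^+ n)) => [|j _]; last first.
  by rewrite -exprD subnK// -ltnS.
rewrite sumr_const card_ord -mulr_natl [h^-1 ^+ N.+1]exprS exprS.
by ring.
Qed.

End InverseDifferenceQuotient.

(** * The limit *)

Section VolumeDifference.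
Variables (R : realType) (m : nat).
Notation n := m.+2.
Notation gam := (cap_scale R m).
Variable K : set 'rV[R]_n.
Hypotheses (convK : Defs.convex_set K) (compK : compact K).
Hypotheses (C2K : C2_boundary K) (curvK : pos_gauss_curv K).
Hypothesis K_int0 : interior K 0.

Let bK : bounded_set K. Proof. exact: compact_bounded. Qed.

Let K0 : K !=set0. Proof. by exists 0; exact: interior_subset. Qed.

Lemma ball_in_body : exists2 r, 0 < r & forall z : 'rV[R]_n, enorm z <= r -> K z.
Proof.
have /nbhs_enormP[e e0 he] := K_int0.
exists (e / 2) => [|z ze]; first exact: divr_gt0.
by apply: he; rewrite subr0 (le_lt_trans ze)// gtr_pMr//; lra.
Qed.

Lemma supp_body_ge : exists2 r, 0 < r & forall u, enorm u = 1 -> r <= supp_fun K u.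
Proof.
have [r r0 hr] := ball_in_body; exists r => // u u1.
have Kru : K (r *: u) by apply: hr; rewrite enormZ u1 mulr1 gtr0_norm.
have := le_supp_fun u bK Kru; rewrite dotZl -sqr_enorm u1 expr1n mulr1.
exact.
Qed.

Lemma rvleb_body : rvleb R n K = (volR K)%:E /\ 0 < volR K.
Proof.
have [r r0 hr] := ball_in_body.
have mK := compact_measurable_rv compK.
have [M hM] := iffLR (bounded_enormP _) bK.
have fK : rvleb R n K \is a fin_num.
  rewrite ge0_fin_numE; last exact: measure_ge0.
  exact: rvleb_bounded mK hM.
have KE : rvleb R n K = (volR K)%:E by rewrite /volR volE// fineK.
split => //; rewrite -lte_fin -KE.
apply: (@lt_le_trans _ _ (rvleb R n (eball r))).
  by rewrite rvleb_eball// lte_fin mulr_gt0 ?exprn_gt0// vball_gt0.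
by apply: le_measure; rewrite ?inE//; exact: measurable_eball.
Qed.

(** [fK] inverts a value chosen by [xget]. As some curvature exists at the normal [u], the chosen
    value is a genuine one, hence positive, and [supp_floating_lim] applies to it. *)
Lemma fK_root u : enorm u = 1 -> exists k, [/\ 0 < k, curv_at_normal K u (k ^+ n.+1) &
  1 / fK K u `^ (1 / n.+1%:R) = k].
Proof.
move=> u1; have [kap hkap] := curv_at_normal_exists compK C2K K0 u1.
rewrite /fK; have := @xgetPex _ 0 _ (ex_intro _ kap hkap).
move: (xget _ _) => kap' ck.
have k0 : 0 < kap' by case: ck => [x [U [F [bx [lF [_ ->]]]]]]; exact: curvK bx lF.
exists (kap' `^ (n.+1%:R^-1)); split.
- exact: powR_gt0.
- by rewrite powR_invn_exp// ltW.
rewrite !div1r -[kap'^-1]powR_inv1 ?(ltW k0)// -powRrM mulN1r powRN invrK//.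
Qed.

Let g u := 1 / (fK K u `^ (1 / n.+1%:R) * supp_fun K u ^+ n.+1).
Notation hat x := ((enorm x)^-1 *: x).

Lemma volume_difference_unif : exists a C s1, [/\ 0 < a, 0 < s1, 0 <= C &
  forall sigma, 0 < sigma < s1 ->
   let L := floating_body K (sigma ^+ n.+1) in
   L !=set0 /\ forall u, enorm u = 1 ->
     [/\ a <= supp_fun L u, a <= supp_fun K u &
      0 <= supp_fun K u - supp_fun L u <= C * sigma ^+ 2] ].
Proof.
have [r r0 hr] := supp_body_ge.
have [C [s0 [s00 C0 unif]]] := supp_floating_unif convK compK K0 C2K.
(* The third bound gives C sigma^2 <= r / 2, so the support function of the floating body keeps half
   of the lower bound [r] valid for K. *)
exists (r / 2), C, (Num.min s0 (Num.min 1 (r / 2 / (C + 1)))).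
have r20 : 0 < r / 2 by rewrite divr_gt0.
have C1 : 0 < C + 1 by rewrite ltr_wpDl.
split => //; first by rewrite !lt_min s00 ltr01 divr_gt0.
move=> sigma /andP[sp]; rewrite !lt_min => /andP[ss0 /andP[s1 sC]] L.
have ss : 0 < sigma < s0 by rewrite sp.
have e0 : delta_mx 0 ord0 != 0 :> 'rV[R]_n.
  by apply/eqP => /matrixP/(_ 0 ord0)/eqP; rewrite !mxE !eqxx oner_eq0.
have [L0 _] := unif sigma _ ss (enorm_normalize e0).
split => // u u1; have [_ hL] := unif sigma u ss u1.
have hK := hr u u1.
have Cs : C * sigma ^+ 2 <= r / 2.
  move: sC; rewrite ltr_pdivlMr// => sC; apply: le_trans (ltW sC).
  rewrite mulrC; apply: ler_pM; rewrite ?sqr_ge0 ?lerDl//.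
  by rewrite expr2 ger_pMr// ltW.
have hd : 0 <= supp_fun K u - supp_fun L u.
  by rewrite subr_ge0; exact: supp_floating_leK.
move: hL hK Cs hd; rewrite -/L.
move: (supp_fun K u) (supp_fun L u) (C * _) => p q w hL hK Cs hd.
by split; [lra|lra|apply/andP; split; lra].
Qed.



Lemma hat_unit (x : 'rV[R]_n) : pball 1 x -> enorm (hat x) = 1.
Proof. by move=> [x0 _]; apply: enorm_normalize; rewrite -enorm_gt0. Qed.

Lemma integrable_radial_polar (L : set 'rV[R]_n) a : bounded_set L -> L !=set0 ->
  0 < a -> (forall u, enorm u = 1 -> a <= supp_fun L u) ->
  (rvleb R n).-integrable (pball 1) (EFin \o (fun x => radial_polar L x ^+ n)).
Proof.
move=> bL L0 a0 La; apply/integrableP; split.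
  apply/measurable_EFinP; apply: measurable_funTS; apply: measurable_funX.
  exact: (@measurable_radial_polar _ _ _ bL L0 _ a0 La).
rewrite (eq_integral (fun x => (radial_polar L x ^+ n)%:E)).
  exact: (volR_polar bL L0 a0 La).2.
move=> x; rewrite inE => /hat_unit u1 /=; rewrite ger0_norm// exprn_ge0//.
by rewrite invr_ge0 (le_trans (ltW a0))// La.
Qed.

Lemma volR_polar_cvg : exists2 s1, 0 < s1 & forall sigma : nat -> R,
  (forall i, 0 < sigma i < s1) -> sigma i @[i --> \oo] --> (0 : R) ->
  gam ^+ 2 * ((volR (polar (floating_body K (sigma i ^+ n.+1))) - volR (polar K))
    / sigma i ^+ 2) @[i --> \oo] --> sphint g.
Proof.
have [a [C [s1 [a0 s10 C0 unif]]]] := volume_difference_unif.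
exists s1 => // sigma hs cs.
pose L i := floating_body K (sigma i ^+ n.+1).
have L0 i : L i !=set0 by have [] := unif _ (hs i).
have bL i : bounded_set (L i) by exact: bounded_floating.
have La i u : enorm u = 1 -> a <= supp_fun (L i) u.
  by move=> u1; have [_ /(_ u u1)[]] := unif _ (hs i).
have Ka u : enorm u = 1 -> a <= supp_fun K u.
  by move=> u1; have [_ /(_ u u1)[]] := unif _ (hs 0%N).
have sp i : 0 < sigma i by case/andP: (hs i).
have ssp i : 0 < sigma i ^+ 2 by rewrite exprn_gt0.
have g0 := @cap_scale_gt0 R m; have gg0 : 0 < gam ^+ 2 by rewrite exprn_gt0.
pose f i (x : 'rV[R]_n) := (radial_polar (L i) x ^+ n - radial_polar K x ^+ n) / sigma i ^+ 2.
(* The expected pointwise limit: [n] comes from differentiating h^-n, and 1 / gam^2 from the limit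
   of the support functions. *)
pose G (x : 'rV[R]_n) := n%:R / gam ^+ 2 * g (hat x).
have mp : measurable (@pball R n 1) by exact: measurable_pball.
have mL i : measurable_fun (@pball R n 1) (fun x => radial_polar (L i) x ^+ n).
  apply: measurable_funTS; apply: measurable_funX.
  exact: (@measurable_radial_polar _ _ _ (bL i) (L0 i) _ a0 (La i)).
have mK : measurable_fun (@pball R n 1) (fun x => radial_polar K x ^+ n).
  apply: measurable_funTS; apply: measurable_funX.
  exact: (@measurable_radial_polar _ _ _ bK K0 _ a0 Ka).
have mf i : measurable_fun (@pball R n 1) (f i).
  by apply: measurable_funM => //; apply: measurable_funB.
have cf x : pball 1 x -> f i x @[i --> \oo] --> G x.
  move=> /hat_unit u1; have [k [k0 ck kE]] := fK_root u1.
  have -> : G x = n%:R * (supp_fun K (hat x))^-1 ^+ n.+1 * (k / gam ^+ 2).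
    rewrite /G /g -kE !div1r [(_ `^ _ * _)^-1]invfM exprVn.
    by move: (_ `^ _)^-1 (_ ^+ n.+1)^-1 (gam ^+ 2)^-1 => p q r; ring.
  apply: (@invX_diff_cvg R m.+1 _ _ a C) => //; first exact: Ka.
  - by move=> i; exact: La.
  - rewrite -[X in _ --> X](expr0n R 2).
    exact: (cvg_comp _ _ cs (@exprn_continuous R 2 0)).
  apply/cvgrPdist_le => e e0.
  have vK : (0 < rvleb R n K)%E by have [-> ?] := rvleb_body; rewrite lte_fin.
  have [s2 s20 h2] := supp_floating_lim convK compK C2K curvK ck k0 vK e0.
  have /cvgrPdist_lt/(_ s2 s20) := cs.
  apply: filterS => i; rewrite sub0r normrN gtr0_norm// => si.
  by rewrite distrC; apply: h2; rewrite sp.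
pose B := C * (a^-1 ^+ 2 * (n%:R * a^-1 ^+ m.+1)).
have fB i x : pball 1 x -> `|f i x| <= B.
  move=> /hat_unit u1; have [_ /(_ _ u1)[h1 h2 h3]] := unif _ (hs i).
  exact: (@invX_diff_bound R m.+1 (supp_fun K (hat x)) (supp_fun (L i) (hat x))
    a C (sigma i ^+ 2) a0 h2 h1 (ssp i) h3).
have mpfin : (rvleb R n (pball 1) < +oo)%E.
  by apply: (rvleb_bounded (M := 1)) => // x [].
have iB : (rvleb R n).-integrable (pball 1) (EFin \o cst B).
  apply: measurable_bounded_integrable => //.
  exact: bounded_cst.
(* Since [fK] rests on a choice, [g] has no evident measurability; it is inherited from the
   pointwise limit and transferred back to [g] in [mg]. *)
have mG : measurable_fun (pball 1) G by exact: (measurable_fun_cvg mf cf).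
have mf' i : measurable_fun (pball 1) (EFin \o f i) by exact/measurable_EFinP.
have mG' : measurable_fun (pball 1) (EFin \o G) by exact/measurable_EFinP.
have cf' : {ae rvleb R n, forall x, pball 1 x ->
    (EFin \o f i) x @[i --> \oo] --> (EFin \o G) x}.
  by apply: aeW => x px; apply/fine_cvgP; split; [exact: nearW|exact: cf].
have fB' : {ae rvleb R n, forall x i, pball 1 x ->
    (`|(EFin \o f i) x| <= (EFin \o cst B) x)%E}.
  by apply: aeW => x i px; rewrite lee_fin; exact: fB.
have [iG _ cI] := dominated_convergence mp mf' mG' cf' iB fB'.
have fE i : (\int[rvleb R n]_(x in pball 1) (EFin \o f i) x)%E =
    ((volR (polar (L i)) - volR (polar K)) / sigma i ^+ 2)%:E.
  have iL := integrable_radial_polar (bL i) (L0 i) a0 (La i).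
  have iK := integrable_radial_polar bK K0 a0 Ka.
  rewrite (eq_integral (fun x => ((sigma i ^+ 2)^-1)%:E *
      ((radial_polar (L i) x ^+ n)%:E - (radial_polar K x ^+ n)%:E))%E); last first.
    by move=> x _; rewrite /= -EFinB -EFinM mulrC.
  rewrite integralZl//; last exact: (integrableB mp iL iK).
  rewrite (integralB_EFin mp iL iK).
  rewrite -(volR_polar (bL i) (L0 i) a0 (La i)).1 -(volR_polar bK K0 a0 Ka).1.
  by rewrite -EFinB -EFinM mulrC.
have n0 : n%:R / gam ^+ 2 != 0 by rewrite mulf_neq0// invr_eq0 gt_eqF.
have mg : measurable_fun (@pball R n 1) (fun x => g (hat x)).
  rewrite (_ : (fun x => _) = (fun x => (n%:R / gam ^+ 2)^-1 * G x)).
    by apply: measurable_funM.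
  by apply/funext => x; rewrite /G mulKf.
have gge0 x : pball 1 x -> 0 <= g (hat x).
  move=> /hat_unit u1; rewrite /g divr_ge0// mulr_ge0 ?powR_ge0// exprn_ge0//.
  by rewrite (le_trans (ltW a0))// Ka.
have gE : sphint g = n%:R * fine (\int[rvleb R n]_(x in pball 1) (g (hat x))%:E)%E.
  rewrite /sphint; congr (_ * fine _).
  have -> : (fun x : 'rV[R]_n => if (0 < enorm x) && (enorm x <= 1)
      then (g (hat x))%:E else 0%E) = (fun x => (g (hat x))%:E) \_ (pball 1).
    apply/funext => x; rewrite /patch; case: ifPn => [/andP[x0 x1]|hx].
      by rewrite ifT// inE.
    by rewrite ifF//; apply/negP; rewrite inE => -[x0 x1]; rewrite x0 x1 in hx.
  rewrite iintE; first by rewrite -integral_mkcond.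
    apply/(measurable_restrict _ mp measurableT); rewrite setTI.
    exact/measurable_EFinP.
  by move=> x; rewrite /patch; case: ifPn => //; rewrite inE => px; rewrite lee_fin gge0.
have GE : (\int[rvleb R n]_(x in pball 1) (EFin \o G) x)%E =
  ((n%:R / gam ^+ 2)%:E * \int[rvleb R n]_(x in pball 1) (g (hat x))%:E)%E.
  rewrite -ge0_integralZl_EFin//.
  - exact/measurable_EFinP.
  - by rewrite divr_ge0// ltW.
have cI' : (volR (polar (L i)) - volR (polar K)) / sigma i ^+ 2 @[i --> \oo] -->
    fine (\int[rvleb R n]_(x in pball 1) (EFin \o G) x)%E.
  apply: (@fine_cvg _ _ _ _
    (fun i => ((volR (polar (L i)) - volR (polar K)) / sigma i ^+ 2)%:E)).
  rewrite fineK; last exact: (integrable_fin_num mp iG).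
  rewrite -(funext fE : (fun i => _) = (fun i => _)).
  exact: cI.
have -> : sphint g = gam ^+ 2 * fine (\int[rvleb R n]_(x in pball 1) (EFin \o G) x)%E.
  have IE : (\int[rvleb R n]_(x in pball 1) (g (hat x))%:E =
      (n%:R / gam ^+ 2)^-1%:E * \int[rvleb R n]_(x in pball 1) (EFin \o G) x)%E.
    by rewrite GE muleA -EFinM mulVf// mul1e.
  rewrite gE IE fineM//; last exact: (integrable_fin_num mp iG).
  by rewrite /= invf_div mulrA [n%:R * _]mulrC divfK.
exact: cvgMl_tmp.
Qed.

End VolumeDifference.

Theorem theorem8 (R : realType) (n : nat) (K : set 'rV[R]_n) :
  (2 <= n)%N ->
  convex_body K -> santalo_at_origin K -> C2_boundary K -> pos_gauss_curv K ->
  (fun delta : R =>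
     2 * (vball R n.-1 / n.+1%:R) `^ (2 / n.+1%:R) *
     ((volR (polar (floating_body K (delta * volR K)))) - volR (polar K)) /
     (delta * volR K) `^ (2 / n.+1%:R))
    @ 0^'+ -->
  sphint (fun u : 'rV[R]_n =>
     1 / (fK K u `^ (1 / n.+1%:R) * supp_fun K u ^+ n.+1)).
Proof.
case: n K => [|[|m]] K // _ [convK [compK _]] [K0 _] C2K curvK.
have [s1 s10 hs1] := volR_polar_cvg convK compK C2K curvK K0.
have [_ V0] := rvleb_body compK K0.
(* Dominated convergence concerns sequences, so the one-sided limit is tested along sequences
   tending to 0 from the right. *)
apply/cvg_at_rightP => d [d0 cd].
pose sigma i := (d i * volR K) `^ (m.+3%:R^-1).
have dV i : 0 < d i * volR K by rewrite mulr_gt0.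
have sp i : 0 < sigma i by exact: powR_gt0.
have sX i : sigma i ^+ m.+3 = d i * volR K by rewrite powR_invn_exp// ltW.
have s2 i : sigma i ^+ 2 = (d i * volR K) `^ (2 / m.+3%:R).
  by rewrite /sigma -powR_mulrn ?powR_ge0// -powRrM [_^-1 * _]mulrC.
have cs : sigma i @[i --> \oo] --> (0 : R).
  have cdV : d i * volR K @[i --> \oo] --> (0 : R).
    by rewrite -(mul0r (volR K)); apply: cvgMr_tmp.
  apply/cvgrPdist_lt => e e0.
  have /cvgrPdist_lt/(_ (e ^+ m.+3)) := cdV; rewrite exprn_gt0// => /(_ isT).
  apply: filterS => i; rewrite !sub0r !normrN !gtr0_norm// -sX.
  by rewrite ltr_pXn2r ?nnegrE ?(ltW (sp i)) ?(ltW e0).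
have [N _ hN] : \forall i \near \oo, sigma i < s1.
  have /cvgrPdist_lt/(_ s1 s10) := cs.
  by apply: filterS => i; rewrite sub0r normrN gtr0_norm.
(* [hs1] asks for sigma below [s1] at every index, which holds only from [N] on. *)
rewrite -(cvg_shiftn N).
have h i : 0 < sigma (i + N)%N < s1 by rewrite sp/= hN//= leq_addl.
have := hs1 _ h; rewrite (cvg_shiftn N) => /(_ cs).
apply: cvg_trans; apply: near_eq_cvg; near=> i => /=.
by rewrite sX s2 cap_scale_sqr mulrA.
Unshelve. all: by end_near.
Qed.
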